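(* Let $\nu\in\mathbb R$ with $\nu\le-\frac12$. Then there exists a (nonempty) class of functions $(u_0,u_1)$ with $u_0,u_1\in C_0^\infty(\mathbb R^3)$ such that, for all sufficiently small $\delta>0$, the solution $u$ of the Cauchy problem $$\square u+u=(\partial_t u)^2\,\partial_1 u,\qquad u(0,x)=\delta^{\nu+1}u_0\left(\frac{x}{\delta}\right),\qquad \partial_t u(0,x)=\delta^{\nu}u_1\left(\frac{x}{\delta}\right)$$ for $t\ge 0$, $x\in\mathbb R^3$, blows up in finite time.
   Context: Notation: $x=(x_1,x_2,x_3)$, $\partial_1=\partial_{x_1}$, $\square=\partial_t^2-\Delta$ with $\Delta=\sum_{a=1}^3\partial_{x_a}^2$. The functions $u_0,u_1$ do not depend on $\delta$. ''Blows up in finite time'' means that the maximal time of existence $T^*$ of the classical solution $u\in C^2([0,T^* )\times\mathbb R^3)$ is finite. *)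

(* Defs.v *)
From HB Require Import structures.
From mathcomp Require Import all_boot all_order all_algebra.
From mathcomp Require Import all_classical all_reals all_analysis.

Set Implicit Arguments.
Unset Strict Implicit.
Unset Printing Implicit Defensive.

Import Order.TTheory GRing.Theory Num.Theory.
Import numFieldNormedType.Exports.

Local Open Scope classical_set_scope.
Local Open Scope ring_scope.

(* Partial derivatives relative to a set D: the increment is restricted to keep
   the point in D, so that at t = 0 the time derivative on [0, T) x R^3 is the
   right derivative, while at interior points it is the usual one (see
   [pderivE] below). *)
Definition within_quotient (R : realType) (n : nat) (D : set 'rV[R]_n)
    (i : 'I_n) (f : 'rV[R]_n -> R) (p : 'rV[R]_n) : set_system R :=
  (fun h : R => h^-1 * (f (p + h *: delta_mx 0 i) - f p)) @
    within [set h | D (p + h *: delta_mx 0 i)] 0^'.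

Definition pderivable (R : realType) (n : nat) (D : set 'rV[R]_n)
    (i : 'I_n) (f : 'rV[R]_n -> R) (p : 'rV[R]_n) : Prop :=
  cvg (within_quotient D i f p).

Definition pderiv (R : realType) (n : nat) (D : set 'rV[R]_n)
    (i : 'I_n) (f : 'rV[R]_n -> R) (p : 'rV[R]_n) : R :=
  lim (within_quotient D i f p).

Lemma within_quotientE (R : realType) (n : nat) (D : set 'rV[R]_n.+1)
    (i : 'I_n.+1) (f : 'rV[R]_n.+1 -> R) (p : 'rV[R]_n.+1) : D° p ->
  within_quotient D i f p =
  (fun h : R => h^-1 *: ((f \o shift p) (h *: delta_mx 0 i) - f p)) @ 0^'.
Proof.
move=> Dp; rewrite /within_quotient.
have HD : \forall h \near 0^', D (p + h *: delta_mx 0 i).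
  apply: (@nbhs_dnbhs R 0).
  have cv : (fun h : R => p + h *: (delta_mx 0 i : 'rV[R]_n.+1)) @ 0 --> p.
    rewrite -[X in _ --> X](addr0 p) -(scale0r (delta_mx 0 i)).
    by apply: cvgD; [exact: cvg_cst|apply: cvgZr_tmp; exact: cvg_id].
  exact: cv Dp.
have -> : within [set h | D (p + h *: delta_mx 0 i)] 0^' = (0 : R)^'.
  apply/seteqP; split => A.
    by rewrite /within /=; apply: filterS2 HD => h /= ? ; apply.
  by rewrite /within /=; apply: filterS => h /= Ah _.
suff -> : (fun h : R => h^-1 * (f (p + h *: delta_mx 0 i) - f p)) =
  (fun h : R => h^-1 *: ((f \o shift p) (h *: delta_mx 0 i) - f p)) by [].
by apply/funext => h /=; rewrite [p + _]addrC.
Qed.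

Lemma pderivableE (R : realType) (n : nat) (D : set 'rV[R]_n.+1)
    (i : 'I_n.+1) (f : 'rV[R]_n.+1 -> R) (p : 'rV[R]_n.+1) : D° p ->
  pderivable D i f p = derivable f p (delta_mx 0 i).
Proof. by move=> Dp; rewrite /pderivable within_quotientE. Qed.

Lemma pderivE (R : realType) (n : nat) (D : set 'rV[R]_n.+1)
    (i : 'I_n.+1) (f : 'rV[R]_n.+1 -> R) (p : 'rV[R]_n.+1) : D° p ->
  pderiv D i f p = 'D_(delta_mx 0 i) f p.
Proof. by move=> Dp; rewrite /pderiv within_quotientE. Qed.

Fixpoint Ck (R : realType) (n : nat) (D : set 'rV[R]_n) (k : nat)
    (f : 'rV[R]_n -> R) : Prop :=
  match k with
  | 0 => {within D, continuous f}
  | k'.+1 => {within D, continuous f} /\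
      forall i : 'I_n, (forall p, D p -> pderivable D i f p) /\
                       Ck D k' (pderiv D i f)
  end.

Definition Cc_infty (R : realType) (n : nat) (f : 'rV[R]_n -> R) : Prop :=
  (forall k, Ck setT k f) /\ compact (closure [set x | f x != 0]).

(* Space-time points (t, x) are row vectors of size 1 + 3, with time as
   coordinate 0. *)
Definition event (R : realType) (t : R) (x : 'rV[R]_3) : 'rV[R]_(1 + 3) :=
  row_mx t%:M x.

Definition time_slab (R : realType) (T : R) : set 'rV[R]_(1 + 3) :=
  [set p | 0 <= p 0 0 < T].

Definition dt (R : realType) (T : R) (u : 'rV[R]_(1 + 3) -> R) :=
  pderiv (time_slab T) (lshift 3 ord0) u.

Definition dx (R : realType) (T : R) (a : 'I_3) (u : 'rV[R]_(1 + 3) -> R) :=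
  pderiv (time_slab T) (rshift 1 a) u.

Definition dalembertian (R : realType) (T : R) (u : 'rV[R]_(1 + 3) -> R)
    (p : 'rV[R]_(1 + 3)) : R :=
  dt T (dt T u) p - \sum_(a < 3) dx T a (dx T a u) p.

(* The spatial variable x_1 has index 0 in 'I_3. *)
Definition classical_solution (R : realType) (f g : 'rV[R]_3 -> R) (T : R)
    (u : 'rV[R]_(1 + 3) -> R) : Prop :=
  [/\ 0 < T,
      Ck (time_slab T) 2 u,
      (forall t x, 0 <= t < T ->
         let p := event t x in
         dalembertian T u p + u p = dt T u p ^+ 2 * dx T ord0 u p),
      (forall x, u (event 0 x) = f x) &
      (forall x, dt T u (event 0 x) = g x)].

Definition max_existence_time (R : realType) (f g : 'rV[R]_3 -> R) : \bar R :=
  ereal_sup [set T%:E | T in [set T | exists u, classical_solution f g T u]].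

(* The maximal time is finite and is realized by a classical solution on
   [0, T) x R^3; in particular a solution exists, so that the supremum is not
   taken over the empty set. *)
Definition blows_up_in_finite_time (R : realType) (f g : 'rV[R]_3 -> R) : Prop :=
  exists (T : R) (u : 'rV[R]_(1 + 3) -> R),
    max_existence_time f g = T%:E /\ classical_solution f g T u.

(* Main.v *)
Require Import Defs.
From mathcomp Require Import all_boot all_order all_algebra.
From mathcomp Require Import all_classical all_reals all_analysis.
From mathcomp Require Import ring lra.
Import Order.TTheory GRing.Theory Num.Theory.
Import numFieldNormedType.Exports.
Local Open Scope classical_set_scope.
Local Open Scope ring_scope.
(** Why solutions blow up.  Near the origin the data are, in the first space
    variable, a power: u = (B/40) x^16 and u_t = (3/5) B x^15 on a cube of side
    proportional to delta, where B is of size delta^(nu - 15).  By finite speed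
    of propagation the solution there depends on (t, x_1) only, and with
    p = u_t + u_x, q = u_t - u_x and F = (p + q)^2 (p - q) / 8 - u the equation
    becomes a system along characteristics: p changes at rate F when x + t is
    fixed, q changes at rate F when x - t is fixed.  As long as p dominates q,
    F is at least p^3 / 24, so that p obeys a Riccati-type inequality and
    becomes infinite after a time of order p^-2 (blowup_time).  The length L of
    the interval considered is fixed by B^2 L^31 = 50: the initial value of
    p^2 L is then 50, and a time L/4 is too long.  The condition
    nu <= -1/2 enters through delta^(2 nu + 1) >= 1, which is what makes L
    smaller than the cube on which the data are powers.

    That p dominates q is a trapping argument (trapped_all).  Next to p and q it
    follows their x-derivatives, and the quantities p_x - F and 3 q_x - F, whose
    derivatives along their own characteristics are the same function V; inside
    the trapped region V is nonnegative, so the inequalities improve and a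
    continuous induction on the triangle of dependence propagates them from
    time 0, where they are elementary inequalities for powers
    (power_data_trapped).

    A finite maximal time also requires a solution to exist, and the supremum
    of the existence times to be attained.  Uniqueness in backward light cones
    (cone_uniqueness) is proved with a weighted energy: the weight is
    exp(-lam t) times the square of the positive part of
    (rho - t)^2 - |x - x0|^2, and it is integrated against a positive,
    translation-invariant functional obtained as an ultrafilter limit of Riemann
    sums; the only properties of an integral that are used are positivity and the
    vanishing on derivatives of functions supported inside the box.  Uniqueness
    gives the plane symmetry above, glues solutions along their common domain, and
    shows that truncating a periodic solution outside the support of the data
    yields a solution (truncated_solution).  Periodic solutions come from Picard iteration
    among absolutely convergent sums of plane waves a(t) cos(xi.x + alpha)
    (local_existence): with the weight 1 + |xi|^2 on coefficients, first
    derivatives of u lie in an algebra, and Duhamel's formula is explicit for each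
    wave.  The data are such sums because a smooth function supported in [-1, 1]
    has Fourier coefficients of order k^-4; this is proved on a grid, where
    inversion is an identity between finite sums and decay is summation by parts,
    and passes to the limit (fourier_partial). *)

Set Implicit Arguments.
Unset Strict Implicit.
Unset Printing Implicit Defensive.

(** * One-variable calculus and mixed derivatives *)

Section Calculus1.
Context {R : realType}.
Implicit Types (f df : R -> R) (a b x y d e m : R).

Lemma is_derive1_epsP f x d : is_derive x 1 f d <->
  forall e, 0 < e -> exists2 r, 0 < r &
    forall h, `|h| < r -> `|f (x + h) - f x - d * h| <= e * `|h|.
Proof.
split=> [[df fd] e e0|H].
  have /cvgrPdist_le /(_ e e0) : (fun h : R => h^-1 *: ((f \o shift x) (h *: 1) - f x)) @ 0^' --> d.
    by rewrite -fd; exact: df.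
  rewrite near_withinE near_simpl => /nbhs_ballP[r /= r0 Hr].
  exists r => // h hr; have [->|h0] := eqVneq h 0.
    by rewrite addr0 mulr0 subr0 subrr normr0 mulr0.
  have /= := Hr h; rewrite /ball /= sub0r normrN => /(_ hr h0) H.
  rewrite -ler_pdivrMr ?normr_gt0// -normrV ?unitfE// -normrM distrC in H *.
  apply: le_trans H; rewrite le_eqVlt; apply/orP; left; apply/eqP; congr (`|_|).
  by rewrite /GRing.scale/= mulr1 (addrC h x) mulrBl mulrK ?unitfE// mulrC.
suff C : (fun h : R => h^-1 *: ((f \o shift x) (h *: 1) - f x)) @ 0^' --> d.
  split; first by apply/cvg_ex; exists d.
  exact: cvg_lim C.
apply/cvgrPdist_le => e e0; have [r r0 Hr] := H e e0.
rewrite near_withinE near_simpl; apply/nbhs_ballP; exists r => //= h.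
rewrite /ball /= sub0r normrN => hr h0; have := Hr h hr.
rewrite -ler_pdivrMr ?normr_gt0// -normrV ?unitfE// -normrM distrC => H1.
apply: le_trans H1; rewrite le_eqVlt; apply/orP; left; apply/eqP; congr (`|_|).
by rewrite /GRing.scale/= mulr1 (addrC h x) mulrBl mulrK ?unitfE// mulrC.
Qed.

Lemma cont1_epsP f x : {for x, continuous f} <->
  forall e, 0 < e -> exists2 r, 0 < r & forall y, `|y - x| < r -> `|f y - f x| < e.
Proof.
split=> [/cvgrPdist_lt H e e0|H].
  have /nbhs_ballP[r /= r0 Hr] := H e e0; exists r => // y yx.
  by rewrite distrC; apply: Hr; rewrite /ball/= distrC.
apply/cvgrPdist_lt => e /H[r r0 Hr]; apply/nbhs_ballP; exists r => //= y.
by rewrite /ball/= distrC => /Hr; rewrite distrC.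
Qed.

Lemma derive_cont1 f x d : is_derive x 1 f d -> {for x, continuous f}.
Proof. by move=> [H _]; apply/differentiable_continuous/derivable1_diffP. Qed.

Lemma within_itv_cont f a b : (forall x, a <= x <= b -> {for x, continuous f}) ->
  {within `[a, b], continuous f}.
Proof.
by move=> H; apply: continuous_in_subspaceT => x /set_mem /=; rewrite in_itv/=; exact: H.
Qed.

Lemma mean_value f df a b : a <= b ->
  (forall x, a <= x <= b -> {for x, continuous f}) ->
  (forall x, a < x < b -> is_derive x 1 f (df x)) ->
  exists2 c, a <= c <= b & (a < b -> a < c < b) /\ f b - f a = df c * (b - a).
Proof.
rewrite le_eqVlt => /predU1P[<- _ _|ab cf Df].
  by exists a; rewrite ?lexx// ltxx !subrr mulr0.
have Df' x : x \in `]a, b[%R -> is_derive x 1 f (df x) by rewrite in_itv => /Df.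
have [c cab fE] := MVT ab Df' (within_itv_cont cf).
move: cab; rewrite in_itv/= => /andP[ac cb].
by exists c => //; rewrite ?(ltW ac) ?(ltW cb)//; split => // _; rewrite ac cb.
Qed.

Lemma mean_value_le f df a b m e : a <= b ->
  (forall x, a <= x <= b -> {for x, continuous f}) ->
  (forall x, a < x < b -> is_derive x 1 f (df x)) ->
  (forall x, a < x < b -> `|df x - m| <= e) ->
  `|f b - f a - m * (b - a)| <= e * (b - a).
Proof.
move=> ab cf Df He; have [c cab [cl ->]] := mean_value ab cf Df.
move: ab; rewrite le_eqVlt => /predU1P[->|ab]; first by rewrite !subrr !mulr0 subrr normr0.
by rewrite -mulrBl normrM (gtr0_norm (_ : 0 < b - a)) ?subr_gt0// ler_wpM2r ?subr_ge0 ?(ltW ab)// He// cl.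
Qed.

Lemma mean_value_le0 f df s m e :
  (forall x, `|x| <= `|s| -> is_derive x 1 f (df x)) ->
  (forall x, `|x| <= `|s| -> `|df x - m| <= e) ->
  `|f s - f 0 - m * s| <= e * `|s|.
Proof.
move=> Df He; have [s0|s0] := leP 0 s.
  have := @mean_value_le f df 0 s m e s0; rewrite subr0 (ger0_norm s0); apply.
  - by move=> x /andP[x0 xs]; apply: derive_cont1; apply: Df; rewrite !ger0_norm.
  - by move=> x /andP[/ltW x0 /ltW xs]; apply: Df; rewrite !ger0_norm.
  - by move=> x /andP[/ltW x0 /ltW xs]; apply: He; rewrite !ger0_norm.
have := @mean_value_le f df s 0 m e (ltW s0); rewrite sub0r (ltr0_norm s0) !mulrN opprK.
rewrite (_ : f s - f 0 - _ = - (f 0 - f s + m * s)); last by ring.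
rewrite normrN; apply.
- by move=> x /andP[xs x0]; apply: derive_cont1; apply: Df; rewrite !ler0_norm ?lerN2// ltW.
- by move=> x /andP[/ltW xs /ltW x0]; apply: Df; rewrite !ler0_norm ?lerN2// ltW.
- by move=> x /andP[/ltW xs /ltW x0]; apply: He; rewrite !ler0_norm ?lerN2// ltW.
Qed.

Lemma nondecr_derive f df a b : a <= b ->
  (forall x, a <= x <= b -> {for x, continuous f}) ->
  (forall x, a < x < b -> is_derive x 1 f (df x)) ->
  (forall x, a < x < b -> 0 <= df x) -> f a <= f b.
Proof.
move=> ab cf Df He; have [c cab [cl fE]] := mean_value ab cf Df.
rewrite -subr_ge0 fE; move: ab; rewrite le_eqVlt => /predU1P[->|ab]; first by rewrite subrr mulr0.
by rewrite mulr_ge0 ?subr_ge0 ?(ltW ab)// He// cl.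
Qed.

End Calculus1.

Section Calculus2.
Context {R : realType}.
Implicit Types (F G : R -> R -> R).

(** Mixed derivatives commute as soon as one of them exists and is continuous:
    the increment of F over a small rectangle, computed with the mean value
    theorem in the first variable and then in the second, is close to Gh 0 0
    times its area. *)
Lemma derive_swap F G (Fh : R -> R) (Gh : R -> R -> R) (r : R) : 0 < r ->
  (forall (s h : R), `|s| < r -> `|h| < r -> is_derive s 1 (F ^~ h) (G s h)) ->
  (forall s : R, `|s| < r -> is_derive (0 : R) 1 (F s) (Fh s)) ->
  (forall (s h : R), `|s| < r -> `|h| < r -> is_derive h 1 (G s) (Gh s h)) ->
  (forall e, 0 < e -> exists2 d, 0 < d & forall (s h : R), `|s| < d -> `|h| < d ->
     `|Gh s h - Gh 0 0| < e) ->
  is_derive (0 : R) 1 Fh (Gh 0 0).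
Proof.
move=> r0 DF DFh DG cG; apply/is_derive1_epsP => e e0.
have [d d0 Hd] := cG e e0; exists (Num.min r d); first by rewrite lt_min r0.
move=> s; rewrite lt_min => /andP[sr sd]; rewrite add0r.
have K h : `|h| < r -> `|h| < d ->
   `|(F s h - F 0 h) - (F s 0 - F 0 0) - Gh 0 0 * h * s| <= e * `|h| * `|s|.
  move=> hr hd; pose f s := F s h - F s 0.
  rewrite (_ : _ - _ - _ = f s - f 0 - Gh 0 0 * h * s); last by rewrite /f; ring.
  apply: (@mean_value_le0 R f (fun s => G s h - G s 0)) => x xs.
    apply: is_deriveB; apply: DF; rewrite ?normr0//; exact: le_lt_trans xs _.
  apply: (@mean_value_le0 R (G x) (Gh x)) => y yh.
    apply: DG; first exact: le_lt_trans xs _.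
    exact: le_lt_trans yh _.
  apply/ltW/Hd; first exact: le_lt_trans xs _.
  exact: le_lt_trans yh _.
apply/ler_addgt0Pr => k k0; set k' := k / 2.
have k'0 : 0 < k' by rewrite divr_gt0.
have /is_derive1_epsP/(_ _ k'0)[r1 r10 H1] := DFh s sr.
have /is_derive1_epsP/(_ _ k'0)[r2 r20 H2] := DFh 0 (eq_ind_r (fun z => z < r) r0 (normr0 R)).
pose h := Num.min (Num.min r d) (Num.min r1 r2) / 2.
have h0 : 0 < h by rewrite divr_gt0// !lt_min r0 d0 r10 r20.
have hM : h < Num.min (Num.min r d) (Num.min r1 r2).
  by rewrite /h; set z := Num.min _ _ in h0 *; move: h0; rewrite /h -/z; lra.
move: hM; rewrite !lt_min => /andP[/andP[hr hd] /andP[hr1 hr2]].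
have hn : `|h| = h by rewrite gtr0_norm.
have := K h; rewrite hn => /(_ hr hd) HK.
have := H1 h; rewrite hn add0r => /(_ hr1) {}H1.
have := H2 h; rewrite hn add0r => /(_ hr2) {}H2.
rewrite -(ler_pM2r h0) -{1}hn -normrM.
have -> : (Fh s - Fh 0 - Gh 0 0 * s) * h =
  ((F s h - F 0 h) - (F s 0 - F 0 0) - Gh 0 0 * h * s) - (F s h - F s 0 - Fh s * h) +
  (F 0 h - F 0 0 - Fh 0 * h) by ring.
apply: le_trans (ler_normD _ _) _; apply: le_trans (lerD (ler_normB _ _) (lexx _)) _.
apply: le_trans (lerD (lerD HK H1) H2) _.
have -> : e * h * `|s| + k' * h + k' * h = (e * `|s| + k) * h by rewrite /k'; field.
exact: lexx.
Qed.

(** Continuity of one of the two partial derivatives suffices for the chain rule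
    along a line. *)
Lemma derive_diag F (Fs : R -> R) (Fh : R -> R -> R) (r a b : R) : 0 < r ->
  (forall s : R, `|s| < r -> is_derive s 1 (F ^~ 0) (Fs s)) ->
  (forall (s h : R), `|s| < r -> `|h| < r -> is_derive h 1 (F s) (Fh s h)) ->
  (forall e, 0 < e -> exists2 d, 0 < d & forall (s h : R), `|s| < d -> `|h| < d ->
     `|Fh s h - Fh 0 0| < e) ->
  is_derive (0 : R) 1 (fun s => F (a * s) (b * s)) (a * Fs 0 + b * Fh 0 0).
Proof.
move=> r0 DFs DFh cF; apply/is_derive1_epsP => e e0.
have e1 : 0 < e / (`|a| + `|b| + 1) by rewrite divr_gt0// ltr_wpDl// addr_ge0.
set e' := e / _ in e1.
have [d d0 Hd] := cF e' e1.
have /is_derive1_epsP/(_ _ e1)[r1 r10 H1] := DFs 0 (eq_ind_r (fun z => z < r) r0 (normr0 R)).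
pose m := Num.min r (Num.min d r1).
have m0 : 0 < m by rewrite !lt_min r0 d0 r10.
have ab0 : 0 < `|a| + `|b| + 1 by rewrite ltr_wpDl// addr_ge0.
exists (m / (`|a| + `|b| + 1)); first by rewrite divr_gt0.
move=> s; rewrite ltr_pdivlMr// => sm; rewrite add0r !mulr0.
have am : `|a * s| < m.
  rewrite normrM mulrC; apply: le_lt_trans sm; rewrite ler_wpM2l//.
  by rewrite -addrA lerDl addr_ge0.
have bm : `|b * s| < m.
  rewrite normrM mulrC; apply: le_lt_trans sm; rewrite ler_wpM2l//.
  by rewrite addrAC lerDr addr_ge0.
move: (am) (bm); rewrite !lt_min => /and3P[asr asd asr1] /and3P[bsr bsd bsr1].
have := @mean_value_le0 R (F (a * s)) (Fh (a * s)) (b * s) (Fh 0 0) e'.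
have := H1 _ asr1; rewrite add0r => {}H1 H2.
have {}H2 : `|F (a * s) (b * s) - F (a * s) 0 - Fh 0 0 * (b * s)| <= e' * `|b * s|.
  apply: H2 => x xb; first by apply: DFh => //; exact: le_lt_trans xb _.
  by apply/ltW/Hd => //; exact: le_lt_trans xb _.
rewrite (_ : _ - _ = (F (a * s) (b * s) - F (a * s) 0 - Fh 0 0 * (b * s)) +
   (F (a * s) 0 - F 0 0 - Fs 0 * (a * s))); last by ring.
apply: le_trans (ler_normD _ _) _; apply: le_trans (lerD H2 H1) _.
rewrite !normrM -mulrDr -mulrDl mulrA ler_wpM2r//.
rewrite /e' -mulrA ler_piMr ?(ltW e0)// mulrC ler_pdivrMr// mul1r (addrC `|b|) lerDl//.
Qed.

End Calculus2.

Section Lines.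
Context {R : realType} {n : nat}.
Implicit Types (f : 'rV[R]_n -> R) (p v : 'rV[R]_n).

Lemma is_derive_line f p v (s d : R) :
  is_derive (p + s *: v) v f d <-> is_derive s 1 (fun h => f (p + h *: v)) d.
Proof.
have E : (fun h : R => h^-1 *: ((f \o shift (p + s *: v)) (h *: v) - f (p + s *: v))) =
  (fun h : R => h^-1 *: (((fun h => f (p + h *: v)) \o shift s) (h *: 1) - f (p + s *: v))).
  apply/funext => h /=; congr (_ *: (f _ - _)).
  have -> : h%:A = h :> R by rewrite /GRing.scale/= mulr1.
  by rewrite scalerDl addrCA.
by split=> -[H1 H2]; split; move: H1 H2; rewrite /derivable /derive E.
Qed.

Lemma is_derive_line0 f p v (d : R) :
  is_derive p v f d <-> is_derive (0 : R) 1 (fun h => f (p + h *: v)) d.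
Proof. by rewrite -is_derive_line scale0r addr0. Qed.

Lemma rV_norm_lt m (p : 'rV[R]_m) d : 0 < d -> `|p| < d <-> (forall i, `|p 0 i| < d).
Proof.
move=> d0; have := @mx_norm_ball R 1 m; move=> /(congr1 (fun b => b 0 d p)).
rewrite /ball_ /= sub0r normrN => <-; split=> [[_ H] i|H].
  by have := H 0 i; rewrite /ball/= mxE sub0r normrN.
by split=> // i j; rewrite ord1 /ball/= mxE sub0r normrN.
Qed.

(** Only the coordinates matter, so that later estimates never mention the norm
    of row vectors. *)
Lemma within_epsP m (D : set 'rV[R]_m) (f : 'rV[R]_m -> R) : {within D, continuous f} <->
  forall p : 'rV[R]_m, D p -> forall e : R, 0 < e -> exists2 d : R, 0 < d &
    forall q, D q -> (forall i, `|q 0 i - p 0 i| < d) -> `|f q - f p| < e.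
Proof.
split=> [/subspace_continuousP H p Dp e e0|H].
  have /cvgrPdist_lt/(_ e e0) := H p Dp; rewrite near_withinE near_simpl.
  move=> /nbhs_ballP[d /= d0 Hd]; exists d => // q Dq qp.
  rewrite distrC; apply: Hd => //; rewrite mx_norm_ball /ball_/= distrC.
  by apply/rV_norm_lt => // i; rewrite !mxE.
apply/subspace_continuousP => p Dp; apply/cvgrPdist_lt => e /(H p Dp)[d d0 Hd].
rewrite near_withinE near_simpl; apply/nbhs_ballP; exists d => //= q.
rewrite mx_norm_ball /ball_/= distrC => /rV_norm_lt - /(_ d0) qp Dq.
by rewrite distrC; apply: Hd => // i; have := qp i; rewrite !mxE.
Qed.

End Lines.

(** * A translation-invariant positive functional on boxes *)

Section Ulim.
Context {R : realType}.
Implicit Types (s t : nat -> R).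

Lemma ultra_eventually_ex : exists U : set_system nat, UltraFilter U /\ \oo `<=` U.
Proof. exact: ultraFilterLemma. Qed.

(** A limit of every bounded sequence, additive and monotone, is obtained by
    choosing an ultrafilter once and for all. *)
Definition ultra_nat : set_system nat := projT1 (cid ultra_eventually_ex).

#[local] Instance ultra_nat_ultra : UltraFilter ultra_nat.
Proof. by rewrite /ultra_nat; case: cid => U []. Qed.

Lemma ultra_nat_oo : \oo `<=` ultra_nat.
Proof. by rewrite /ultra_nat; case: cid => U []. Qed.

Definition ulim s : R := lim (s @ ultra_nat).

Definition bounded_seq s := exists M, forall n, `|s n| <= M.

Lemma ulim_cvg s : bounded_seq s -> s @ ultra_nat --> ulim s.
Proof.
move=> [M sM]; suff : cvg (s @ ultra_nat) by [].
have [|x [_ xs]] := @segment_compact R (- M) M (s @ ultra_nat) _.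
  rewrite /fmap/=; apply: (@filterE _ ultra_nat) => n /=; rewrite in_itv/= -ler_norml; exact: sM.
apply/cvg_ex; exists x => B Bx.
have [//|nB] := in_ultra_setVsetC (s @^-1` B) ultra_nat_ultra.
by have [y []] := xs (~` B) B nB Bx.
Qed.

Lemma bounded_seqD s t : bounded_seq s -> bounded_seq t -> bounded_seq (fun n => s n + t n).
Proof.
move=> [M sM] [N tN]; exists (M + N) => n.
by apply: le_trans (ler_normD _ _) _; rewrite lerD.
Qed.

Lemma bounded_seqZ s c : bounded_seq s -> bounded_seq (fun n => c * s n).
Proof. by move=> [M sM]; exists (`|c| * M) => n; rewrite normrM ler_wpM2l. Qed.

Lemma ulimD s t : bounded_seq s -> bounded_seq t -> ulim (fun n => s n + t n) = ulim s + ulim t.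
Proof.
by move=> /ulim_cvg cs /ulim_cvg ct; apply: cvg_lim => //; exact: cvgD cs ct.
Qed.

Lemma ulimZ s c : bounded_seq s -> ulim (fun n => c * s n) = c * ulim s.
Proof. by move=> /ulim_cvg cs; apply: cvg_lim => //; exact: cvgM (cvg_cst c) cs. Qed.

Lemma ulim_ge s m : bounded_seq s -> (\forall n \near \oo, m <= s n) -> m <= ulim s.
Proof.
move=> /ulim_cvg cs H; have := ultra_nat_oo H => H'.
by apply: (@limr_ge _ _ _ _ m s) => //; apply/cvg_ex; exists (ulim s).
Qed.

Lemma ulim_le s m : bounded_seq s -> (\forall n \near \oo, s n <= m) -> ulim s <= m.
Proof.
move=> /ulim_cvg cs H; have := ultra_nat_oo H => H'.
by apply: (@limr_le _ _ _ _ m s) => //; apply/cvg_ex; exists (ulim s).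
Qed.

Lemma ulim_eq s t : bounded_seq s -> bounded_seq t -> (\forall n \near \oo, s n = t n) -> ulim s = ulim t.
Proof.
move=> bs bt H; apply/eqP; rewrite -subr_eq0 -mulN1r -ulimZ// -ulimD//; last exact: bounded_seqZ.
have bd : bounded_seq (fun n => s n + -1 * t n) by apply: bounded_seqD => //; exact: bounded_seqZ.
rewrite eq_le ulim_le//=; first by rewrite ulim_ge//; apply: filterS H => n ->; rewrite mulN1r subrr.
by apply: filterS H => n ->; rewrite mulN1r subrr.
Qed.

End Ulim.

Section Functional1.
Context {R : realType}.
Variable N : nat.
Implicit Types (f g : R -> R).

Definition bounded_fct T (f : T -> R) := exists M, forall x, `|f x| <= M.

Lemma bounded_fct_ge0 T (f : T -> R) : bounded_fct f -> exists2 M, 0 <= M & forall x, `|f x| <= M.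
Proof.
move=> [M fM]; exists (Num.max 0 M); first by rewrite le_max lexx.
by move=> x; apply: le_trans (fM x) _; rewrite le_max lexx orbT.
Qed.

(** Riemann invariants of the wave operator: for c = -1 this is p, constant
    along x + t for free waves, and for c = 1 it is q. *)
Definition riemann_sum f n : R :=
  (2 ^+ n)^-1 * \sum_(0 <= k < N.*2 * 2 ^ n) f (k%:R / 2 ^+ n - N%:R).

Lemma riemann_sum_le f M n : 0 <= M -> (forall x, `|f x| <= M) -> `|riemann_sum f n| <= N.*2%:R * M.
Proof.
move=> M0 fM; rewrite /riemann_sum normrM gtr0_norm ?invr_gt0 ?exprn_gt0//.
rewrite mulrC ler_pdivrMr ?exprn_gt0//; apply: le_trans (ler_norm_sum _ _ _) _.
apply: le_trans (ler_sum _ (fun k _ => fM _)) _.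
by rewrite sumr_const_nat subn0 -[X in X <= _]mulr_natl natrM natrX mulrAC.
Qed.

Lemma riemann_sum_bounded f : bounded_fct f -> bounded_seq (riemann_sum f).
Proof.
by move=> /bounded_fct_ge0[M M0 fM]; exists (N.*2%:R * M) => n; exact: riemann_sum_le.
Qed.

Lemma riemann_sumD f g n : riemann_sum (fun x => f x + g x) n = riemann_sum f n + riemann_sum g n.
Proof. by rewrite /riemann_sum big_split mulrDr. Qed.

Lemma riemann_sumZ f c n : riemann_sum (fun x => c * f x) n = c * riemann_sum f n.
Proof. by rewrite /riemann_sum -mulr_sumr mulrCA. Qed.

Lemma riemann_sum_ge0 f n : (forall x, 0 <= f x) -> 0 <= riemann_sum f n.
Proof. by move=> f0; rewrite mulr_ge0 ?invr_ge0 ?exprn_ge0// sumr_ge0. Qed.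

Lemma riemann_sum_shift f j n : (j <= n)%N -> (forall x, N%:R - 1 <= `|x| -> f x = 0) ->
  riemann_sum (fun x => f (x + (2 ^+ j)^-1)) n = riemann_sum f n.
Proof.
move=> jn f0; rewrite /riemann_sum; congr (_ * _).
have [N0|N0] := posnP N; first by rewrite N0 mul0n !big_geq.
set K := (N.*2 * 2 ^ n)%N; pose m := (2 ^ (n - j))%N.
have n0 : 2 ^+ n != 0 :> R by rewrite expf_neq0.
pose F k := f (k%:R / 2 ^+ n - N%:R).
have -> : \sum_(0 <= k < K) f (k%:R / 2 ^+ n - N%:R + (2 ^+ j)^-1) = \sum_(0 <= k < K) F (k + m)%N.
  apply: eq_bigr => k _; rewrite /F; congr f; rewrite natrD mulrDl addrAC; congr (_ + _ - _).
  by rewrite /m natrX exprB// ?unitfE// mulrAC mulfV// mul1r.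
rewrite -[RHS]/(\sum_(0 <= k < K) F k).
have E1 : \sum_(0 <= k < m + K) F k = \sum_(0 <= k < K) F (k + m)%N.
  rewrite (@big_cat_nat _ _ _ m) ?leq_addr//= big_nat big1 ?add0r; last first.
    move=> k /andP[_ km]; apply: f0.
    have xk : k%:R / 2 ^+ n <= 1 :> R.
      rewrite ler_pdivrMr ?exprn_gt0// mul1r -natrX ler_nat (leq_trans (ltnW km))//.
      by rewrite leq_exp2l// leq_subr.
    by rewrite ler0_norm ?opprB ?lerB// subr_le0 (le_trans xk)// ler1n.
  by rewrite -{1}[m]add0n (addnC m) big_addn addnK.
rewrite -E1 addnC (@big_cat_nat _ _ _ K) ?leq_addr//= [X in _ + X]big_nat [X in _ + X]big1 ?addr0//.
move=> k /andP[Kk _]; apply: f0.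
have xk : N.*2%:R <= k%:R / 2 ^+ n :> R.
  by rewrite ler_pdivlMr ?exprn_gt0// -natrX -natrM ler_nat.
apply: le_trans (ler_norm _); rewrite lerBrDr addrAC -addrA.
apply: le_trans xk; rewrite -addnn natrD lerD2l gerBl//.
Qed.

(** Limits of Riemann sums along the ultrafilter exist without any regularity of
    the integrand, hence so does the iterated functional box_integral; shifts by
    a mesh length still leave it invariant for functions supported well inside
    the box. *)
Definition interval_integral f : R := ulim (riemann_sum f).

Lemma interval_integralD f g : bounded_fct f -> bounded_fct g -> interval_integral (fun x => f x + g x) = interval_integral f + interval_integral g.
Proof.
move=> /riemann_sum_bounded bf /riemann_sum_bounded bg; rewrite /interval_integral -(ulimD bf bg).
by congr ulim; apply/funext => n; rewrite riemann_sumD.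
Qed.

Lemma interval_integralZ f c : bounded_fct f -> interval_integral (fun x => c * f x) = c * interval_integral f.
Proof.
move=> /riemann_sum_bounded bf; rewrite /interval_integral -(ulimZ c bf).
by congr ulim; apply/funext => n; rewrite riemann_sumZ.
Qed.

Lemma interval_integral_ge0 f : bounded_fct f -> (forall x, 0 <= f x) -> 0 <= interval_integral f.
Proof.
move=> bf f0; apply: ulim_ge; first exact: riemann_sum_bounded.
by apply: nearW => n; exact: riemann_sum_ge0.
Qed.

Lemma interval_integral_norm_le f M : 0 <= M -> (forall x, `|f x| <= M) -> `|interval_integral f| <= N.*2%:R * M.
Proof.
move=> M0 fM; have bf : bounded_fct f by exists M.
have bs := riemann_sum_bounded bf.
rewrite ler_norml; apply/andP; split; [apply: ulim_ge => //|apply: ulim_le => //];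
  by apply: nearW => n; have := riemann_sum_le n M0 fM; rewrite ler_norml => /andP[].
Qed.

Lemma interval_integral_shift f j : bounded_fct f -> (forall x, N%:R - 1 <= `|x| -> f x = 0) ->
  interval_integral (fun x => f (x + (2 ^+ j)^-1)) = interval_integral f.
Proof.
move=> bf f0; apply: ulim_eq; try exact: riemann_sum_bounded.
  by move: bf => [M fM]; apply: riemann_sum_bounded; exists M.
near=> n; apply: riemann_sum_shift => //; near: n; exact: nbhs_infty_ge.
Unshelve. all: by end_near. Qed.

(** The constant k does not depend on f or c: box_integral_gt0 applies the lemma
    with f an integral over the remaining coordinates. *)
Lemma interval_integral_gt0 (p r : R) : 0 < r -> `|p| < N%:R -> exists2 k, 0 < k &
  forall f c, bounded_fct f -> (forall x, 0 <= f x) -> 0 <= c ->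
    (forall x, `|x - p| <= r -> c <= f x) -> c * k <= interval_integral f.
Proof.
move=> r0 pN.
have [j jr] : exists j : nat, (2 ^+ j)^-1 < r.
  have [j _ Hj] := near_infty_natSinv_expn_lt (PosNum r0).
  by exists j; have := Hj j (leqnn j); rewrite div1r.
have p0 : 0 <= p + N%:R by move: pN; rewrite ltr_norml; lra.
pose i := Num.truncn ((p + N%:R) * 2 ^+ j).
have j0 : 0 < 2 ^+ j :> R by rewrite exprn_gt0.
have /andP[ip pi] : i%:R <= (p + N%:R) * 2 ^+ j < i.+1%:R.
  by apply: truncn_itv; rewrite mulr_ge0// ltW.
have iK : (i < N.*2 * 2 ^ j)%N.
  rewrite -(ltr_nat R); apply: le_lt_trans ip _; rewrite natrM natrX ltr_pM2r//.
  by rewrite -addnn natrD ltrD2r; move: pN; rewrite ltr_norml => /andP[].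
exists (2 ^+ j)^-1; first by rewrite invr_gt0.
move=> f c bf f0 c0 fc; apply: ulim_ge; first exact: riemann_sum_bounded.
near=> n; have jn : (j <= n)%N by near: n; exact: nbhs_infty_ge.
have n0 : 0 < 2 ^+ n :> R by rewrite exprn_gt0.
set m := (2 ^ (n - j))%N.
have mE : 2 ^+ n = 2 ^+ j * m%:R :> R by rewrite /m natrX -exprD subnKC.
have m0 : 0 < m%:R :> R by rewrite ltr0n expn_gt0.
have iKn : (i.+1 * m <= N.*2 * 2 ^ n)%N.
  by rewrite -(subnK jn) expnD mulnA -/m (mulnAC _ m) leq_mul2r orbC iK.
have im : (i * m <= i.+1 * m)%N by rewrite leq_mul2r leqnSn orbT.
rewrite /riemann_sum (@big_cat_nat _ _ _ (i * m))/= ?(leq_trans im)//.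
rewrite (@big_cat_nat _ _ _ (i.+1 * m) (i * m))//=.
have H : c * m%:R <= \sum_(i * m <= k < i.+1 * m) f (k%:R / 2 ^+ n - N%:R).
  have -> : c * m%:R = \sum_(i * m <= k < i.+1 * m) c.
    by rewrite sumr_const_nat mulSn addnK mulr_natr.
  apply: ler_sum_nat => k /andP[k1 k2]; apply: fc.
  have H1 : i%:R / 2 ^+ j <= k%:R / 2 ^+ n :> R.
    by rewrite ler_pdivrMr// mulrAC ler_pdivlMr// mE mulrCA mulrC ler_pM2r// -natrM ler_nat.
  have H2 : k%:R / 2 ^+ n <= i.+1%:R / 2 ^+ j :> R.
    by rewrite ler_pdivrMr// mulrAC ler_pdivlMr// mE (mulrCA i.+1%:R) [leLHS]mulrC ler_pM2l// -natrM ler_nat ltnW.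
  move: ip; rewrite -ler_pdivrMr// => ip; move: pi; rewrite -ltr_pdivlMr// => pi.
  have H3 : i.+1%:R / 2 ^+ j = i%:R / 2 ^+ j + (2 ^+ j)^-1 :> R by rewrite -natr1 mulrDl mul1r.
  rewrite ler_norml; apply/andP; lra.
apply: (@le_trans _ _ ((2 ^+ n)^-1 * (c * m%:R))).
  have -> : (2 ^+ n)^-1 * (c * m%:R) = c / 2 ^+ j by rewrite mE; field; rewrite !gt_eqF.
  exact: lexx.
rewrite ler_wpM2l ?invr_ge0 ?(ltW n0)//; apply: le_trans H _.
rewrite addrCA lerDl addr_ge0// sumr_ge0//.
Unshelve. all: by end_near. Qed.

End Functional1.

Section FunctionalN.
Context {R : realType}.
Variable N : nat.

Fixpoint box_integral n : ('rV[R]_n -> R) -> R :=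
  match n with
  | 0 => fun F => F 0
  | n'.+1 => fun F => interval_integral N (fun a => @box_integral n' (fun x => F (row_mx a%:M x : 'rV[R]_(1 + n'))))
  end.

Lemma box_integral_norm_le n (F : 'rV[R]_n -> R) M : 0 <= M -> (forall x, `|F x| <= M) ->
  `|box_integral F| <= N.*2%:R ^+ n * M.
Proof.
elim: n F => [|n IH] F M0 FM /=; first by rewrite expr0 mul1r.
rewrite exprS -mulrA; apply: interval_integral_norm_le; first by rewrite mulr_ge0// exprn_ge0.
by move=> a; apply: IH.
Qed.

Lemma box_integral_bounded n (F : R -> 'rV[R]_n -> R) M : (forall a x, `|F a x| <= M) ->
  bounded_fct (fun a => box_integral (F a)).
Proof.
move=> FM; exists (N.*2%:R ^+ n * Num.max 0 M) => a; apply: box_integral_norm_le; first by rewrite le_max lexx.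
by move=> x; apply: le_trans (FM a x) _; rewrite le_max lexx orbT.
Qed.

Lemma box_integralD n (F G : 'rV[R]_n -> R) : bounded_fct F -> bounded_fct G ->
  box_integral (fun x => F x + G x) = box_integral F + box_integral G.
Proof.
elim: n F G => [|n IH] F G //= [M FM] [L GL].
rewrite -interval_integralD; [|by apply: box_integral_bounded => a x; exact: FM|by apply: box_integral_bounded => a x; exact: GL].
by congr (interval_integral _ _); apply/funext => a; apply: IH; [exists M|exists L].
Qed.

Lemma box_integralZ n (F : 'rV[R]_n -> R) c : bounded_fct F -> box_integral (fun x => c * F x) = c * box_integral F.
Proof.
elim: n F => [|n IH] F //= [M FM].
rewrite -interval_integralZ; last by apply: box_integral_bounded => a x; exact: FM.
by congr (interval_integral _ _); apply/funext => a; apply: IH; exists M.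
Qed.

Lemma box_integral_ge0 n (F : 'rV[R]_n -> R) : bounded_fct F -> (forall x, 0 <= F x) -> 0 <= box_integral F.
Proof.
elim: n F => [|n IH] F //= [M FM] F0.
apply: interval_integral_ge0 => [|a]; first by apply: box_integral_bounded => a x; exact: FM.
by apply: IH => //; exists M.
Qed.

Lemma box_integral_le n (F G : 'rV[R]_n -> R) : bounded_fct F -> bounded_fct G ->
  (forall x, F x <= G x) -> box_integral F <= box_integral G.
Proof.
move=> [M FM] bG FG; have bF : bounded_fct (fun x => -1 * F x).
  by exists M => x; rewrite mulN1r normrN.
have := @box_integral_ge0 n (fun x => G x + -1 * F x).
rewrite box_integralD// box_integralZ; last by exists M.
rewrite mulN1r subr_ge0; apply.
  move: bG => [L GL]; exists (L + M) => x; apply: le_trans (ler_normD _ _) _.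
  by rewrite lerD// mulN1r normrN.
by move=> x; rewrite mulN1r subr_ge0.
Qed.

Lemma row_mx_delta0 n (a h : R) (x : 'rV[R]_n) :
  row_mx a%:M x + h *: delta_mx 0 (lshift n (0 : 'I_1)) = row_mx (a + h)%:M x.
Proof.
apply/rowP => k; rewrite !mxE eqxx /=; case: split_ordP => k' ->.
  by rewrite !mxE ord1 !eqxx mulr1 !mulr1n.
by rewrite eq_rlshift mulr0 addr0.
Qed.

Lemma row_mx_delta1 n (a h : R) (x : 'rV[R]_n) (i : 'I_n) :
  row_mx a%:M x + h *: delta_mx 0 (rshift 1 i) = row_mx a%:M (x + h *: delta_mx 0 i).
Proof.
apply/rowP => k; rewrite !mxE eqxx /=; case: split_ordP => k' ->.
  by rewrite eq_lrshift mulr0 addr0.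
by rewrite !mxE eqxx /= (inj_eq (@rshift_inj _ _)).
Qed.

Lemma row_mx_coord0 n (a : R) (x : 'rV[R]_n) (k : 'I_1) :
  (row_mx a%:M x : 'rV[R]_n.+1) 0 (lshift n k : 'I_(1 + n)) = a.
Proof. by rewrite (@row_mxEl _ 1 1 n) ord1 mxE eqxx mulr1n. Qed.

Lemma row_mx_coord1 n (a : R) (x : 'rV[R]_n) (k : 'I_n) :
  (row_mx a%:M x : 'rV[R]_n.+1) 0 (rshift 1 k : 'I_(1 + n)) = x 0 k.
Proof. by rewrite (@row_mxEr _ 1 1 n). Qed.

Lemma box_integral_shift n (F : 'rV[R]_n -> R) (i : 'I_n) (j : nat) : bounded_fct F ->
  (forall x : 'rV[R]_n, N%:R - 1 <= `|x 0 i| -> F x = 0) ->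
  box_integral (fun x => F (x + (2 ^+ j)^-1 *: delta_mx 0 i)) = box_integral F.
Proof.
elim: n F i => [|n IH] F; first by case.
move=> i [M FM] F0 /=; case: (@split_ordP 1 n i) F0 => [k|k] -> F0.
  rewrite (ord1 k) -[RHS](interval_integral_shift j).
  - congr (interval_integral _ _); apply/funext => a; congr (box_integral _); apply/funext => x.
    by rewrite row_mx_delta0.
  - by apply: box_integral_bounded => a x; exact: FM.
  - move=> a aN; apply/eqP; rewrite -normr_le0.
    have := @box_integral_norm_le n (fun x => F (row_mx a%:M x)) 0 (lexx _).
    rewrite mulr0; apply => x; rewrite F0 ?normr0//.
    by rewrite row_mx_coord0.
congr (interval_integral _ _); apply/funext => a; rewrite -[RHS](IH _ k).
- by congr (box_integral _); apply/funext => x; rewrite row_mx_delta1.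
- by exists M.
- by move=> x xN; rewrite F0// row_mx_coord1.
Qed.

Lemma box_integral_gt0 n (p : 'rV[R]_n) (r : R) : 0 < r -> (forall i, `|p 0 i| < N%:R) ->
  exists2 k : R, 0 < k & forall (F : 'rV[R]_n -> R) (c : R), bounded_fct F ->
    (forall x, 0 <= F x) -> 0 <= c ->
    (forall x : 'rV[R]_n, (forall i, `|x 0 i - p 0 i| <= r) -> c <= F x) -> c * k <= box_integral F.
Proof.
elim: n p => [|n IH] p r0 pN.
  by exists 1 => // F c _ _ _ Fc /=; rewrite mulr1; apply: Fc; case.
have [|k k0 Hk] := IH (rsubmx (p : 'rV_(1 + n))) r0.
  by move=> i; rewrite mxE.
have [|l l0 Hl] := interval_integral_gt0 r0 (p := p 0 0) (N := N); first exact: pN.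
exists (k * l); first exact: mulr_gt0.
move=> F c [M FM] F0 c0 Fc /=; rewrite mulrA; apply: Hl.
- by apply: box_integral_bounded => a x; exact: FM.
- by move=> a; apply: box_integral_ge0 => //; exists M.
- by rewrite mulr_ge0// ltW.
move=> a ap; apply: Hk => //; first by exists M.
move=> x xp; apply: Fc => i; case: (@split_ordP 1 n i) => [j|j] ->.
  by rewrite row_mx_coord0 ord1 (_ : lshift n 0 = 0)//; exact: val_inj.
by have := xp j; rewrite row_mx_coord1 mxE.
Qed.

(** The difference quotients of F by mesh lengths have integral zero by
    invariance under shifts, and converge uniformly to G. *)
Lemma box_integral_derive0 n (F G : 'rV[R]_n -> R) (i : 'I_n) : bounded_fct F -> bounded_fct G ->
  (forall x : 'rV[R]_n, N%:R - 1 <= `|x 0 i| -> F x = 0) ->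
  (forall e : R, 0 < e -> exists2 d : R, 0 < d & forall (h : R) x, 0 < h < d ->
     `|F (x + h *: delta_mx 0 i) - F x - h * G x| <= e * h) ->
  box_integral G = 0.
Proof.
move=> bF bG F0 FG; apply/eqP; rewrite -normr_le0; apply/ler_addgt0Pl => e e0; rewrite addr0.
set C := N.*2%:R ^+ n + 1 : R.
have C0 : 0 < C by rewrite ltr_wpDl ?exprn_ge0.
have [d d0 Hd] := FG (e / C) (divr_gt0 e0 C0).
have [j jd] : exists j : nat, (2 ^+ j)^-1 < d.
  have [j _ Hj] := near_infty_natSinv_expn_lt (PosNum d0).
  by exists j; have := Hj j (leqnn j); rewrite div1r.
set h := (2 ^+ j)^-1 in jd; have h0 : 0 < h by rewrite invr_gt0 exprn_gt0.
pose Fh x := F (x + h *: delta_mx 0 i).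
have bFh : bounded_fct Fh by move: bF => [M FM]; exists M => x; exact: FM.
have bZ (H : 'rV[R]_n -> R) c : bounded_fct H -> bounded_fct (fun x => c * H x).
  by move=> [M HM]; exists (`|c| * M) => x; rewrite normrM ler_wpM2l.
have bD (H K : 'rV[R]_n -> R) : bounded_fct H -> bounded_fct K -> bounded_fct (fun x => H x + K x).
  move=> [M HM] [L KL]; exists (M + L) => x.
  by apply: le_trans (ler_normD _ _) _; rewrite lerD.
have E : box_integral (fun x => Fh x + -1 * F x + - h * G x) = - h * box_integral G.
  rewrite box_integralD ?box_integralD ?box_integralZ//; try exact: bZ; last by apply: bD => //; exact: bZ.
  by rewrite /Fh box_integral_shift// mulN1r subrr add0r.
have := @box_integral_norm_le n (fun x => Fh x + -1 * F x + - h * G x) (e / C * h).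
rewrite E normrM normrN (gtr0_norm h0) => H.
rewrite -(ler_pM2l h0); apply: le_trans (H _ _) _.
- by rewrite mulr_ge0 ?divr_ge0 ?ltW.
- by move=> x; rewrite mulN1r mulNr; apply: Hd; rewrite h0 jd.
rewrite (_ : _ * _ = h * (N.*2%:R ^+ n / C * e)); last by field; rewrite gt_eqF.
by rewrite ler_pM2l// ler_piMl ?(ltW e0)// ler_pdivrMr// mul1r lerDl.
Qed.

End FunctionalN.

(** * Uniform estimates on boxes *)

Section CompactBox.
Context {R : realType} {n : nat}.
Implicit Types (K D : set 'rV[R]_n) (f : 'rV[R]_n -> R).

Lemma compact_within_bounded K D f : compact K -> K `<=` D -> {within D, continuous f} ->
  exists2 M, 0 <= M & forall p, K p -> `|f p| <= M.
Proof.
move=> cK KD cf.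
have cfK : {within K, continuous f} := continuous_subspaceW KD cf.
have /compact_bounded[M [_ HM]] := continuous_compact cfK cK.
exists (`|M| + 1); first by rewrite addr_ge0.
move=> p Kp; apply: HM; last by exists p.
by rewrite (le_lt_trans (ler_norm M))// ltrDl.
Qed.

Lemma compact_unif_cont K f : compact K -> continuous f -> forall e, 0 < e ->
  exists2 d, 0 < d & forall p q, K p -> `|q - p| < d -> `|f q - f p| <= e.
Proof.
move=> /compact_near_coveringP cK cf e e0.
have := @cK R (0^'+) (fun d p => forall q, `|q - p| < d -> `|f q - f p| <= e) _.
case.
  move=> p Kp; have /cvgrPdist_lt/(_ _ (divr_gt0 e0 (ltr0Sn R 1))) := cf p.
  move=> /nbhs_ballP[r /= r0 Hr].
  exists (ball p (r / 2), [set d | d < r / 2]).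
    split; first by apply: nbhsx_ballx; rewrite divr_gt0.
    by apply: nbhs_right_lt; rewrite divr_gt0.
  move=> [p' d] /= [pp' dr] q qp'.
  move: pp'; rewrite mx_norm_ball /ball_/= => pp'.
  have H1 := Hr p'; have H2 := Hr q; move: H1 H2; rewrite mx_norm_ball /ball_/= => H1 H2.
  have {}H1 : `|f p - f p'| < e / 2 by apply: H1; apply: lt_le_trans pp' _; rewrite ler_pdivrMr// ler_peMr ?ler1n// ltW.
  have {}H2 : `|f p - f q| < e / 2.
    apply: H2; rewrite -(subrK p' p) -addrA; apply: le_lt_trans (ler_normD _ _) _.
    rewrite (splitr r) ltrD// distrC; exact: lt_trans qp' dr.
  rewrite -(subrK (f p) (f q)) -addrA; apply: le_trans (ler_normD _ _) _.
  by rewrite (splitr e) lerD// ltW// distrC.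
move=> r /= r0 Hr; exists (r / 2); first by rewrite divr_gt0.
move=> p q Kp qp; apply: (Hr (r / 2)) => //=.
  by rewrite /ball/= sub0r normrN gtr0_norm ?divr_gt0// ltr_pdivrMr// ltr_pMr// ltr1n.
by rewrite divr_gt0.
Qed.

Lemma box_compact (c : 'rV[R]_n) (r : R) : compact [set x : 'rV[R]_n | forall i, `|x 0 i - c 0 i| <= r].
Proof.
have := @rV_compact R n (fun i => `[c 0 i - r, c 0 i + r]%classic).
rewrite (_ : [set v | _] = [set x : 'rV[R]_n | forall i, `|x 0 i - c 0 i| <= r]).
  by apply => i; exact: segment_compact.
apply/seteqP; split => x /= H i; have := H i; rewrite in_itv/= ler_distl//.
Qed.

End CompactBox.

Section MeanValueExc.
Context {R : realType}.

(** A single point c without a derivative is allowed: functions cut off at time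
    0 are not differentiable there. *)
Lemma mean_value_le_exc (f df : R -> R) (a b c m e : R) : a <= b ->
  continuous f ->
  (forall x, x != c -> is_derive x 1 f (df x)) ->
  (forall x, a < x < b -> `|df x - m| <= e) ->
  `|f b - f a - m * (b - a)| <= e * (b - a).
Proof.
move=> ab cf Df He.
have H x y : x <= y -> a <= x -> y <= b -> ~~ (x < c < y) ->
    `|f y - f x - m * (y - x)| <= e * (y - x).
  move=> xy ax yb nc; apply: (@mean_value_le _ f df) => //.
  - by move=> z _; exact: cf.
  - move=> z /andP[xz zy]; apply: Df; apply: contraNneq nc => <-.
    by rewrite xz zy.
  - by move=> z /andP[xz zy]; apply: He; rewrite (le_lt_trans ax) ?(lt_le_trans zy).
have [/andP[ac cb]|nc] := boolP (a < c < b); last exact: H.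
have H1 := H a c (ltW ac) (lexx _) (ltW cb); rewrite ltxx andbF/= in H1.
have H2 := H c b (ltW cb) (ltW ac) (lexx _); rewrite ltxx/= in H2.
rewrite (_ : _ - _ = (f b - f c - m * (b - c)) + (f c - f a - m * (c - a))); last by ring.
apply: le_trans (ler_normD _ _) _; apply: le_trans (lerD (H2 isT) (H1 isT)) _.
by rewrite -mulrDr (_ : b - c + (c - a) = b - a)//; ring.
Qed.

Lemma line_continuous {n} (F : 'rV[R]_n -> R) (p v : 'rV[R]_n) : continuous F ->
  continuous (fun h : R => F (p + h *: v)).
Proof.
move=> cF h; apply: continuous_comp; last exact: cF.
by apply: cvgD; [exact: cvg_cst|apply: cvgZr_tmp; exact: cvg_id].
Qed.

(** Uniform continuity of G on the box turns the mean value theorem into a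
    uniform bound for the difference quotients. *)
Lemma increment_unif {n} (N : R) (F G : 'rV[R]_n -> R) (i j : 'I_n) :
  continuous F -> continuous G ->
  (forall p : 'rV[R]_n, (i != j) || (p 0 j != 0) -> is_derive p (delta_mx 0 i) F (G p)) ->
  (forall (p : 'rV[R]_n) k, N - 1 <= `|p 0 k| -> F p = 0 /\ G p = 0) ->
  forall e : R, 0 < e -> exists2 d : R, 0 < d & forall (h : R) x, 0 < h < d ->
     `|F (x + h *: delta_mx 0 i) - F x - h * G x| <= e * h.
Proof.
move=> cF cG DF FK e e0.
have [d d0 Hd] := compact_unif_cont (@box_compact R n 0 N) cG e0.
exists (Num.min 1 d); first by rewrite lt_min ltr01.
move=> h x /andP[h0]; rewrite lt_min => /andP[h1 hd].
have [Kx|nKx] := pselect (forall k, `|x 0 k - (0 : 'rV[R]_n) 0 k| <= N); last first.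
  have [k /negP] : exists k, ~ (`|x 0 k - (0 : 'rV[R]_n) 0 k| <= N) by exact/existsNP.
  rewrite mxE subr0 -ltNge => xk.
  have [|-> ->] := FK x k; first by rewrite (le_trans _ (ltW xk))// gerBl.
  have [|-> _] := FK (x + h *: delta_mx 0 i) k; last by rewrite mulr0 !subr0 normr0 mulr_ge0// ltW.
  rewrite !mxE eqxx /= lerBlDr; apply: le_trans (ltW xk) _.
  rewrite -{1}(addrK (h * (k == i)%:R) (x 0 k)); apply: le_trans (ler_normB _ _) _.
  by rewrite lerD2l; case: (k == i); rewrite ?mulr1 ?mulr0 ?normr0// gtr0_norm// ltW.
pose f s := F (x + s *: delta_mx 0 i); pose g s := G (x + s *: delta_mx 0 i).
have := @mean_value_le_exc f g 0 h (- x 0 j) (G x) e (ltW h0) (line_continuous cF).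
rewrite /f scale0r addr0 subr0 (mulrC (G x)); apply.
  move=> s sx; apply/is_derive_line/DF; have [ij|] := eqVneq i j => //=.
  by rewrite !mxE ij !eqxx mulr1 addrC addr_eq0.
move=> s /andP[s0 sh]; apply: Hd => //.
rewrite addrC addKr; apply/rV_norm_lt => // k; rewrite !mxE eqxx/= normrM gtr0_norm//.
apply: le_lt_trans (lt_trans sh hd); rewrite ler_piMr ?(ltW s0)//.
by case: (k == i); rewrite ?normr1 ?normr0.
Qed.

End MeanValueExc.

(** * Partial derivatives relative to a domain *)

Section CkTheory.
Context {R : realType} {n : nat}.
Implicit Types (D : set 'rV[R]_n) (f g : 'rV[R]_n -> R) (p a : 'rV[R]_n).

Lemma within_quotient_congr D D' i f g p (r : R) : 0 < r -> f p = g p ->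
  (forall h, `|h| < r -> (D (p + h *: delta_mx 0 i) <-> D' (p + h *: delta_mx 0 i)) /\
     (D (p + h *: delta_mx 0 i) -> f (p + h *: delta_mx 0 i) = g (p + h *: delta_mx 0 i))) ->
  within_quotient D i f p = within_quotient D' i g p.
Proof.
move=> r0 fgp H.
have N : \forall h \near (0 : R)^', `|h| < r.
  apply/nbhs_ballP; exists r => //= h; rewrite /ball/= sub0r normrN => hr _.
  exact: hr.
apply/seteqP; split => A; rewrite /within_quotient /within /fmap /=;
  apply: filterS2 N => h hr W Dh; have [DD E] := H h hr.
  by move: (W (DD.2 Dh)); rewrite /preimage/= fgp E//; apply/DD.
by move: (W (DD.1 Dh)); rewrite /preimage/= fgp E.
Qed.

Lemma pderiv_congr D D' i f g p (r : R) : 0 < r -> f p = g p ->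
  (forall h, `|h| < r -> (D (p + h *: delta_mx 0 i) <-> D' (p + h *: delta_mx 0 i)) /\
     (D (p + h *: delta_mx 0 i) -> f (p + h *: delta_mx 0 i) = g (p + h *: delta_mx 0 i))) ->
  pderiv D i f p = pderiv D' i g p.
Proof. by move=> r0 fg H; rewrite /pderiv (within_quotient_congr r0 fg H). Qed.

Lemma pderivable_congr D D' i f g p (r : R) : 0 < r -> f p = g p ->
  (forall h, `|h| < r -> (D (p + h *: delta_mx 0 i) <-> D' (p + h *: delta_mx 0 i)) /\
     (D (p + h *: delta_mx 0 i) -> f (p + h *: delta_mx 0 i) = g (p + h *: delta_mx 0 i))) ->
  pderivable D i f p -> pderivable D' i g p.
Proof. by move=> r0 fg H; rewrite /pderivable (within_quotient_congr r0 fg H). Qed.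

Lemma line_near p i (h r : R) k : `|h| < r -> `|(p + h *: delta_mx 0 i) 0 k - p 0 k| < r.
Proof.
move=> hr; rewrite !mxE eqxx /= addrC addKr; case: (k == i); first by rewrite mulr1.
by rewrite mulr0 normr0 (le_lt_trans _ hr).
Qed.

(** The domain may change from point to point: this is what allows solutions
    defined on different time slabs to be compared. *)
Lemma continuous_local D f :
  (forall p, D p -> exists D' g, exists2 r, 0 < r & {within D', continuous g} /\
     forall q : 'rV[R]_n, (forall i, `|q 0 i - p 0 i| < r) -> (D q <-> D' q) /\ (D q -> f q = g q)) ->
  {within D, continuous f}.
Proof.
move=> H; apply/within_epsP => p Dp e e0; have [D' [g [r r0 [/within_epsP cg E]]]] := H p Dp.
have Ep : forall i, `|p 0 i - p 0 i| < r by move=> i; rewrite subrr normr0.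
have [d d0 Hd] := cg p (iffLR (E p Ep).1 Dp) e e0.
exists (Num.min r d); first by rewrite lt_min r0.
move=> q Dq qp; have qr : forall i, `|q 0 i - p 0 i| < r.
  by move=> i; have := qp i; rewrite lt_min => /andP[].
rewrite (E p Ep).2// (E q qr).2//.
apply: Hd; last by move=> i; have := qp i; rewrite lt_min => /andP[].
exact: (iffLR (E q qr).1 Dq).
Qed.

(** Regularity relative to D can be tested near each point with another domain
    D' and another function that agree there with D and f; solutions are glued
    and truncated through this lemma. *)
Lemma Ck_local k D f :
  (forall p, D p -> exists D' g, exists2 r, 0 < r & Ck D' k g /\
     forall q : 'rV[R]_n, (forall i, `|q 0 i - p 0 i| < r) -> (D q <-> D' q) /\ (D q -> f q = g q)) ->
  Ck D k f.
Proof.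
elim: k D f => [|k IH] D f H; first exact: continuous_local.
split.
  apply: continuous_local => p /H[D' [g [r r0 [[cg _] E]]]].
  by exists D', g, r.
have W (p q : 'rV[R]_n) (r : R) : (forall i, `|q 0 i - p 0 i| < r / 2) -> forall i h, `|h| < r / 2 ->
    forall k, `|(q + h *: delta_mx 0 i) 0 k - p 0 k| < r.
  move=> qp i h hr l; rewrite -(subrK (q 0 l) (_ 0 l)) -addrA.
  by apply: le_lt_trans (ler_normD _ _) _; rewrite (splitr r); apply: ltrD (line_near _ _ _ hr) (qp l).
move=> i; split.
  move=> p Dp; have [D' [g [r r0 [[_ Cg] E]]]] := H p Dp.
  have Ep : forall i, `|p 0 i - p 0 i| < r by move=> j; rewrite subrr normr0.
  apply: (@pderivable_congr D' D i g f p r r0); first by rewrite (E p Ep).2.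
    move=> h hr; have [] := E (p + h *: delta_mx 0 i) (fun k => line_near p i k hr).
    by move=> DD' fg; split; [tauto|move=> D'h; rewrite fg//; apply/DD'].
  by apply: (Cg i).1; apply/(E p Ep).1.
apply: IH => p Dp; have [D' [g [r r0 [[_ Cg] E]]]] := H p Dp.
exists D', (pderiv D' i g), (r / 2); first by rewrite divr_gt0.
split; first exact: (Cg i).2.
move=> q qp; have qr : forall i, `|q 0 i - p 0 i| < r.
  by move=> j; apply: lt_le_trans (qp j) _; rewrite ler_pdivrMr// ler_peMr ?ler1n// ltW.
split; first exact: (E q qr).1.
move=> Dq; apply: (@pderiv_congr _ _ _ _ _ _ (r / 2)); first by rewrite divr_gt0.
  exact: (E q qr).2.
by move=> h hr; apply: E; exact: W.
Qed.

Lemma Ck_eq k D f g : (forall p, D p -> f p = g p) -> Ck D k g -> Ck D k f.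
Proof. by move=> fg Cg; apply: Ck_local => p Dp; exists D, g, 1 => //; split=> // q _; split=> // /fg. Qed.

Lemma within_quotient_shift D f a i p : (forall p, D p <-> D (p + a)) ->
  within_quotient D i (fun p => f (p + a)) p = within_quotient D i f (p + a).
Proof.
move=> Da; rewrite /within_quotient.
have -> : (fun h : R => h^-1 * (f (p + h *: delta_mx 0 i + a) - f (p + a))) =
          (fun h : R => h^-1 * (f (p + a + h *: delta_mx 0 i) - f (p + a))).
  by apply/funext => h; rewrite addrAC.
have -> // : [set h | D (p + h *: delta_mx 0 i)] = [set h | D (p + a + h *: delta_mx 0 i)].
by apply/funext => h; apply/propext; rewrite /= addrAC; exact: Da.
Qed.

Lemma pderiv_shift D f a i p : (forall p, D p <-> D (p + a)) ->
  pderiv D i (fun p => f (p + a)) p = pderiv D i f (p + a).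
Proof. by move=> Da; rewrite /pderiv within_quotient_shift. Qed.

Lemma Ck_shift k D f a : (forall p, D p <-> D (p + a)) -> Ck D k f -> Ck D k (fun p => f (p + a)).
Proof.
move=> Da; elim: k f => [|k IH] f; last first.
  move=> [cf Df]; split.
    move/within_epsP : cf => cf; apply/within_epsP => p Dp e e0.
    have [d d0 Hd] := cf _ (iffLR (Da p) Dp) e e0; exists d => // q Dq qp.
    apply: Hd; first exact: (Da q).1.
    move=> i; have := qp i; rewrite !mxE.
 by rewrite (_ : q 0 i + a 0 i - _ = q 0 i - p 0 i)//; ring.
  move=> i; split=> [p Dp|].
    by rewrite /pderivable within_quotient_shift//; apply: (Df i).1; exact: (Da p).1.
  have -> : pderiv D i (fun p => f (p + a)) = fun p => pderiv D i f (p + a).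
    by apply/funext => p; exact: pderiv_shift.
  exact/IH/(Df i).2.
move/within_epsP => cf; apply/within_epsP => p Dp e e0.
have [d d0 Hd] := cf _ (iffLR (Da p) Dp) e e0; exists d => // q Dq qp.
apply: Hd; first exact: (Da q).1.
    move=> i; have := qp i; rewrite !mxE.
 by rewrite (_ : q 0 i + a 0 i - _ = q 0 i - p 0 i)//; ring.
Qed.

Lemma pderiv_is_derive D f i p d : is_derive p (delta_mx 0 i) f d ->
  ProperFilter (within [set h | D (p + h *: delta_mx 0 i)] 0^') ->
  pderivable D i f p /\ pderiv D i f p = d.
Proof.
move=> [Df fd] PF.
have C : within_quotient D i f p --> d.
  have H : (fun h : R => h^-1 *: ((f \o shift p) (h *: delta_mx 0 i) - f p)) @ 0^' --> d.
    by rewrite -fd; exact: Df.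
  have -> : within_quotient D i f p = (fun h : R => h^-1 *: ((f \o shift p) (h *: delta_mx 0 i) - f p)) @
     within [set h | D (p + h *: delta_mx 0 i)] 0^'.
    rewrite /within_quotient.
    suff -> : (fun h : R => h^-1 * (f (p + h *: delta_mx 0 i) - f p)) =
      (fun h : R => h^-1 *: ((f \o shift p) (h *: delta_mx 0 i) - f p)) by [].
    by apply/funext => h /=; rewrite [p + _]addrC.
  by apply: cvg_trans H; apply: cvg_app; exact: cvg_within.
split; first by apply/cvg_ex; exists d.
exact: cvg_lim C.
Qed.

End CkTheory.

Definition tI : 'I_(1 + 3) := lshift 3 ord0.
Definition xI (a : 'I_3) : 'I_(1 + 3) := rshift 1 a.

Lemma tI0 : tI = 0. Proof. exact: val_inj. Qed.

Lemma xI_tI a : (xI a == tI) = false. Proof. exact: eq_rlshift. Qed.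

Section Slab.
Context {R : realType}.
Implicit Types (T : R) (p q : 'rV[R]_(1 + 3)) (u : 'rV[R]_(1 + 3) -> R).

Lemma slabE T p : time_slab T p <-> 0 <= p 0 tI < T.
Proof. by rewrite tI0. Qed.

Lemma line_coord p i (h : R) k : (p + h *: delta_mx 0 i) 0 k = p 0 k + h * (k == i)%:R.
Proof. by rewrite !mxE eqxx. Qed.

Lemma slab_near T p : 0 < p 0 tI < T -> exists2 r, 0 < r &
  forall q, `|q 0 tI - p 0 tI| < r -> 0 < q 0 tI < T.
Proof.
move=> /andP[p0 pT]; exists (Num.min (p 0 tI) (T - p 0 tI)); first by rewrite lt_min p0 subr_gt0.
move=> q; rewrite lt_min => /andP[]; rewrite !ltr_norml => /andP[h1 h2] /andP[h3 h4].
by apply/andP; split; lra.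
Qed.

Lemma slab_interior T p : 0 < p 0 tI < T -> (time_slab T)° p.
Proof.
move=> /slab_near[r r0 Hr]; apply/nbhs_ballP; exists r => //= q.
rewrite mx_norm_ball /ball_/= distrC => /rV_norm_lt-/(_ r0) H.
apply/slabE; have := H tI; rewrite !mxE => /Hr/andP[q0 ->].
by rewrite ltW.
Qed.

(** On a slab the increment h is one-sided at time 0, but never trivial, so that
    the limit defining the relative derivative is unique. *)
Lemma slab_proper T p i : time_slab T p ->
  ProperFilter (within [set h : R | time_slab T (p + h *: delta_mx 0 i)] 0^').
Proof.
move=> /slabE/andP[p0 pT]; split; last exact: within_filter.
rewrite /within/= => /nbhs_ballP[r /= r0 Hr].
pose h := Num.min r (T - p 0 tI) / 2.
have m0 : 0 < Num.min r (T - p 0 tI) by rewrite lt_min r0 subr_gt0.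
have h0 : 0 < h by rewrite divr_gt0.
have hm : h < Num.min r (T - p 0 tI) by rewrite /h ltr_pdivrMr// ltr_pMr// ltr1n.
move: hm; rewrite lt_min => /andP[hr hT].
apply: (Hr h) => /=; first by rewrite /ball/= sub0r normrN gtr0_norm.
  by rewrite gt_eqF.
apply/slabE; rewrite line_coord; case: (tI == i) => /=; rewrite ?mulr1 ?mulr0 ?addr0 ?p0 ?pT//.
by rewrite addr_ge0 ?(ltW h0)//=; lra.
Qed.

Lemma Ck1_is_derive T u p i : Ck (time_slab T) 1 u -> 0 < p 0 tI < T ->
  is_derive p (delta_mx 0 i) u (pderiv (time_slab T) i u p).
Proof.
move=> [_ Du] pT; have pI := slab_interior pT.
rewrite (@pderivE R 3)//; apply: derivableP.
by rewrite -(@pderivableE R 3 (time_slab T))//; apply: (Du i).1; exact: interior_subset.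
Qed.

Lemma Ck_le T k u : Ck (time_slab T) k.+1 u -> Ck (time_slab T) k u.
Proof.
elim: k u => [|k IH] u; first by case.
by move=> [cu Du]; split=> // i; split; [exact: (Du i).1|apply: IH; exact: (Du i).2].
Qed.

Lemma Ck2_is_derive T u p i j : Ck (time_slab T) 2 u -> 0 < p 0 tI < T ->
  is_derive p (delta_mx 0 j) (pderiv (time_slab T) i u) (pderiv (time_slab T) j (pderiv (time_slab T) i u) p).
Proof. by move=> [_ Du]; apply: Ck1_is_derive; exact: (Du i).2. Qed.

(** Both orders are computed at interior points, where relative partial
    derivatives are ordinary ones. *)
Lemma pderiv_swap T u p i j : Ck (time_slab T) 2 u -> 0 < p 0 tI < T ->
  pderiv (time_slab T) i (pderiv (time_slab T) j u) p =
  pderiv (time_slab T) j (pderiv (time_slab T) i u) p.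
Proof.
move=> C2 pT; have [r r0 Hr] := slab_near pT.
have C1 := Ck_le C2.
set D := time_slab T in C2 C1 *.
have near s h : `|s| < r / 2 -> `|h| < r / 2 ->
    0 < (p + s *: delta_mx 0 i + h *: delta_mx 0 j) 0 tI < T.
  move=> sr hr; apply: Hr; rewrite !line_coord.
  rewrite (_ : _ - _ = s * (tI == i)%:R + h * (tI == j)%:R); last by ring.
  apply: le_lt_trans (ler_normD _ _) _; rewrite (splitr r); apply: ltrD.
    by case: (tI == i); rewrite ?mulr1 // mulr0 normr0 divr_gt0.
  by case: (tI == j); rewrite ?mulr1 // mulr0 normr0 divr_gt0.
have near1 s : `|s| < r / 2 -> 0 < (p + s *: delta_mx 0 i) 0 tI < T.
  move=> sr; have := near s 0 sr; rewrite scale0r addr0; apply.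
  by rewrite normr0 divr_gt0.
have S : is_derive (0 : R) 1 (fun s => pderiv D j u (p + s *: delta_mx 0 i))
    (pderiv D j (pderiv D i u) p).
  have := @derive_swap R (fun s h => u (p + s *: delta_mx 0 i + h *: delta_mx 0 j))
    (fun s h => pderiv D i u (p + s *: delta_mx 0 i + h *: delta_mx 0 j))
    (fun s => pderiv D j u (p + s *: delta_mx 0 i))
    (fun s h => pderiv D j (pderiv D i u) (p + s *: delta_mx 0 i + h *: delta_mx 0 j)) (r / 2).
  rewrite !scale0r !addr0; apply; first by rewrite divr_gt0.
  - move=> s h sr hr; have := near s h sr hr; rewrite addrAC => pin.
    apply: is_derive_eq; last reflexivity.
    rewrite [X in is_derive _ _ X](_ : _ = fun s => u (p + h *: delta_mx 0 j + s *: delta_mx 0 i)); last first.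
      by apply/funext => s'; rewrite addrAC.
    by apply: (is_derive_line _ _ _ _ _).1; exact: Ck1_is_derive.
  - by move=> s sr; rewrite -is_derive_line scale0r addr0; apply: Ck1_is_derive => //; exact: near1.
  - move=> s h sr hr; apply/is_derive_line; apply: Ck2_is_derive => //; exact: near.
  move=> e e0.
  have [_ Du] := C2; have [_ /(_ j)[_ /within_epsP cD]] := (Du i).2.
  have Dp : D p by apply/slabE; move/andP: pT => [/ltW-> ->].
  have [d d0 Hd] := cD p Dp e e0.
  exists (Num.min (r / 2) (d / 2)); first by rewrite lt_min !divr_gt0.
  move=> s h; rewrite !lt_min => /andP[sr sd] /andP[hr hd]; apply: Hd.
    by apply/slabE; have /andP[/ltW-> ->] := near s h sr hr.
  move=> k; rewrite !line_coord.
  rewrite (_ : _ - _ = s * (k == i)%:R + h * (k == j)%:R); last by ring.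
  apply: le_lt_trans (ler_normD _ _) _; rewrite (splitr d); apply: ltrD.
    by case: (k == i); rewrite ?mulr1 // mulr0 normr0 divr_gt0.
  by case: (k == j); rewrite ?mulr1 // mulr0 normr0 divr_gt0.
have := @Ck2_is_derive T u p j i C2 pT; rewrite is_derive_line0 => S'.
by rewrite -(@derive_val _ _ _ _ _ _ _ S) (@derive_val _ _ _ _ _ _ _ S').
Qed.

Lemma restrict_slab k T T' u : T' <= T -> Ck (time_slab T) k u -> Ck (time_slab T') k u.
Proof.
move=> TT Cu; apply: Ck_local => p /slabE/andP[p0 pT].
exists (time_slab T), u, (T' - p 0 tI); first by rewrite subr_gt0.
split=> // q qp; split=> //; have := qp tI; rewrite ltr_norml => /andP[_ H].
by split=> /slabE/andP[q0 qT]; apply/slabE; rewrite q0/=; lra.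
Qed.

Lemma pderiv_restrict T T' u p i : T' <= T -> time_slab T' p ->
  pderiv (time_slab T') i u p = pderiv (time_slab T) i u p.
Proof.
move=> TT /slabE/andP[p0 pT].
apply: (@pderiv_congr _ _ _ _ _ _ _ _ (T' - p 0 tI)) => //; first by rewrite subr_gt0.
move=> h hr; split=> //; have := line_near p i tI hr; rewrite ltr_norml => /andP[_ H].
by split=> /slabE/andP[q0 qT]; apply/slabE; rewrite q0/=; lra.
Qed.

End Slab.

(** * Weighted energy and uniqueness in light cones *)

Section WithinAlgebra.
Context {R : realType} {T : topologicalType}.
Implicit Types (D : set T) (f g : T -> R).

Lemma withinD D f g : {within D, continuous f} -> {within D, continuous g} ->
  {within D, continuous (fun x => f x + g x)}.
Proof. by move=> cf cg x; apply: (@continuousD R R (subspace D) f g); [exact: cf|exact: cg]. Qed.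

Lemma withinM D f g : {within D, continuous f} -> {within D, continuous g} ->
  {within D, continuous (fun x => f x * g x)}.
Proof. by move=> cf cg x; apply: (@continuousM R (subspace D) f g); [exact: cf|exact: cg]. Qed.

Lemma within_cst D (c : R) : {within D, continuous (fun _ : T => c)}.
Proof. by move=> x; exact: cvg_cst. Qed.

Lemma withinB D f g : {within D, continuous f} -> {within D, continuous g} ->
  {within D, continuous (fun x => f x - g x)}.
Proof.
move=> cf cg; rewrite (_ : (fun x => _) = (fun x => f x + (-1) * g x)).
  by apply: withinD => //; apply: withinM => //; exact: within_cst.
by apply/funext => x; rewrite mulN1r.
Qed.

Lemma within_sum n D (f : 'I_n -> T -> R) : (forall i, {within D, continuous (f i)}) ->
  {within D, continuous (fun x => \sum_(i < n) f i x)}.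
Proof.
elim: n f => [|n IH] f cf.
  rewrite (_ : (fun x => _) = (fun=> 0)); first exact: within_cst.
  by apply/funext => x; rewrite big_ord0.
rewrite (_ : (fun x => _) = (fun x => f ord0 x + \sum_(i < n) f (lift ord0 i) x)).
  by apply: withinD => //; apply: IH.
by apply/funext => x; rewrite big_ord_recl.
Qed.

End WithinAlgebra.

Section DeriveTools.
Context {R : realType}.

Lemma is_derive_near (f g : R -> R) x d r : 0 < r ->
  (forall h, `|h| < r -> f (x + h) = g (x + h)) -> is_derive x 1 g d -> is_derive x 1 f d.
Proof.
move=> r0 fg /is_derive1_epsP H; apply/is_derive1_epsP => e /H[d' d'0 Hd].
exists (Num.min r d'); first by rewrite lt_min r0.
move=> h; rewrite lt_min => /andP[hr hd]; rewrite fg//.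
have -> : f x = g x by have := fg 0; rewrite addr0 normr0; exact.
exact: Hd.
Qed.

Lemma is_derive_c1 (c x : R) : is_derive x 1 (fun=> c) (0 : R).
Proof.
by apply/is_derive1_epsP => e e0; exists 1 => // h _; rewrite subrr mul0r subrr normr0 mulr_ge0// ltW.
Qed.

Definition posp (z : R) := Num.max 0 z.

Lemma posp_pos (z : R) : 0 <= z -> posp z = z. Proof. by move=> z0; rewrite /posp max_r. Qed.
Lemma posp_neg (z : R) : z <= 0 -> posp z = 0. Proof. by move=> z0; rewrite /posp max_l. Qed.

Definition sqr_posp (z : R) := posp z ^+ 2.

Lemma sqp_neg z : z <= 0 -> sqr_posp z = 0.
Proof. by move=> z0; rewrite /sqr_posp posp_neg// expr2 mul0r. Qed.

Lemma sqp_pos z : 0 <= z -> sqr_posp z = z ^+ 2.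
Proof. by move=> z0; rewrite /sqr_posp posp_pos. Qed.

Lemma sqp_derive (z : R) : is_derive z 1 sqr_posp (2 * posp z).
Proof.
apply/is_derive1_epsP => e e0; exists e => // h he; rewrite /sqr_posp.
have H : `|posp (z + h) ^+ 2 - posp z ^+ 2 - 2 * posp z * h| <= h ^+ 2.
  have [z0|z0] := leP 0 z; have [w0|w0] := leP 0 (z + h).
  - by rewrite !posp_pos// (_ : _ - _ - _ = h ^+ 2) ?ger0_norm ?sqr_ge0//; ring.
  - by rewrite (posp_neg (ltW w0)) posp_pos// ler_norml; apply/andP; split; nra.
  - by rewrite (posp_neg (ltW z0)) posp_pos// ler_norml; apply/andP; split; nra.
  - by rewrite (posp_neg (ltW z0)) (posp_neg (ltW w0)) mulr0 mul0r subr0 subrr normr0 sqr_ge0.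
apply: le_trans H _; rewrite -real_normK ?num_real// expr2 ler_wpM2r// ltW//.
Qed.

Context {n : nat}.
Implicit Types (p v : 'rV[R]_n) (f g : 'rV[R]_n -> R).

Lemma is_derive_comp1 (G : R -> R) f p v d dG : is_derive p v f d ->
  is_derive (f p) 1 G dG -> is_derive p v (fun q => G (f q)) (dG * d).
Proof.
move=> /is_derive_line0 Df DG; apply/is_derive_line0.
have E : f (p + 0 *: v) = f p by rewrite scale0r addr0.
rewrite -E in DG.
exact: (@is_derive1_comp R G (fun h => f (p + h *: v)) 0 _ _ DG Df).
Qed.

Lemma is_deriveMM f g p v df dg : is_derive p v f df -> is_derive p v g dg ->
  is_derive p v (fun q => f q * g q) (df * g p + f p * dg).
Proof.
move=> Df Dg; apply: (is_derive_eq (is_deriveM Df Dg)).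
by rewrite /GRing.scale/= addrC mulrC.
Qed.

Lemma is_deriveDD f g p v df dg : is_derive p v f df -> is_derive p v g dg ->
  is_derive p v (fun q => f q + g q) (df + dg).
Proof. by move=> Df Dg; exact: is_deriveD. Qed.

Lemma is_deriveBB f g p v df dg : is_derive p v f df -> is_derive p v g dg ->
  is_derive p v (fun q => f q - g q) (df - dg).
Proof. by move=> Df Dg; exact: is_deriveB. Qed.

Lemma is_derive_cc c p v : is_derive p v (fun=> c) (0 : R).
Proof. exact: is_derive_cst. Qed.

Lemma is_derive_sumf m (f : 'I_m -> 'rV[R]_n -> R) df p v :
  (forall i, is_derive p v (f i) (df i)) ->
  is_derive p v (fun q => \sum_(i < m) f i q) (\sum_(i < m) df i).
Proof.
elim: m f df => [|m IH] f df Df.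
  rewrite big_ord0 (_ : (fun q => _) = (fun=> 0)); first exact: is_derive_cc.
  by apply/funext => q; rewrite big_ord0.
rewrite big_ord_recl (_ : (fun q => _) = (fun q => f ord0 q + \sum_(i < m) f (lift ord0 i) q)).
  by apply: is_deriveDD => //; apply: IH.
by apply/funext => q; rewrite big_ord_recl.
Qed.

Lemma is_derive_coord p i k : is_derive p (delta_mx 0 i) (fun q => q 0 k) ((k == i)%:R : R).
Proof.
apply/is_derive_line0/is_derive1_epsP => e e0; exists 1 => // h _.
rewrite !mxE eqxx/= add0r mul0r addr0 (_ : _ - _ - _ = 0); last by ring.
by rewrite normr0 mulr_ge0// ltW.
Qed.

Lemma coord_continuous k : continuous (fun q : 'rV[R]_n => q 0 k).
Proof. exact: coord_continuous. Qed.

End DeriveTools.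

Section Cut.
Context {R : realType}.
Variables (T rho : R).
Hypotheses (rhoT : rho < T).
Implicit Types (p : 'rV[R]_(1 + 3)) (phi H : 'rV[R]_(1 + 3) -> R).

(** Extending phi H by 0 to negative times turns functions on a slab into
    functions on the whole space, to which box_integral applies. *)
Definition time_cut phi H p := if 0 < p 0 tI then phi p * H p else 0.

Lemma cut_continuous phi H : continuous phi -> {within time_slab T, continuous H} ->
  (forall p, rho <= p 0 tI -> phi p = 0) ->
  (forall p, p 0 tI = 0 -> phi p != 0 -> H p = 0) -> continuous (time_cut phi H).
Proof.
move=> cphi cH phi0 H0.
have cPH : {within time_slab T, continuous (fun p => phi p * H p)}.
  by apply: withinM => //; exact: continuous_subspaceT.
suff : {within setT, continuous (time_cut phi H)}.
  by rewrite -continuous_subspace_setT.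
apply/within_epsP => p _ e e0; have [pT|Tp] := ltP (p 0 tI) T; last first.
  exists (T - rho); first by rewrite subr_gt0.
  move=> q _ qp; have Z (r : 'rV[R]_(1 + 3)) : rho <= r 0 tI -> time_cut phi H r = 0.
    by rewrite /time_cut => /phi0 ->; rewrite mul0r if_same.
  rewrite (Z p (ltW (lt_le_trans rhoT Tp))) Z ?subrr ?normr0//.
  by have := qp tI; rewrite ltr_norml => /andP[h1 h2]; lra.
have [p0|p0] := ltP (p 0 tI) 0.
  exists (- p 0 tI); first by rewrite oppr_gt0.
  move=> q _ /(_ tI); rewrite ltr_norml => /andP[_ h].
  rewrite /time_cut ifF; last by apply/negbTE; rewrite -leNgt; lra.
  by rewrite ifF ?subrr ?normr0//; apply/negbTE; rewrite -leNgt ltW.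
have Dp : time_slab T p by apply/slabE; rewrite p0.
move/within_epsP : cPH => /(_ p Dp e e0)[d d0 Hd].
have E : time_cut phi H p = phi p * H p.
  rewrite /time_cut; case: ltP => // h; have {}h : p 0 tI = 0 by apply/eqP; rewrite eq_le h.
  by have [->|/(H0 _ h)->] := eqVneq (phi p) 0; rewrite ?mul0r ?mulr0.
exists (Num.min d (T - p 0 tI)); first by rewrite lt_min d0 subr_gt0.
move=> q _ qp; have qd k : `|q 0 k - p 0 k| < d by have := qp k; rewrite lt_min => /andP[].
have := qp tI; rewrite lt_min => /andP[_]; rewrite ltr_norml => /andP[_ qT].
have [q0|q0] := ltP 0 (q 0 tI).
  rewrite E /time_cut q0; apply: Hd => //; apply/slabE; rewrite ltW//=; lra.
rewrite {1}/time_cut ifF; last by apply/negbTE; rewrite -leNgt.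
have [p00|p00] := ltP 0 (p 0 tI); last first.
  by rewrite /time_cut ifF ?subrr ?normr0//; apply/negbTE; rewrite -leNgt.
(* the segment from p to q crosses the hyperplane t = 0 *)
pose q' := p + (- p 0 tI) *: delta_mx 0 tI.
have q'0 : q' 0 tI = 0 by rewrite line_coord eqxx mulr1 subrr.
have /Hd : time_slab T q' by apply/slabE; rewrite q'0 lexx /=; lra.
have -> : phi q' * H q' = 0 by have [->|/(H0 _ q'0)->] := eqVneq (phi q') 0; rewrite ?mul0r ?mulr0.
rewrite E; apply => k; rewrite line_coord addrC addKr.
case: (k == tI); last by rewrite mulr0 normr0.
rewrite mulr1 normrN gtr0_norm//; apply: le_lt_trans (qd tI); rewrite ler0_norm; lra.
Qed.

Lemma cut_derive phi dphi H dH p i :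
  is_derive p (delta_mx 0 i) phi (dphi p) ->
  (0 < p 0 tI < T -> is_derive p (delta_mx 0 i) H (dH p)) ->
  (forall p, rho <= p 0 tI -> phi p = 0 /\ dphi p = 0) ->
  (i != tI) || (p 0 tI != 0) ->
  is_derive p (delta_mx 0 i) (time_cut phi H) (time_cut dphi H p + time_cut phi dH p).
Proof.
move=> Dphi DH phi0 ip.
have lineE h : (p + h *: delta_mx 0 i) 0 tI = p 0 tI + h * (tI == i)%:R by exact: line_coord.
have [p0|p0] := leP (p 0 tI) 0.
  have Z H' phi' : time_cut phi' H' p = 0 by rewrite /time_cut ifF//; apply/negbTE; rewrite -leNgt.
  rewrite !Z addr0; apply/is_derive_line0.
  have Hn : exists2 r, 0 < r & forall h, `|h| < r -> (p + h *: delta_mx 0 i) 0 tI <= 0.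
    have [pz|pz] := eqVneq (p 0 tI) 0.
      exists 1 => // h _; rewrite lineE; move: ip; rewrite pz eqxx orbF eq_sym => /negbTE ->.
      by rewrite mulr0 addr0.
    exists (- p 0 tI); first by rewrite oppr_gt0 lt_neqAle pz.
    move=> h; rewrite ltr_norml lineE => /andP[h1 h2]; case: (tI == i); rewrite ?mulr1 ?mulr0; lra.
  have [r r0 Hr] := Hn.
  apply: (is_derive_near r0 _ (is_derive_c1 0 0)).
  by move=> h hr; rewrite /time_cut ifF//; apply/negbTE; rewrite -leNgt add0r; exact: Hr.
have [Tp|pT] := leP T (p 0 tI).
  have Z (q : 'rV[R]_(1 + 3)) H' : rho <= q 0 tI -> time_cut phi H' q = 0 /\ time_cut dphi H' q = 0.
    by move=> /phi0[h1 h2]; rewrite /time_cut h1 h2 mul0r if_same.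
  have pr : rho <= p 0 tI by rewrite ltW// (lt_le_trans rhoT).
  rewrite (Z p H pr).2 (Z p dH pr).1 addr0; apply/is_derive_line0.
  have Tr : 0 < T - rho by rewrite subr_gt0.
  apply: (is_derive_near Tr _ (is_derive_c1 0 0)).
  move=> h; rewrite add0r ltr_norml => /andP[h1 h2]; apply: (Z _ H _).1; rewrite lineE.
  by case: (tI == i); rewrite ?mulr1 ?mulr0; lra.
have D1 := is_deriveMM Dphi (DH (introT andP (conj p0 pT))).
have -> : time_cut dphi H p + time_cut phi dH p = dphi p * H p + phi p * dH p by rewrite /time_cut p0.
apply/is_derive_line0; move/is_derive_line0 : D1 => D1.
apply: (is_derive_near p0 _ D1) => h; rewrite add0r /time_cut lineE ltr_norml => /andP[h1 h2].
by rewrite ifT//; case: (tI == i); rewrite ?mulr1 ?mulr0 ?addr0//; lra.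
Qed.

End Cut.

(** Positivity of the commutator in the energy estimate: c is the defining
    function of the cone, r the time left, X the position. The term with factor
    4 c is nonnegative because |X| <= r, a sum of squares after multiplication
    by r; the Gronwall factor 3 C + 1 absorbs the lower order terms. *)
Lemma energy_identity {R : realFieldType} (c r W a b1 b2 b3 X1 X2 X3 C B : R) :
  0 < c -> 0 < r -> c = r ^+ 2 - (X1 ^+ 2 + X2 ^+ 2 + X3 ^+ 2) -> 0 <= C ->
  `|B| <= C * (`|a| + `|b1|) ->
  - (3 * C + 1) * c ^+ 2 * (W * W + (a * a + b1 * b1 + b2 * b2 + b3 * b3)) -
   4 * c * (r * (W * W + (a * a + b1 * b1 + b2 * b2 + b3 * b3)) - 2 * a * (X1 * b1 + X2 * b2 + X3 * b3)) +
   2 * c ^+ 2 * (a * B) <= - (c ^+ 2 * (W * W + (a * a + b1 * b1 + b2 * b2 + b3 * b3))).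
Proof.
move=> c0 r0 cE C0 HB; set e := W * W + _.
have H1 : 0 <= r * e - 2 * a * (X1 * b1 + X2 * b2 + X3 * b3).
  rewrite -(pmulr_rge0 _ r0).
  have -> : r * (r * e - 2 * a * (X1 * b1 + X2 * b2 + X3 * b3)) =
    r ^+ 2 * W ^+ 2 + a ^+ 2 * c + (r * b1 - a * X1) ^+ 2 + (r * b2 - a * X2) ^+ 2 + (r * b3 - a * X3) ^+ 2.
    by rewrite cE /e; ring.
  have c0' := ltW c0.
  have h1 : 0 <= r ^+ 2 * W ^+ 2 by rewrite mulr_ge0 ?sqr_ge0.
  have h2 : 0 <= a ^+ 2 * c by rewrite mulr_ge0 ?sqr_ge0.
  have := sqr_ge0 (r * b1 - a * X1); have := sqr_ge0 (r * b2 - a * X2); have := sqr_ge0 (r * b3 - a * X3).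
  lra.
have H2 : 2 * (a * B) <= 3 * C * e.
  have h1 : a * B <= `|a| * (C * (`|a| + `|b1|)).
    by apply: le_trans (ler_norm _) _; rewrite normrM ler_wpM2l.
  have ea : `|a| ^+ 2 = a * a by rewrite real_normK ?num_real// expr2.
  have eb : `|b1| ^+ 2 = b1 * b1 by rewrite real_normK ?num_real// expr2.
  have h2 : 2 * (`|a| * (`|a| + `|b1|)) <= 3 * e.
    have := sqr_ge0 (`|a| - `|b1|); have := sqr_ge0 W; have := sqr_ge0 b1; have := sqr_ge0 b2; have := sqr_ge0 b3.
    have := sqr_ge0 a; rewrite /e; nra.
  have h3 := ler_wpM2l C0 h2.
  by nra.
have c2 : 0 <= c ^+ 2 by exact: sqr_ge0.
have h3 := ler_wpM2l c2 H2; have h4 := mulr_ge0 (ltW c0) H1.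
nra.
Qed.

Lemma le_of_eq {R : realFieldType} (a b c d : R) : c = a -> d = b -> a <= b -> c <= d.
Proof. by move=> -> ->. Qed.

Section Energy.
Context {R : realType}.
Variables (T rho : R) (x0 : 'rV[R]_3).
Hypotheses (rho0 : 0 < rho) (rhoT : rho < T).
Implicit Types (p : 'rV[R]_(1 + 3)).

Definition dist2 p := \sum_(a < 3) (p 0 (xI a) - x0 0 a) ^+ 2.
(** Positive exactly inside the backward cone with vertex (rho, x0), as long as
    t < rho. *)
Definition cone_fct p := sqr_posp (rho - p 0 tI) - dist2 p.
Definition cone_dfct i p := 2 * posp (rho - p 0 tI) * - (tI == i)%:R -
   \sum_(a < 3) 2 * (p 0 (xI a) - x0 0 a) * (xI a == i)%:R.

Lemma cone_fct_derive p i : is_derive p (delta_mx 0 i) cone_fct (cone_dfct i p).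
Proof.
apply: is_deriveBB.
  apply: (is_derive_comp1 _ (sqp_derive _)).
  apply: is_derive_eq; first exact: (is_deriveBB (is_derive_cc rho p _) (is_derive_coord p i tI)).
  by rewrite sub0r.
apply: is_derive_sumf => a.
have D := is_deriveBB (is_derive_coord p i (xI a)) (is_derive_cc (x0 0 a) p (delta_mx 0 i)).
rewrite (_ : (fun q : 'rV_(1 + 3) => _) = (fun q : 'rV[R]_(1 + 3) => (q 0 (xI a) - x0 0 a) * (q 0 (xI a) - x0 0 a))).
  by apply: (is_derive_eq (is_deriveMM D D)); rewrite subr0; ring.
by apply/funext => q; rewrite expr2.
Qed.

Variable lam : R.

(** The square of the positive part of cone_fct is continuously differentiable
    and vanishes with its gradient on the boundary of the cone; the exponential
    plays the part of Gronwall's lemma. *)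
Definition weight p := expR (- lam * p 0 tI) * sqr_posp (cone_fct p).
Definition dweight i p := expR (- lam * p 0 tI) *
  (- lam * (tI == i)%:R * sqr_posp (cone_fct p) + 2 * posp (cone_fct p) * cone_dfct i p).

Lemma weight_derive p i : is_derive p (delta_mx 0 i) weight (dweight i p).
Proof.
have D1 : is_derive p (delta_mx 0 i) (fun q : 'rV[R]_(1 + 3) => - lam * q 0 tI) (- lam * (tI == i)%:R).
  apply: (is_derive_eq (is_deriveMM (is_derive_cc (- lam) p _) (is_derive_coord p i tI))).
  by rewrite mul0r add0r.
have D2 := is_derive_comp1 D1 (is_derive_expR _).
have D3 := is_derive_comp1 (cone_fct_derive p i) (sqp_derive _).
apply: (is_derive_eq (is_deriveMM D2 D3)); rewrite /dweight; ring.
Qed.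

Lemma dist2_ge0 p : 0 <= dist2 p.
Proof. by apply: sumr_ge0 => a _; exact: sqr_ge0. Qed.

Lemma cone_fct_le0 p : rho <= p 0 tI -> cone_fct p <= 0.
Proof.
by move=> rp; rewrite /cone_fct sqp_neg ?subr_le0// dist2_ge0.
Qed.

Lemma weight0 p : cone_fct p <= 0 -> forall i, weight p = 0 /\ dweight i p = 0.
Proof.
move=> c0 i; rewrite /weight /dweight (sqp_neg c0) (posp_neg c0).
by split; rewrite !mulr0 // mul0r addr0 mulr0.
Qed.

Lemma weight_ge0 p : 0 <= weight p.
Proof. by rewrite mulr_ge0 ?expR_ge0// sqr_ge0. Qed.

Lemma weight_gt0 p : 0 < cone_fct p -> 0 < weight p.
Proof. by move=> c0; rewrite mulr_gt0 ?expR_gt0// exprn_gt0// posp_pos// ltW. Qed.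

Let N : nat := (Num.truncn (rho + \sum_(a < 3) `|x0 0 a|)).+4.

(** The cone is bounded, so that functions cut off by the weight vanish near the
    boundary of the box of half-side N. *)
Lemma weight_box p k : 0 < p 0 tI -> 0 < cone_fct p -> `|p 0 k| < N%:R - 1.
Proof.
move=> p0 c0.
have pr : p 0 tI < rho by rewrite ltNge; apply/negP => /cone_fct_le0; rewrite leNgt c0.
have NE : rho + \sum_(a < 3) `|x0 0 a| < N%:R - 1.
  have := @truncnS_gt R (rho + \sum_(a < 3) `|x0 0 a|).
  rewrite /N -!natr1; set m := (Num.truncn _)%:R; lra.
apply: le_lt_trans NE; case: (@split_ordP 1 3 k) => [j|j] ->.
  rewrite (ord1 j) -/tI gtr0_norm//; apply: (le_trans (ltW pr)).
  by rewrite lerDl sumr_ge0.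
rewrite -/(xI j) -(subrK (x0 0 j) (p 0 (xI j))); apply: le_trans (ler_normD _ _) _.
rewrite lerD//; last by rewrite (bigD1 j)//= lerDl sumr_ge0.
have H : (p 0 (xI j) - x0 0 j) ^+ 2 <= rho ^+ 2.
  apply: (@le_trans _ _ (dist2 p)).
    by rewrite /dist2 (bigD1 j)//= lerDl sumr_ge0// => a _; exact: sqr_ge0.
  have := c0; rewrite /cone_fct sqp_pos; last by rewrite subr_ge0 ltW.
  by rewrite subr_gt0 => /ltW/le_trans; apply; nra.
have r0 := ltW rho0.
by rewrite -ler_sqr ?nnegrE// real_normK ?num_real.
Qed.

Variables (w : 'rV[R]_(1 + 3) -> R) (w1 : 'I_(1 + 3) -> 'rV[R]_(1 + 3) -> R)
  (w2 : 'I_(1 + 3) -> 'I_(1 + 3) -> 'rV[R]_(1 + 3) -> R).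
Hypotheses (cw : {within time_slab T, continuous w})
  (cw1 : forall i, {within time_slab T, continuous (w1 i)})
  (cw2 : forall i j, {within time_slab T, continuous (w2 i j)})
  (dw : forall p i, 0 < p 0 tI < T -> is_derive p (delta_mx 0 i) w (w1 i p))
  (dw1 : forall p i j, 0 < p 0 tI < T -> is_derive p (delta_mx 0 i) (w1 j) (w2 i j p))
  (w2C : forall p i j, 0 < p 0 tI < T -> w2 i j p = w2 j i p)
  (w_init : forall p, p 0 tI = 0 -> 0 < cone_fct p -> w p = 0 /\ forall i, w1 i p = 0).

Definition energy p := w p * w p + \sum_(j < 1 + 3) w1 j p * w1 j p.
Definition denergy i p := 2 * w p * w1 i p + \sum_(j < 1 + 3) 2 * w1 j p * w2 i j p.
(** The spatial energy current: the divergence of (energy, - flux) is 2 w1 tI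
    times the Klein-Gordon operator applied to w. *)
Definition flux a p := 2 * w1 tI p * w1 (xI a) p.
Definition dflux a p := 2 * (w2 (xI a) tI p * w1 (xI a) p + w1 tI p * w2 (xI a) (xI a) p).

Lemma energy_continuous : {within time_slab T, continuous energy}.
Proof.
apply: withinD; first exact: withinM.
by apply: within_sum => j; exact: withinM.
Qed.

Lemma denergy_continuous i : {within time_slab T, continuous (denergy i)}.
Proof.
apply: withinD; first by do !apply: withinM => //; exact: within_cst.
by apply: within_sum => j; do !apply: withinM => //; exact: within_cst.
Qed.

Lemma flux_continuous a : {within time_slab T, continuous (flux a)}.
Proof. by do !apply: withinM => //; exact: within_cst. Qed.

Lemma dflux_continuous a : {within time_slab T, continuous (dflux a)}.
Proof.
apply: withinM; first exact: within_cst.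
by apply: withinD; apply: withinM.
Qed.

Lemma energy_derive p i : 0 < p 0 tI < T -> is_derive p (delta_mx 0 i) energy (denergy i p).
Proof.
move=> pT; apply: is_deriveDD.
  by apply: (is_derive_eq (is_deriveMM (dw i pT) (dw i pT))); ring.
by apply: is_derive_sumf => j; apply: (is_derive_eq (is_deriveMM (dw1 i j pT) (dw1 i j pT))); ring.
Qed.

Lemma flux_derive p a : 0 < p 0 tI < T -> is_derive p (delta_mx 0 (xI a)) (flux a) (dflux a p).
Proof.
move=> pT; have D := is_deriveMM (dw1 (xI a) tI pT) (dw1 (xI a) (xI a) pT).
rewrite (_ : flux a = (fun q => 2 * (w1 tI q * w1 (xI a) q))); last first.
  by apply/funext => q; rewrite /flux mulrA.
by apply: (is_derive_eq (is_deriveMM (is_derive_cc 2 p _) D)); rewrite mul0r add0r.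
Qed.

Lemma coordc k : {within setT, continuous (fun q : 'rV[R]_(1 + 3) => q 0 k)}.
Proof. by apply: continuous_subspaceT; exact: coord_continuous. Qed.

Lemma posp_continuous : continuous (@posp R).
Proof.
by move=> z; apply: (@continuous_max R R (fun=> 0) id); [exact: cvg_cst|exact: cvg_id].
Qed.

Lemma within_comp (g : R -> R) (f : 'rV[R]_(1 + 3) -> R) : continuous g ->
  {within setT, continuous f} -> {within setT, continuous (fun x => g (f x))}.
Proof.
move=> cg cf; have {}cf : continuous f by rewrite continuous_subspace_setT.
by apply: continuous_subspaceT => x; apply: continuous_comp; [exact: cf|exact: cg].
Qed.

Lemma cone_fct_continuous : {within setT, continuous cone_fct}.
Proof.
have c k (c : R) : {within setT, continuous (fun q : 'rV[R]_(1 + 3) => q 0 k - c)}.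
  by apply: withinB; [exact: coordc|exact: within_cst].
apply: withinB.
  rewrite (_ : (fun x => _) = fun x : 'rV[R]_(1 + 3) => posp (rho - x 0 tI) * posp (rho - x 0 tI)).
    have H : {within setT, continuous (fun x : 'rV[R]_(1 + 3) => posp (rho - x 0 tI))}.
      apply: within_comp; first exact: posp_continuous.
      by apply: withinB; [exact: within_cst|exact: coordc].
    exact: withinM.
  by apply/funext => q; rewrite /sqr_posp expr2.
apply: within_sum => a.
rewrite (_ : (fun x => _) = fun x : 'rV[R]_(1 + 3) => (x 0 (xI a) - x0 0 a) * (x 0 (xI a) - x0 0 a)).
  exact: withinM.
by apply/funext => q; rewrite expr2.
Qed.

Lemma expw_continuous : {within setT, continuous (fun p : 'rV[R]_(1 + 3) => expR (- lam * p 0 tI))}.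
Proof.
apply: within_comp; first exact: continuous_expR.
by apply: withinM; [exact: within_cst|exact: coordc].
Qed.

Lemma pospc_continuous : {within setT, continuous (fun p => posp (cone_fct p))}.
Proof. by apply: within_comp; [exact: posp_continuous|exact: cone_fct_continuous]. Qed.

Lemma sqpc_continuous : {within setT, continuous (fun p => sqr_posp (cone_fct p))}.
Proof.
rewrite (_ : (fun x => _) = fun x : 'rV[R]_(1 + 3) => posp (cone_fct x) * posp (cone_fct x)).
  by apply: withinM; exact: pospc_continuous.
by apply/funext => q; rewrite /sqr_posp expr2.
Qed.

Lemma weight_continuous : continuous weight.
Proof.
rewrite continuous_subspace_setT; apply: withinM; first exact: expw_continuous.
exact: sqpc_continuous.
Qed.

Lemma dweight_continuous i : continuous (dweight i).
Proof.
rewrite continuous_subspace_setT; apply: withinM; first exact: expw_continuous.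
apply: withinD; first by apply: withinM; [exact: within_cst|exact: sqpc_continuous].
apply: withinM; first by apply: withinM; [exact: within_cst|exact: pospc_continuous].
apply: withinB.
  apply: withinM; last exact: within_cst.
  apply: withinM; first exact: within_cst.
  apply: within_comp; first exact: posp_continuous.
  by apply: withinB; [exact: within_cst|exact: coordc].
apply: within_sum => a; apply: withinM; last exact: within_cst.
apply: withinM; first exact: within_cst.
by apply: withinB; [exact: coordc|exact: within_cst].
Qed.

Let F := time_cut weight energy.
Let Gt p := time_cut (dweight tI) energy p + time_cut weight (denergy tI) p.
Let Fx a := time_cut weight (flux a).
Let Gx a p := time_cut (dweight (xI a)) (flux a) p + time_cut weight (dflux a) p.

Lemma cone_dfct_tI p : cone_dfct tI p = - (2 * posp (rho - p 0 tI)).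
Proof.
rewrite /cone_dfct eqxx big1 ?subr0 ?mulrN1// => a _.
by rewrite xI_tI mulr0.
Qed.

Lemma cone_dfct_xI p a : cone_dfct (xI a) p = - (2 * (p 0 (xI a) - x0 0 a)).
Proof.
rewrite /cone_dfct eq_sym xI_tI oppr0 mulr0 sub0r (bigD1 a)//= eqxx mulr1 big1 ?addr0// => b /negbTE ba.
by rewrite (inj_eq (@rshift_inj _ _)) ba mulr0.
Qed.

Lemma sum3 (f : 'I_3 -> R) : \sum_a f a = f ord0 + f (lift ord0 ord0) + f (lift ord0 (lift ord0 ord0)).
Proof. by rewrite !big_ord_recl big_ord0 addr0 addrA. Qed.

Lemma sum4 (f : 'I_(1 + 3) -> R) : \sum_j f j = f tI + \sum_a f (xI a).
Proof.
rewrite big_split_ord /= big_ord_recl big_ord0 addr0.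
by congr (f _ + _); apply/val_inj.
Qed.

(** Gt and Gx are the time and space derivatives of the weighted energy and of
    the weighted flux; F is the weighted energy itself. Their integrals vanish,
    hence that of F is nonpositive. *)
Lemma energy_pointwise C p : 0 <= C -> lam = 3 * C + 1 ->
  (0 < p 0 tI -> 0 < cone_fct p ->
     `|w2 tI tI p - \sum_(a < 3) w2 (xI a) (xI a) p + w p| <= C * (`|w1 tI p| + `|w1 (xI ord0) p|)) ->
  Gt p - \sum_(a < 3) Gx a p <= - F p.
Proof.
move=> C0 lamE H; rewrite /Gt /Gx /F /time_cut.
have [p0|p0] := ltP 0 (p 0 tI); last first.
  by rewrite big1 ?addr0 ?subrr ?oppr0.
have [c0|c0] := leP (cone_fct p) 0.
  have Z i := weight0 c0 i.
  rewrite (Z tI).1 (Z tI).2 big1 ?mul0r ?addr0 ?subr0 ?oppr0// => a _.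
  by rewrite (Z (xI a)).2 !mul0r addr0.
have pr : p 0 tI < rho by rewrite ltNge; apply/negP => /cone_fct_le0; rewrite leNgt c0.
have pT : 0 < p 0 tI < T by rewrite p0 (lt_trans pr).
have r0 : 0 < rho - p 0 tI by rewrite subr_gt0.
move: (H p0 c0); set B := w2 tI tI p - _ + _ => HB.
rewrite /dweight /weight cone_dfct_tI eqxx mulr1.
under eq_bigr do rewrite (eq_sym tI) xI_tI mulr0 mul0r add0r cone_dfct_xI.
rewrite (sqp_pos (ltW c0)) (posp_pos (ltW c0)) (posp_pos (ltW r0)).
rewrite /energy /denergy !sum4 !sum3 /flux /dflux.
have cE : cone_fct p = (rho - p 0 tI) ^+ 2 - dist2 p by rewrite /cone_fct sqp_pos// ltW.
rewrite /dist2 sum3 in cE.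
have ineq := energy_identity (w p) (w1 (xI (lift ord0 ord0)) p) (w1 (xI (lift ord0 (lift ord0 ord0))) p) c0 r0 cE C0 HB.
rewrite -(w2C (xI ord0) tI pT) -(w2C (xI (lift ord0 ord0)) tI pT) -(w2C (xI (lift ord0 (lift ord0 ord0))) tI pT).
rewrite -lamE in ineq.
have := ler_wpM2l (expR_ge0 (- lam * p 0 tI)) ineq.
move: ineq => _; rewrite /B sum3.
by apply: le_of_eq; ring.
Qed.

Lemma weight_rho p i : rho <= p 0 tI -> weight p = 0 /\ dweight i p = 0.
Proof. by move=> /cone_fct_le0 /weight0. Qed.

Lemma cut_box phi H p k : (forall q, cone_fct q <= 0 -> phi q = 0) ->
  N%:R - 1 <= `|p 0 k| -> time_cut phi H p = 0.
Proof.
move=> phi0 pk; rewrite /time_cut; case: ltP => // p0.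
have [c0|/phi0->] := ltP 0 (cone_fct p); last by rewrite mul0r.
by have := weight_box k p0 c0; rewrite ltNge pk.
Qed.

Lemma box_bounded (f : 'rV[R]_(1 + 3) -> R) : continuous f -> (forall p (k : 'I_(1 + 3)), N%:R - 1 <= `|p 0 k| -> f p = 0) -> bounded_fct f.
Proof.
move=> cf f0.
have cf' : {within setT, continuous f} by exact: continuous_subspaceT.
have [M M0 HM] := compact_within_bounded (@box_compact R _ 0 N%:R) (@subsetT _ _) cf'.
exists M => p; have [Kp|nKp] := pselect (forall k, `|p 0 k - (0 : 'rV[R]_(1 + 3)) 0 k| <= N%:R).
  exact: HM.
have [k /negP] : exists k, ~ (`|p 0 k - (0 : 'rV[R]_(1 + 3)) 0 k| <= N%:R) by exact/existsNP.
rewrite mxE subr0 -ltNge => pk; rewrite (f0 p k) ?normr0//.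
by apply: le_trans (ltW pk); rewrite gerBl.
Qed.

Lemma energy_init p : p 0 tI = 0 -> 0 < cone_fct p -> energy p = 0.
Proof.
move=> p0 c0; have [w0 w10] := w_init p0 c0.
by rewrite /energy w0 mul0r add0r big1// => j _; rewrite w10 mul0r.
Qed.

Lemma denergy_init i p : p 0 tI = 0 -> 0 < cone_fct p -> denergy i p = 0.
Proof.
move=> p0 c0; have [w0 w10] := w_init p0 c0.
by rewrite /denergy w0 mulr0 mul0r add0r big1// => j _; rewrite w10 mulr0 mul0r.
Qed.

Lemma flux_init a p : p 0 tI = 0 -> 0 < cone_fct p -> flux a p = 0.
Proof. by move=> p0 c0; have [w0 w10] := w_init p0 c0; rewrite /flux w10 mulr0 mul0r. Qed.

Lemma dflux_init a p : p 0 tI = 0 -> 0 < cone_fct p -> dflux a p = 0.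
Proof. by move=> p0 c0; have [w0 w10] := w_init p0 c0; rewrite /dflux !w10 mulr0 mul0r addr0 mulr0. Qed.

Lemma weight_neq0 p : weight p != 0 -> 0 < cone_fct p.
Proof. by have [//|c0] := ltP 0 (cone_fct p); rewrite (weight0 c0 tI).1 eqxx. Qed.

Lemma dweight_neq0 i p : dweight i p != 0 -> 0 < cone_fct p.
Proof. by have [//|c0] := ltP 0 (cone_fct p); rewrite (weight0 c0 i).2 eqxx. Qed.

Lemma cutw_continuous H : {within time_slab T, continuous H} ->
  (forall p, p 0 tI = 0 -> 0 < cone_fct p -> H p = 0) -> continuous (time_cut weight H).
Proof.
move=> cH H0; apply: (cut_continuous rhoT) => //; first exact: weight_continuous.
  by move=> p rp; exact: (weight_rho tI rp).1.
by move=> p p0 /weight_neq0; exact: H0.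
Qed.

Lemma cutdw_continuous i H : {within time_slab T, continuous H} ->
  (forall p, p 0 tI = 0 -> 0 < cone_fct p -> H p = 0) -> continuous (time_cut (dweight i) H).
Proof.
move=> cH H0; apply: (cut_continuous rhoT) => //; first exact: dweight_continuous.
  by move=> p rp; exact: (weight_rho i rp).2.
by move=> p p0 /dweight_neq0; exact: H0.
Qed.

(** The weight makes the product vanish outside the cone and the initial
    conditions make it vanish at time 0; at time 0 the extended product may fail
    to be differentiable, but not to be continuous. *)
Lemma integral_cut0 i (H dH : 'rV[R]_(1 + 3) -> R) : {within time_slab T, continuous H} ->
  {within time_slab T, continuous dH} ->
  (forall p, p 0 tI = 0 -> 0 < cone_fct p -> H p = 0) ->
  (forall p, p 0 tI = 0 -> 0 < cone_fct p -> dH p = 0) ->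
  (forall p, 0 < p 0 tI < T -> is_derive p (delta_mx 0 i) H (dH p)) ->
  bounded_fct (fun p => time_cut (dweight i) H p + time_cut weight dH p) /\
  box_integral N (fun p => time_cut (dweight i) H p + time_cut weight dH p) = 0.
Proof.
move=> cH cdH H0 dH0 DH.
have c1 := cutw_continuous cH H0.
have c2 : continuous (fun p => time_cut (dweight i) H p + time_cut weight dH p).
  have h1 := cutdw_continuous (i := i) cH H0; have h2 := cutw_continuous cdH dH0.
  by move=> p; exact: (continuousD (h1 p) (h2 p)).
have b1 p k : N%:R - 1 <= `|p 0 k| -> time_cut weight H p = 0.
  by apply: cut_box => q q0; exact: (weight0 q0 tI).1.
have b2 p k : N%:R - 1 <= `|p 0 k| -> time_cut (dweight i) H p + time_cut weight dH p = 0.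
  move=> pk; rewrite (@cut_box _ _ _ k) ?(@cut_box _ _ _ k) ?addr0//.
    by move=> q q0; exact: (weight0 q0 tI).1.
  by move=> q q0; exact: (weight0 q0 i).2.
have B2 := box_bounded c2 b2.
split => //; apply: (box_integral_derive0 (box_bounded c1 b1) B2 (i := i)); first by move=> x; exact: b1.
apply: (@increment_unif R _ N%:R _ _ i tI c1 c2).
  move=> p ip; apply: (cut_derive rhoT (weight_derive p i) (DH p) _ ip) => q.
  exact: weight_rho.
by move=> p k pk; split; [exact: b1 pk|exact: b2 pk].
Qed.

(** The weighted energy F is nonnegative, continuous, and has nonpositive
    integral, so it vanishes wherever the weight does not. *)
Lemma cone_zero C : 0 <= C -> lam = 3 * C + 1 ->
  (forall p, 0 < p 0 tI -> 0 < cone_fct p ->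
     `|w2 tI tI p - \sum_(a < 3) w2 (xI a) (xI a) p + w p| <= C * (`|w1 tI p| + `|w1 (xI ord0) p|)) ->
  forall p, 0 < p 0 tI -> 0 < cone_fct p -> w p = 0.
Proof.
move=> C0 lamE H p p0 cp.
have [bt It] := integral_cut0 energy_continuous (@denergy_continuous tI) energy_init
  (@denergy_init tI) (fun p => @energy_derive p tI).
have Hx a := integral_cut0 (@flux_continuous a) (@dflux_continuous a) (@flux_init a) (@dflux_init a)
  (fun p => @flux_derive p a).
have cF : continuous F := cutw_continuous energy_continuous energy_init.
have bF : bounded_fct F by apply: (box_bounded cF) => q k; apply: cut_box => q' q0; exact: (weight0 q0 tI).1.
have energy_ge0 q : 0 <= energy q.
  by rewrite addr_ge0 ?sumr_ge0// => *; rewrite -expr2 sqr_ge0.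
have F0 q : 0 <= F q.
  by rewrite /F /time_cut; case: ifP => // _; rewrite mulr_ge0 ?weight_ge0.
have bZ (G : 'rV[R]_(1 + 3) -> R) : bounded_fct G -> bounded_fct (fun x => -1 * G x).
  by move=> [M HM]; exists M => x; rewrite mulN1r normrN.
have bD (G K : 'rV[R]_(1 + 3) -> R) : bounded_fct G -> bounded_fct K -> bounded_fct (fun x => G x + K x).
  move=> [M HM] [L KL]; exists (M + L) => x.
  by apply: le_trans (ler_normD _ _) _; rewrite lerD.
have IF : box_integral N F <= 0.
  have bs a : bounded_fct (fun q => -1 * Gx a q) by apply: bZ; exact: (Hx a).1.
  have Is a : box_integral N (fun q => -1 * Gx a q) = 0 by rewrite box_integralZ ?(Hx a).2 ?mulr0//; exact: (Hx a).1.
  pose A a q := -1 * Gx a q.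
  have b12 := bD _ _ (bs (lift ord0 ord0)) (bs (lift ord0 (lift ord0 ord0))).
  have b012 := bD _ _ (bs ord0) b12.
  have E : box_integral N (fun q => Gt q + (A ord0 q + (A (lift ord0 ord0) q + A (lift ord0 (lift ord0 ord0)) q))) = 0.
    rewrite (@box_integralD R N _ Gt _ bt b012) (@box_integralD R N _ (A ord0) _ (bs ord0) b12).
    by rewrite (@box_integralD R N _ (A (lift ord0 ord0)) _ (bs _) (bs _)) It !Is !addr0.
  have := @box_integral_le R N _ _ _ (bD Gt _ bt b012) (bZ F bF).
  rewrite E (@box_integralZ R N _ F _ bF) mulN1r oppr_ge0; apply.
  move=> q; have := energy_pointwise C0 lamE (H q); rewrite sum3.
  by apply: le_of_eq; ring.
have [->//|wp] := eqVneq (w p) 0.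
suff : 0 < box_integral N F by rewrite ltNge IF.
have Fp : 0 < F p.
  rewrite /F /time_cut p0 mulr_gt0 ?weight_gt0// /energy ltr_pwDl ?sumr_ge0//.
    by rewrite -expr2 lt_neqAle sqr_ge0 eq_sym expf_eq0/= wp.
  by move=> j _; rewrite -expr2 sqr_ge0.
have cF' : {within setT, continuous F} by exact: continuous_subspaceT.
have Fp2 : 0 < F p / 2 by rewrite divr_gt0.
have [d d0 Hd] := iffLR (within_epsP _ _) cF' p Logic.I _ Fp2.
have d20 : 0 < d / 2 by rewrite divr_gt0.
have pN k : `|p 0 k| < N%:R by apply: lt_le_trans (weight_box k p0 cp) _; rewrite gerBl.
have [l l0 Hl] := box_integral_gt0 d20 pN.
apply: lt_le_trans (Hl F (F p / 2) bF F0 (ltW Fp2) _); first exact: mulr_gt0.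
move=> x xp; have xd i : `|x 0 i - p 0 i| < d.
  by apply: le_lt_trans (xp i) _; rewrite ltr_pdivrMr// ltr_pMr// ltr1n.
by have := Hd x Logic.I xd; rewrite ltr_norml ltrBrDl {1}(splitr (F p)) addrK => /andP[/ltW].
Qed.

End Energy.

Section Uniqueness.
Context {R : realType}.
Implicit Types (p : 'rV[R]_(1 + 3)) (x : 'rV[R]_3) (u v : 'rV[R]_(1 + 3) -> R).

Lemma event_tI (t : R) x : event t x 0 tI = t.
Proof. by rewrite /event /tI row_mxEl mxE eqxx mulr1n. Qed.

Lemma event_xI (t : R) x a : event t x 0 (xI a) = x 0 a.
Proof. by rewrite /event /xI row_mxEr. Qed.

Lemma eventK p : event (p 0 tI) (rsubmx p) = p.
Proof.
apply/rowP => k; case: (@split_ordP 1 3 k) => j ->; last by rewrite event_xI mxE.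
by rewrite (ord1 j) -/tI event_tI.
Qed.

(** The requirements on a classical solution that do not involve the data. *)
Definition kg_solution (T : R) u := Ck (time_slab T) 2 u /\ forall p, time_slab T p ->
  dalembertian T u p + u p = dt T u p ^+ 2 * dx T ord0 u p.

Lemma classical_kg (f g : 'rV[R]_3 -> R) T u : classical_solution f g T u <->
  [/\ 0 < T, kg_solution T u, (forall x, u (event 0 x) = f x) & (forall x, dt T u (event 0 x) = g x)].
Proof.
split=> [[T0 Cu E uf ug]|[T0 [Cu E] uf ug]]; split => //.
  by split => // p /slabE pT; rewrite -(eventK p); apply: E.
by move=> t x tT; apply: E; apply/slabE; rewrite event_tI.
Qed.

Lemma kg_restrict T T' u : T' <= T -> kg_solution T u -> kg_solution T' u.
Proof.
move=> TT [Cu E]; split; first exact: restrict_slab Cu.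
move=> p Dp; have Dp' : time_slab T p.
  by move/slabE : Dp => /andP[p0 pT]; apply/slabE; rewrite p0 (lt_le_trans pT).
have E1 i q : time_slab T' q -> pderiv (time_slab T') i u q = pderiv (time_slab T) i u q.
  exact: pderiv_restrict.
have E2 i j : pderiv (time_slab T') i (pderiv (time_slab T') j u) p =
              pderiv (time_slab T) i (pderiv (time_slab T) j u) p.
  rewrite -(pderiv_restrict _ i TT Dp); apply: (@pderiv_congr _ _ _ _ _ _ _ _ 1) => //; first exact: E1.
  by move=> h _; split=> //; exact: E1.
rewrite /dalembertian /dt /dx E2 E1// E1//.
by under eq_bigr do rewrite E2; exact: E.
Qed.

Lemma segments_compact (n : nat) (lo hi : 'rV[R]_n) :
  compact [set x : 'rV[R]_n | forall i, lo 0 i <= x 0 i <= hi 0 i].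
Proof.
have := @rV_compact R n (fun i => `[lo 0 i, hi 0 i]%classic).
rewrite (_ : [set v | _] = [set x : 'rV[R]_n | forall i, lo 0 i <= x 0 i <= hi 0 i]).
  by apply => i; exact: segment_compact.
by apply/seteqP; split => x /= H i; have := H i; rewrite in_itv/=.
Qed.

Lemma cone_fct_box rho x0 p : 0 < rho -> 0 <= p 0 tI -> 0 < cone_fct rho x0 p ->
  p 0 tI < rho /\ forall a, `|p 0 (xI a) - x0 0 a| <= rho.
Proof.
move=> rho0 p0 c0.
have pr : p 0 tI < rho by rewrite ltNge; apply/negP => /cone_fct_le0 - /(_ x0); rewrite leNgt c0.
split=> // a.
have H : (p 0 (xI a) - x0 0 a) ^+ 2 <= rho ^+ 2.
  apply: (@le_trans _ _ (dist2 x0 p)).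
    by rewrite /dist2 (bigD1 a)//= lerDl sumr_ge0// => b _; exact: sqr_ge0.
  have := c0; rewrite /cone_fct sqp_pos; last by rewrite subr_ge0 ltW.
  by rewrite subr_gt0 => /ltW/le_trans; apply; nra.
have r0 := ltW rho0.
by rewrite -ler_sqr ?nnegrE// real_normK ?num_real.
Qed.

Lemma sub_wave_operator (a b c a' b' c' : R) : a - a' - (b - b') + (c - c') = a - b + c - (a' - b' + c').
Proof. by ring. Qed.

Lemma sub_nonlinearity (a b a' b' : R) :
  a ^+ 2 * b - a' ^+ 2 * b' = (a + a') * b * (a - a') + a' * a' * (b - b').
Proof. by ring. Qed.

(** The difference of two solutions satisfies a linear equation whose
    coefficients are bounded on the compact cone, to which cone_zero applies. *)
Theorem cone_uniqueness T rho x0 u v : 0 < rho < T -> kg_solution T u -> kg_solution T v ->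
  (forall x, \sum_(a < 3) (x 0 a - x0 0 a) ^+ 2 < rho ^+ 2 ->
     u (event 0 x) = v (event 0 x) /\ dt T u (event 0 x) = dt T v (event 0 x)) ->
  forall t, 0 <= t < rho -> u (event t x0) = v (event t x0).
Proof.
move=> /andP[rho0 rhoT] [C2u Eu] [C2v Ev] init t.
have base p : p 0 tI = 0 -> 0 < cone_fct rho x0 p ->
    u p = v p /\ dt T u p = dt T v p.
  move=> p0; rewrite /cone_fct p0 subr0 sqp_pos ?(ltW rho0)// subr_gt0 => H.
  rewrite -(eventK p) p0; apply: init; apply: le_lt_trans H.
  by rewrite /dist2 le_eqVlt; apply/orP; left; apply/eqP; apply: eq_bigr => a _; rewrite mxE.
rewrite le_eqVlt => /andP[/predU1P[<- _|t0 tr]].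
  apply: (base _ _ _).1; first by rewrite event_tI.
  rewrite /cone_fct event_tI subr0 sqp_pos ?(ltW rho0)// /dist2 big1 ?subr0 ?exprn_gt0//.
  by move=> a _; rewrite event_xI subrr expr2 mul0r.
set D := time_slab T in C2u C2v Eu Ev *.
pose w p := u p - v p.
pose w1 i p := pderiv D i u p - pderiv D i v p.
pose w2 i j p := pderiv D i (pderiv D j u) p - pderiv D i (pderiv D j v) p.
have C1u := Ck_le C2u; have C1v := Ck_le C2v.
have cD f k : Ck D k.+1 f -> {within D, continuous f} by case.
have cu1 f i : Ck D 2 f -> {within D, continuous (pderiv D i f)} by move=> [_ /(_ i)[_ []]].
have cu2 f i j : Ck D 2 f -> {within D, continuous (pderiv D i (pderiv D j f))}.
  by move=> [_ /(_ j)[_ [_ /(_ i)[]]]].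
have cw : {within D, continuous w} by apply: withinB; [exact: cD C2u|exact: cD C2v].
have cw1 i : {within D, continuous (w1 i)} by apply: withinB; exact: cu1.
have cw2 i j : {within D, continuous (w2 i j)} by apply: withinB; exact: cu2.
have dw p i : 0 < p 0 tI < T -> is_derive p (delta_mx 0 i) w (w1 i p).
  by move=> pT; exact: (is_deriveBB (Ck1_is_derive i C1u pT) (Ck1_is_derive i C1v pT)).
have dw1 p i j : 0 < p 0 tI < T -> is_derive p (delta_mx 0 i) (w1 j) (w2 i j p).
  by move=> pT; exact: (is_deriveBB (Ck2_is_derive j i C2u pT) (Ck2_is_derive j i C2v pT)).
have w2C p i j : 0 < p 0 tI < T -> w2 i j p = w2 j i p.
  by move=> pT; rewrite /w2 (pderiv_swap i j C2u pT) (pderiv_swap i j C2v pT).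
have w_init p : p 0 tI = 0 -> 0 < cone_fct rho x0 p -> w p = 0 /\ forall i, w1 i p = 0.
  move=> p0 c0; have [b1 b2] := base p p0 c0; split; first by rewrite /w b1 subrr.
  move=> i; case: (@split_ordP 1 3 i) => [j|a] ->.
    by rewrite (ord1 j) /w1 -/tI; apply/eqP; rewrite subr_eq0; apply/eqP.
  have cc := @cone_fct_continuous R rho x0.
  have [d d0 Hd] := iffLR (within_epsP _ _) cc p Logic.I _ c0.
  apply/eqP; rewrite subr_eq0; apply/eqP; apply: (@pderiv_congr _ _ _ _ _ _ _ _ d d0) => //.
  move=> h hd; split=> // _; apply: (base _ _ _).1.
    by rewrite line_coord eq_sym xI_tI mulr0 addr0.
  have := Hd (p + h *: delta_mx 0 (rshift 1 a)) Logic.I (fun k => line_near p (rshift 1 a) k hd); rewrite ltr_norml => /andP[+ _].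
  by rewrite ltrBrDl subrr.
pose lo : 'rV[R]_(1 + 3) := event 0 (\row_a (x0 0 a - rho)).
pose hi : 'rV[R]_(1 + 3) := event rho (\row_a (x0 0 a + rho)).
have cK := @segments_compact _ lo hi; set K := [set x | _] in cK.
have KD : K `<=` D.
  move=> p /(_ tI); rewrite !event_tI => /andP[p0 pr]; apply/slabE.
  by rewrite p0 (le_lt_trans pr).
have coneK p : 0 < p 0 tI -> 0 < cone_fct rho x0 p -> K p.
  move=> p0 c0; have [pr pa] := cone_fct_box rho0 (ltW p0) c0.
  move=> i; case: (@split_ordP 1 3 i) => [j|a] ->.
    by rewrite (ord1 j) -/tI !event_tI !ltW.
  by rewrite -/(xI a) !event_xI !mxE -ler_distl.
pose h1 p := (dt T u p + dt T v p) * dx T ord0 u p.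
pose h2 p := dt T v p * dt T v p.
have c1 : {within D, continuous h1}.
  by apply: withinM; [apply: withinD|]; exact: cu1.
have c2 : {within D, continuous h2} by apply: withinM; exact: cu1.
have [M1 M10 H1] := compact_within_bounded cK KD c1.
have [M2 M20 H2] := compact_within_bounded cK KD c2.
have M0 := addr_ge0 M10 M20.
suff : w (event t x0) = 0 by move/eqP; rewrite subr_eq0 => /eqP.
apply: (cone_zero rho0 rhoT cw cw1 cw2 dw dw1 w2C w_init M0 erefl).
- move=> p p0 c0; have Kp := coneK p p0 c0; have Dp := KD p Kp.
  have -> : w2 tI tI p - \sum_(a < 3) w2 (xI a) (xI a) p + w p =
      (dalembertian T u p + u p) - (dalembertian T v p + v p).
    by rewrite /dalembertian /w2 /w sumrB; exact: sub_wave_operator.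
  rewrite Eu// Ev//.
  have -> : dt T u p ^+ 2 * dx T ord0 u p - dt T v p ^+ 2 * dx T ord0 v p =
      h1 p * w1 tI p + h2 p * w1 (xI ord0) p.
    exact: sub_nonlinearity.
  apply: le_trans (ler_normD _ _) _; rewrite (normrM (h1 p)) (normrM (h2 p)).
  have e1 := ler_wpM2r (normr_ge0 (w1 tI p)) (H1 p Kp).
  have e2 := ler_wpM2r (normr_ge0 (w1 (xI ord0) p)) (H2 p Kp).
  apply: le_trans (lerD e1 e2) _.
  move: (normr_ge0 (w1 tI p)) (normr_ge0 (w1 (xI ord0) p)).
  move: `|w1 tI p| `|w1 (xI ord0) p| => a b a0 b0.
  rewrite mulrDl !mulrDr; apply: lerD; [rewrite lerDl|rewrite lerDr]; exact: mulr_ge0.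
- by rewrite event_tI.
rewrite /cone_fct event_tI sqp_pos ?subr_ge0 ?(ltW tr)// /dist2 big1 ?subr0 ?exprn_gt0 ?subr_gt0//.
by move=> a _; rewrite event_xI subrr expr2 mul0r.
Qed.

End Uniqueness.

(** * Primitives and dominated series of functions *)

Section Primitive.
Context {R : realType}.

Lemma local_primitive (f : R -> R) (r : R) : 0 < r -> continuous f ->
  exists F : R -> R, F 0 = 0 /\ forall x : R, `|x| < r -> is_derive x 1 F (f x).
Proof.
move=> r0 cf.
have r10 : 0 < r + 1 by rewrite addr_gt0.
pose F x := (\int[lebesgue_measure]_(t in `[- (r + 1), x]) f t)%R.
exists (fun x => F x - F 0); split; first by rewrite subrr.
move=> x; rewrite ltr_norml => /andP[rx xr].
have itf : lebesgue_measure.-integrable `[- (r + 1), r + 1] (EFin \o f).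
  apply: continuous_compact_integrable; first exact: segment_compact.
  exact: continuous_subspaceT.
have x1 : x < r + 1 by lra.
have ax : - (r + 1) < x by lra.
have [dF DF] := continuous_FTC1 x1 itf ax (cf x).
suff DD : is_derive x 1 F (f x).
  by have := is_deriveB DD (is_derive_c1 (F 0) x); rewrite subr0.
by split; [exact: dF|rewrite -derive1E; exact: DF].
Qed.

Lemma primitive_ex (f : R -> R) : continuous f ->
  exists F : R -> R, F 0 = 0 /\ forall x : R, is_derive x 1 F (f x).
Proof.
move=> cf.
have H (n : nat) : {F : R -> R | F 0 = 0 /\ forall x : R, `|x| < n.+1%:R -> is_derive x 1 F (f x)}.
  by apply: cid; apply: local_primitive.
pose F n := sval (H n).
have F0 n : F n 0 = 0 := (svalP (H n)).1.
have DF n (x : R) : `|x| < n.+1%:R -> is_derive x 1 (F n) (f x) := (svalP (H n)).2 x.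
have FF m n (x : R) : `|x| < m.+1%:R -> `|x| < n.+1%:R -> F m x = F n x.
  move=> xm xn; pose g y := F m y - F n y.
  have := @mean_value_le0 R g (fun=> 0) x 0 0.
  rewrite /g !F0 subrr subr0 !mul0r subr0 => H0; apply/eqP; rewrite -subr_eq0 -normr_le0.
  apply: H0 => y yx; last by rewrite normr0.
  have D1 := DF m y (le_lt_trans yx xm); have D2 := DF n y (le_lt_trans yx xn).
  by have := is_deriveB D1 D2; rewrite subrr.
pose k (x : R) : nat := Num.truncn `|x|.
have kx x : `|x| < (k x).+1%:R by exact: truncnS_gt.
exists (fun x => F (k x) x); split; first exact: F0.
move=> x; have kx2 : `|x| < (k x).+2%:R by apply: lt_trans (kx x) _; rewrite ltr_nat.
have e0 : 0 < (k x).+2%:R - `|x| by rewrite subr_gt0.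
apply: (is_derive_near e0 _ (DF (k x).+1 x kx2)) => h hx.
apply: FF; first exact: kx.
apply: le_lt_trans (ler_normD _ _) _; move: hx; lra.
Qed.

(** Total in f, with value 0 when f is not continuous, so that it can be used
    inside definitions. *)
Definition primitive (f : R -> R) : R -> R :=
  match pselect (continuous f) with
  | left cf => projT1 (cid (primitive_ex cf))
  | right _ => fun=> 0
  end.

Lemma primitiveP f : continuous f ->
  primitive f 0 = 0 /\ forall x : R, is_derive x 1 (primitive f) (f x).
Proof. by move=> cf; rewrite /primitive; case: pselect => // cf'; case: cid. Qed.

Lemma primitive_le f (M t : R) : continuous f -> (forall s, `|s| <= `|t| -> `|f s| <= M) ->
  `|primitive f t| <= M * `|t|.
Proof.
move=> cf fM; have [p0 Dp] := primitiveP cf.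
have := @mean_value_le0 R (primitive f) f t 0 M; rewrite p0 mul0r !subr0; apply => //.
by move=> x xt; rewrite subr0; exact: fM.
Qed.

End Primitive.

Section SeriesSum.
Context {R : realType}.
Implicit Types (u v M : nat -> R).

Definition summable_seq M := exists C, forall n, 0 <= M n /\ \sum_(k < n) M k <= C.

Definition ssum u : R := lim ((fun n => \sum_(k < n) u k) @ \oo).

Definition dominated u M := forall n, `|u n| <= M n.

Lemma psum_seriesE u : (fun n => \sum_(k < n) u k) = series u.
Proof. by apply/funext => n; rewrite /series/= big_mkord. Qed.

Lemma summable_cvg M : summable_seq M -> (fun n => \sum_(k < n) M k) @ \oo --> ssum M.
Proof.
move=> [C HC]; suff : cvg ((fun n => \sum_(k < n) M k) @ \oo) by [].
apply: nondecreasing_is_cvgn.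
  by apply/nondecreasing_seqP => n; rewrite big_ord_recr/= lerDl; exact: (HC n).1.
by exists C => _ [n _ <-]; exact: (HC n).2.
Qed.

Lemma dominated_cvg u M : summable_seq M -> dominated u M -> (fun n => \sum_(k < n) u k) @ \oo --> ssum u.
Proof.
move=> sM uM; suff : cvg ((fun n => \sum_(k < n) u k) @ \oo) by [].
have [C HC] := sM.
have H : cvgn (series (fun n => `|u n|)).
  rewrite -psum_seriesE; apply: nondecreasing_is_cvgn.
    by apply/nondecreasing_seqP => n; rewrite big_ord_recr/= lerDl.
  exists C => _ [n _ <-]; apply: le_trans (HC n).2.
  by apply: ler_sum => k _; exact: uM.
by rewrite psum_seriesE; exact: normed_cvg H.
Qed.

Definition tail M N := ssum M - \sum_(k < N) M k.

Lemma tail_cvg M e : summable_seq M -> 0 < e -> exists N, `|tail M N| < e.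
Proof.
move=> /summable_cvg/cvgrPdist_lt/(_ e) + e0 => /(_ e0) [N _ HN].
by exists N; exact: HN (leqnn N).
Qed.

Lemma psum_split u (N n : nat) : (N <= n)%N ->
  \sum_(k < n) u k - \sum_(k < N) u k = \sum_(N <= k < n) u k.
Proof.
move=> Nn; have E m : \sum_(k < m) u k = \sum_(0 <= k < m) u k by rewrite big_mkord.
by rewrite !E (big_cat_nat (leq0n N) Nn)/= addrAC subrr add0r.
Qed.

Lemma ssum_tail u M N : summable_seq M -> dominated u M -> `|ssum u - \sum_(k < N) u k| <= tail M N.
Proof.
move=> sM uM; have cu := dominated_cvg sM uM; have cM := summable_cvg sM.
have c1 : (fun n => `|\sum_(k < n) u k - \sum_(k < N) u k|) @ \oo --> `|ssum u - \sum_(k < N) u k|.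
  by apply: cvg_norm; apply: cvgB => //; exact: cvg_cst.
have c2 : (fun n => \sum_(k < n) M k - \sum_(k < N) M k) @ \oo --> tail M N.
  by apply: cvgB => //; exact: cvg_cst.
apply: (ler_cvg_to c1 c2); near=> n.
have Nn : (N <= n)%N by near: n; exact: nbhs_infty_ge.
rewrite !psum_split//.
by apply: le_trans (ler_norm_sum _ _ _) _; apply: ler_sum => k _; exact: uM.
Unshelve. all: by end_near. Qed.

Lemma ssumD u v M : summable_seq M -> dominated u M -> dominated v M ->
  ssum (fun n => u n + v n) = ssum u + ssum v.
Proof.
move=> sM uM vM; apply: cvg_lim => //.
rewrite (_ : (fun n => _) = (fun n => \sum_(k < n) u k + \sum_(k < n) v k)).
  by apply: cvgD; apply: dominated_cvg sM _.
by apply/funext => n; rewrite big_split.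
Qed.

Lemma ssumZ u c M : summable_seq M -> dominated u M -> ssum (fun n => c * u n) = c * ssum u.
Proof.
move=> sM uM; apply: cvg_lim => //.
rewrite (_ : (fun n => _) = (fun n => c * \sum_(k < n) u k)).
  by apply: cvgM; [exact: cvg_cst|exact: dominated_cvg sM _].
by apply/funext => n; rewrite mulr_sumr.
Qed.

Lemma summableZ M c : 0 <= c -> summable_seq M -> summable_seq (fun n => c * M n).
Proof.
move=> c0 [C HC]; exists (c * C) => n; split; first by rewrite mulr_ge0//; exact: (HC n).1.
by rewrite -mulr_sumr ler_wpM2l//; exact: (HC n).2.
Qed.

Lemma ssum_continuous (T : topologicalType) (D : set T) (f : nat -> T -> R) M :
  summable_seq M -> (forall n, {within D, continuous (f n)}) ->
  (forall n p, D p -> `|f n p| <= M n) -> {within D, continuous (fun p => ssum (f^~ p))}.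
Proof.
move=> sM cf fM; apply/subspace_continuousP => p Dp; apply/cvgrPdist_le => e e0.
have e3 : 0 < e / 3 by rewrite divr_gt0.
have [N HN] := tail_cvg sM e3.
have cS : {within D, continuous (fun p => \sum_(k < N) f k p)}.
  by apply: within_sum => k; exact: cf.
move/subspace_continuousP : cS => /(_ p Dp)/cvgrPdist_le/(_ _ e3).
rewrite !near_withinE; apply: filterS => q Hq Dq.
have dom z : D z -> dominated (f^~ z) M by move=> Dz n; exact: fM.
have Tp := ssum_tail N sM (dom p Dp); have Tq := ssum_tail N sM (dom q Dq).
have tN := ltW (le_lt_trans (ler_norm _) HN).
have {}Hq : `|\sum_(k < N) f k p - \sum_(k < N) f k q| <= e / 3 := Hq Dq.
change (`|ssum (f^~ p) - ssum (f^~ q)| <= e).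
rewrite (_ : ssum (f^~ p) - _ = (ssum (f^~ p) - \sum_(k < N) f k p) + (\sum_(k < N) f k p - \sum_(k < N) f k q)
   - (ssum (f^~ q) - \sum_(k < N) f k q)); last by ring.
apply: le_trans (ler_normB _ _) _; apply: le_trans (lerD (ler_normD _ _) (lexx _)) _.
apply: le_trans (lerD (lerD Tp Hq) Tq) _; apply: le_trans (lerD (lerD tN (lexx _)) tN) _.
by rewrite le_eqVlt; apply/orP; left; apply/eqP; field.
Qed.

Lemma is_derive_shiftl (f : R -> R) (x y d : R) : is_derive (x + y) 1 f d ->
  is_derive y 1 (fun h => f (x + h)) d.
Proof.
move=> /is_derive1_epsP H; apply/is_derive1_epsP => e /H[r r0 Hr]; exists r => // h hr.
by rewrite addrA; exact: Hr.
Qed.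

(** Term by term differentiation: the tails of the difference quotients are
    bounded by the tail of the dominating series. *)
Lemma ssum_derive (f g : nat -> R -> R) M (x r : R) : 0 < r -> summable_seq M ->
  (forall n h, `|h| < r -> is_derive (x + h) 1 (f n) (g n (x + h))) ->
  (forall n h, `|h| < r -> `|f n (x + h)| <= M n) ->
  (forall n h, `|h| < r -> `|g n (x + h)| <= M n) ->
  is_derive x 1 (fun z => ssum (f^~ z)) (ssum (g^~ x)).
Proof.
move=> r0 sM Df fM gM; apply/is_derive1_epsP => e e0.
have e3 : 0 < e / 3 by rewrite divr_gt0.
have [N HN] := tail_cvg sM e3.
have tN := ltW (le_lt_trans (ler_norm _) HN).
have Dsum : is_derive x 1 (fun z => \sum_(k < N) f k z) (\sum_(k < N) g k x).
  have : forall n, is_derive x 1 (fun z => \sum_(k < n) f k z) (\sum_(k < n) g k x).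
    elim=> [|n IH].
      rewrite big_ord0 (_ : (fun z => _) = (fun=> 0)); first exact: is_derive_c1.
      by apply/funext => z; rewrite big_ord0.
    rewrite big_ord_recr/= (_ : (fun z => _) = (fun z => \sum_(k < n) f k z + f n z)); last first.
      by apply/funext => z; rewrite big_ord_recr.
    have D0 := Df n 0; rewrite addr0 normr0 in D0.
    exact: (is_deriveD IH (D0 r0)).
  exact.
have [d d0 Hd] := iffLR (is_derive1_epsP _ _ _) Dsum _ e3.
exists (Num.min r d); first by rewrite lt_min r0.
move=> h; rewrite lt_min => /andP[hr hd].
pose w n := f n (x + h) - f n x - g n x * h.
have z0 : `|0 : R| < r by rewrite normr0.
have wM n : `|w n| <= 2 * `|h| * M n.
  have : `|f n (x + h) - f n x| <= M n * `|h|.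
    have := @mean_value_le0 R (fun h => f n (x + h)) (fun h => g n (x + h)) h 0 (M n).
    rewrite mul0r subr0 addr0; apply => y yh; last by rewrite subr0; apply: gM; exact: le_lt_trans yh _.
    by apply: is_derive_shiftl; exact: Df n y (le_lt_trans yh hr).
  move=> H1; apply: le_trans (ler_normB _ _) _; apply: le_trans (lerD H1 (lexx _)) _.
  rewrite normrM; have := gM n 0 z0; rewrite addr0 => H2.
  have := ler_wpM2r (normr_ge0 h) H2; lra.
have h20 : 0 <= 2 * `|h| by rewrite mulr_ge0.
have domf : dominated (fun n => f n (x + h)) M by move=> n; exact: fM.
have domf0 : dominated (fun n => f n x) M by move=> n; have := fM n 0 z0; rewrite addr0.
have domg0 : dominated (fun n => g n x) M by move=> n; have := gM n 0 z0; rewrite addr0.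
have E : ssum w = ssum (f^~ (x + h)) - ssum (f^~ x) - ssum (g^~ x) * h.
  pose K n := (2 + `|h|) * M n.
  have sK : summable_seq K by apply: summableZ => //; rewrite addr_ge0.
  have M0 n : 0 <= M n by exact: le_trans (normr_ge0 _) (domf n).
  have k1 : dominated (fun n => f n (x + h) + -1 * f n x) K.
    move=> n; apply: le_trans (ler_normD _ _) _; rewrite mulN1r normrN.
    have := domf n; have := domf0 n; have := mulr_ge0 (normr_ge0 h) (M0 n); rewrite /K => *; lra.
  have k2 : dominated (fun n => - h * g n x) K.
    move=> n; rewrite normrM normrN; have := ler_wpM2l (normr_ge0 h) (domg0 n).
    by have := M0 n; rewrite /K => *; lra.
  have k3 : dominated (fun n => -1 * f n x) M by move=> n; rewrite mulN1r normrN; exact: domf0.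
  have -> : w = (fun n => (f n (x + h) + -1 * f n x) + - h * g n x).
    by apply/funext => n; rewrite /w; ring.
  rewrite (ssumD sK k1 k2) (ssumD sM domf k3) (ssumZ _ sM domf0) (ssumZ _ sM domg0); ring.
have := ssum_tail N (summableZ h20 sM) wM; rewrite E.
have -> : tail (fun n => 2 * `|h| * M n) N = 2 * `|h| * tail M N.
  rewrite /tail mulrBr -mulr_sumr; congr (_ - _).
  by apply: ssumZ sM _ => n; rewrite ger0_norm// (le_trans _ (domf n)).
have := Hd h hd.
rewrite (_ : \sum_(k < N) f k (x + h) - _ - _ = \sum_(k < N) w k); last first.
  by rewrite mulr_suml -!sumrB.
set S := ssum _ - _ - _; set W := \sum_(k < N) w k => a1 a2.
rewrite -(subrK W S); apply: le_trans (ler_normD _ _) _.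
have := ler_wpM2l (normr_ge0 h) tN; lra.
Qed.

End SeriesSum.

Section Ck2Intro.
Context {R : realType}.
Variables (T : R) (U : 'rV[R]_(1 + 3) -> R) (U1 : 'I_(1 + 3) -> 'rV[R]_(1 + 3) -> R)
  (U2 : 'I_(1 + 3) -> 'I_(1 + 3) -> 'rV[R]_(1 + 3) -> R).
Let O := [set p : 'rV[R]_(1 + 3) | `|p 0 tI| < T].
Hypotheses (cU : {within O, continuous U}) (cU1 : forall i, {within O, continuous (U1 i)})
  (cU2 : forall j i, {within O, continuous (U2 j i)})
  (DU : forall p i, O p -> is_derive p (delta_mx 0 i) U (U1 i p))
  (DU1 : forall p i j, O p -> is_derive p (delta_mx 0 j) (U1 i) (U2 j i p)).

Let DO p : time_slab T p -> O p.
Proof. by move=> /slabE/andP[p0 pT]; rewrite /O/= ger0_norm. Qed.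

(** Derivatives across time 0 are the one-sided ones of the slab when the
    function extends differentiably to negative times. *)
Lemma Ck2_intro : Ck (time_slab T) 2 U /\ forall p, time_slab T p -> forall i j,
  pderiv (time_slab T) i U p = U1 i p /\ pderiv (time_slab T) j (pderiv (time_slab T) i U) p = U2 j i p.
Proof.
have E1 p i : time_slab T p -> pderivable (time_slab T) i U p /\ pderiv (time_slab T) i U p = U1 i p.
  by move=> Dp; apply: pderiv_is_derive; [apply: DU; exact: DO|exact: slab_proper].
have E2 p i j : time_slab T p -> pderivable (time_slab T) j (U1 i) p /\ pderiv (time_slab T) j (U1 i) p = U2 j i p.
  by move=> Dp; apply: pderiv_is_derive; [apply: DU1; exact: DO|exact: slab_proper].
have E3 p i j : time_slab T p -> pderivable (time_slab T) j (pderiv (time_slab T) i U) p /\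
    pderiv (time_slab T) j (pderiv (time_slab T) i U) p = U2 j i p.
  move=> Dp; have [d1 d2] := E2 p i j Dp; split.
    apply: (@pderivable_congr _ _ _ _ _ _ _ _ 1 _ _ _ d1) => //; first by rewrite (E1 p i Dp).2.
    by move=> h _; split=> // Dh; rewrite (E1 _ i Dh).2.
  rewrite -d2; apply: (@pderiv_congr _ _ _ _ _ _ _ _ 1) => //; first exact: (E1 p i Dp).2.
  by move=> h _; split=> // Dh; exact: (E1 _ i Dh).2.
have sub (f : 'rV[R]_(1 + 3) -> R) : {within O, continuous f} -> {within time_slab T, continuous f}.
  by move=> cf; exact: (continuous_subspaceW (fun p => @DO p) cf).
split; last by move=> p Dp i j; split; [exact: (E1 p i Dp).2|exact: (E3 p i j Dp).2].
split; first exact: sub.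
move=> i; split; first by move=> p Dp; exact: (E1 p i Dp).1.
split; first by apply: (@Ck_eq _ _ 0 _ _ (U1 i)); [move=> p Dp; exact: (E1 p i Dp).2|exact: sub].
move=> j; split; first by move=> p Dp; exact: (E3 p i j Dp).1.
by apply: (@Ck_eq _ _ 0 _ _ (U2 j i)); [move=> p Dp; exact: (E3 p i j Dp).2|exact: sub].
Qed.

End Ck2Intro.

(** * Finite sums of plane waves *)

Section SeqSums.
Context {R : realType} {I : Type}.
Implicit Types (L : seq I).

Lemma within_bigseq (T : topologicalType) (D : set T) L (f : I -> T -> R) :
  (forall A, {within D, continuous (f A)}) -> {within D, continuous (fun x => \sum_(A <- L) f A x)}.
Proof.
move=> cf; elim: L => [|A L IH].
  rewrite (_ : (fun x => _) = (fun=> 0)); first exact: within_cst.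
  by apply/funext => x; rewrite big_nil.
rewrite (_ : (fun x => _) = (fun x => f A x + \sum_(B <- L) f B x)); first exact: withinD.
by apply/funext => x; rewrite big_cons.
Qed.

Lemma is_derive_bigseq n L (f : I -> 'rV[R]_n -> R) df p v :
  (forall A, is_derive p v (f A) (df A)) ->
  is_derive p v (fun q => \sum_(A <- L) f A q) (\sum_(A <- L) df A).
Proof.
move=> Df; elim: L => [|A L IH].
  rewrite big_nil (_ : (fun q => _) = (fun=> 0)); first exact: is_derive_cc.
  by apply/funext => q; rewrite big_nil.
rewrite big_cons (_ : (fun q => _) = (fun q => f A q + \sum_(B <- L) f B q)); first exact: is_deriveDD.
by apply/funext => q; rewrite big_cons.
Qed.

Lemma norm_bigseq_le L (f b : I -> R) : (forall A, `|f A| <= b A) ->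
  `|\sum_(A <- L) f A| <= \sum_(A <- L) b A.
Proof. by move=> fb; apply: le_trans (ler_norm_sum _ _ _) _; apply: ler_sum => A _. Qed.

End SeqSums.

Section Frequencies.
Context {R : realType}.
Implicit Types (xi eta : 'rV[R]_3) (p : 'rV[R]_(1 + 3)).

Definition om xi : R := Num.sqrt (1 + \sum_(a < 3) xi 0 a ^+ 2).

Lemma om2 xi : om xi ^+ 2 = 1 + \sum_(a < 3) xi 0 a ^+ 2.
Proof. by rewrite sqr_sqrtr// addr_ge0// sumr_ge0// => a _; exact: sqr_ge0. Qed.

Lemma om_ge1 xi : 1 <= om xi.
Proof.
rewrite -(@ler_pXn2r _ 2) ?nnegrE ?sqrtr_ge0// expr1n om2 lerDl sumr_ge0// => a _.
exact: sqr_ge0.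
Qed.

Lemma om_gt0 xi : 0 < om xi. Proof. exact: lt_le_trans (om_ge1 xi). Qed.

Lemma coord_le_om xi a : `|xi 0 a| <= om xi.
Proof.
rewrite -(@ler_pXn2r _ 2) ?nnegrE ?sqrtr_ge0// real_normK ?num_real// om2 (bigD1 a)//=.
by rewrite addrCA lerDl addr_ge0// sumr_ge0// => b _; exact: sqr_ge0.
Qed.

(** Submultiplicativity of the weight, for sums and differences of frequencies;
    it makes weighted sums of waves an algebra. *)
Lemma om_add xi eta (s : R) : `|s| = 1 -> om (xi + s *: eta) <= 2 * (om xi * om eta).
Proof.
move=> s1; have s2 : s ^+ 2 = 1 by rewrite -real_normK ?num_real// s1 expr1n.
rewrite -(@ler_pXn2r _ 2) ?nnegrE ?sqrtr_ge0 ?mulr_ge0 ?sqrtr_ge0// !exprMn !om2.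
have H : \sum_(a < 3) (xi + s *: eta) 0 a ^+ 2 <=
    2 * \sum_(a < 3) xi 0 a ^+ 2 + 2 * \sum_(a < 3) eta 0 a ^+ 2.
  rewrite !mulr_sumr -big_split; apply: ler_sum => a _; rewrite !mxE.
  have := sqr_ge0 (xi 0 a - s * eta 0 a).
  have -> : (xi 0 a + s * eta 0 a) ^+ 2 = 2 * xi 0 a ^+ 2 + 2 * (s ^+ 2 * eta 0 a ^+ 2) - (xi 0 a - s * eta 0 a) ^+ 2 by ring.
  by rewrite s2 mul1r => h; rewrite lerBlDr lerDl.
set X := \sum_(a < 3) xi 0 a ^+ 2 in H *; set Y := \sum_(a < 3) eta 0 a ^+ 2 in H *.
have X0 : 0 <= X by apply: sumr_ge0 => a _; exact: sqr_ge0.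
have Y0 : 0 <= Y by apply: sumr_ge0 => a _; exact: sqr_ge0.
have := mulr_ge0 X0 Y0; nra.
Qed.

Definition phase xi (al : R) p := \sum_(a < 3) xi 0 a * p 0 (xI a) + al.
Definition wave xi al p := cos (phase xi al p).
Definition swave xi al p := sin (phase xi al p).
Definition delta_t (i : 'I_(1 + 3)) : R := (tI == i)%:R.
(** The component of (0, xi) along the coordinate i. *)
Definition freq xi (i : 'I_(1 + 3)) : R := \sum_(a < 3) xi 0 a * (xI a == i)%:R.

Lemma freq_tI xi : freq xi tI = 0.
Proof. by rewrite /freq big1// => a _; rewrite xI_tI mulr0. Qed.

Lemma freq_xI xi a : freq xi (xI a) = xi 0 a.
Proof.
rewrite /freq (bigD1 a)//= eqxx mulr1 big1 ?addr0// => b /negbTE ba.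
by rewrite (inj_eq (@rshift_inj _ _)) ba mulr0.
Qed.

Lemma freq_le xi i : `|freq xi i| <= om xi.
Proof.
case: (@split_ordP 1 3 i) => [j|a] ->.
  by rewrite (ord1 j) -/tI freq_tI normr0 ltW// om_gt0.
by rewrite -/(xI a) freq_xI coord_le_om.
Qed.

Lemma delta_t_le i : `|delta_t i| <= 1.
Proof. by rewrite /delta_t; case: (tI == i); rewrite ?normr1 ?normr0. Qed.

Lemma phase_derive xi (al : R) p i : is_derive p (delta_mx 0 i) (phase xi al) (freq xi i).
Proof.
have D : is_derive p (delta_mx 0 i) (fun q : 'rV[R]_(1 + 3) => \sum_(a < 3) xi 0 a * q 0 (xI a)) (freq xi i).
  apply: is_derive_sumf => a.
  apply: (is_derive_eq (is_deriveMM (is_derive_cc (xi 0 a) p _) (is_derive_coord p i (xI a)))).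
  by rewrite mul0r add0r.
by apply: (is_derive_eq (is_deriveDD D (is_derive_cc al p _))); rewrite addr0.
Qed.

Lemma wave_derive xi (al : R) p i : is_derive p (delta_mx 0 i) (wave xi al) (- freq xi i * swave xi al p).
Proof.
apply: (is_derive_eq (is_derive_comp1 (phase_derive xi al p i) (is_derive_cos _))).
by rewrite /swave; ring.
Qed.

Lemma swave_derive xi (al : R) p i : is_derive p (delta_mx 0 i) (swave xi al) (freq xi i * wave xi al p).
Proof.
apply: (is_derive_eq (is_derive_comp1 (phase_derive xi al p i) (is_derive_sin _))).
by rewrite /wave; ring.
Qed.

Lemma wave_le xi al p : `|wave xi al p| <= 1.
Proof. by rewrite ler_norml cos_geN1 cos_le1. Qed.

Lemma swave_le xi al p : `|swave xi al p| <= 1.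
Proof. by rewrite ler_norml sin_geN1 sin_le1. Qed.

Lemma phase_continuous xi al : {within setT, continuous (phase xi al)}.
Proof.
apply: withinD; last exact: within_cst.
by apply: within_sum => a; apply: withinM; [exact: within_cst|exact: coordc].
Qed.

Lemma wave_continuous xi al : {within setT, continuous (wave xi al)}.
Proof. by apply: within_comp; [exact: continuous_cos|exact: phase_continuous]. Qed.

Lemma swave_continuous xi al : {within setT, continuous (swave xi al)}.
Proof. by apply: within_comp; [exact: continuous_sin|exact: phase_continuous]. Qed.

Lemma time_continuous (f : R -> R) : continuous f -> {within setT, continuous (fun p => f (p 0 tI))}.
Proof. by move=> cf; apply: within_comp => //; exact: coordc. Qed.

Lemma time_derive (f : R -> R) p i d : is_derive (p 0 tI) 1 f d ->
  is_derive p (delta_mx 0 i) (fun q => f (q 0 tI)) (d * delta_t i).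
Proof. by move=> Df; exact: (is_derive_comp1 (is_derive_coord p i tI) Df). Qed.

(** Products of cosines are sums of cosines, at the sum and at the difference of
    the frequencies. *)
Lemma wave_mul xi al eta be p : wave xi al p * wave eta be p =
  2^-1 * wave (xi + 1 *: eta) (al + be) p + 2^-1 * wave (xi + -1 *: eta) (al - be) p.
Proof.
have E (s : R) c : phase (xi + s *: eta) (al + s * c) p = phase xi al p + s * phase eta c p.
  rewrite /phase mulrDr mulr_sumr addrACA -big_split /=; congr (_ + _).
  by apply: eq_bigr => a _; rewrite !mxE; ring.
rewrite /wave.
have -> : phase (xi + 1 *: eta) (al + be) p = phase xi al p + phase eta be p by rewrite -{1}[be]mul1r E mul1r.
have -> : phase (xi + -1 *: eta) (al - be) p = phase xi al p - phase eta be p by have := E (-1) be; rewrite !mulN1r.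
rewrite (cosD (phase xi al p) (phase eta be p)) (cosB (phase xi al p) (phase eta be p)).
move: (cos _) (cos _) (sin _) (sin _) => a b c d; lra.
Qed.

End Frequencies.

Section Atoms.
Context {R : realType}.
Variable tau : R.
Hypotheses (tau0 : 0 < tau) (tau1 : tau <= 1).
Implicit Types (p : 'rV[R]_(1 + 3)) (xi : 'rV[R]_3).

(** One term a(t) cos(xi.x + alpha) of a solution, with two derivatives of a and
    a single number ub bounding all quantities that the iteration needs: two
    powers of the frequency on a, one on its derivative. The factor tau on the
    second derivative is harmless because that bound is used only for
    differentiability. *)
Record uatom := UAtom {
  ua : R -> R; ua1 : R -> R; ua2 : R -> R; ub : R; uxi : 'rV[R]_3; ual : R;
  ua_derive : forall t : R, is_derive t 1 ua (ua1 t);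
  ua1_derive : forall t : R, is_derive t 1 ua1 (ua2 t);
  ua2_cont : continuous ua2;
  ua_le : forall t, `|t| <= tau -> om uxi ^+ 2 * `|ua t| <= ub;
  ua1_le : forall t, `|t| <= tau -> om uxi * `|ua1 t| <= ub;
  ua2_le : forall t, `|t| <= tau -> tau * `|ua2 t| <= ub }.

(** One term of a first derivative of a solution or of a product of such: one
    power of the frequency is left. *)
Record fatom := FAtom {
  fa : R -> R; fb : R; fxi : 'rV[R]_3; fal : R;
  fa_cont : continuous fa;
  fa_le : forall t, `|t| <= tau -> om fxi * `|fa t| <= fb }.

Let z0 : `|0 : R| <= tau. Proof. by rewrite normr0 ltW. Qed.

Lemma ub_ge0 A : 0 <= ub A.
Proof. by apply: le_trans (ua_le A z0); rewrite mulr_ge0// sqr_ge0. Qed.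

Lemma fb_ge0 F : 0 <= fb F.
Proof. by apply: le_trans (fa_le F z0); rewrite mulr_ge0// ltW// om_gt0. Qed.

Lemma ua_cont A : continuous (ua A).
Proof. by move=> t; exact: derive_cont1 (ua_derive A t). Qed.

Lemma ua1_cont A : continuous (ua1 A).
Proof. by move=> t; exact: derive_cont1 (ua1_derive A t). Qed.

Implicit Types (L : seq uatom) (F G : seq fatom).

Definition unorm L := \sum_(A <- L) ub A.
Definition fnorm F := \sum_(A <- F) fb A.
Definition uval L p := \sum_(A <- L) ua A (p 0 tI) * wave (uxi A) (ual A) p.
Definition uval1 i L p := \sum_(A <- L) (ua1 A (p 0 tI) * delta_t i * wave (uxi A) (ual A) p
  - ua A (p 0 tI) * (freq (uxi A) i * swave (uxi A) (ual A) p)).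
Definition uval2 j i L p := \sum_(A <- L)
  (ua2 A (p 0 tI) * delta_t j * delta_t i * wave (uxi A) (ual A) p
  - ua1 A (p 0 tI) * delta_t i * (freq (uxi A) j * swave (uxi A) (ual A) p)
  - ua1 A (p 0 tI) * delta_t j * (freq (uxi A) i * swave (uxi A) (ual A) p)
  - ua A (p 0 tI) * (freq (uxi A) i * (freq (uxi A) j * wave (uxi A) (ual A) p))).
Definition fval F p := \sum_(A <- F) fa A (p 0 tI) * wave (fxi A) (fal A) p.

Lemma unorm_ge0 L : 0 <= unorm L.
Proof. by apply: sumr_ge0 => A _; exact: ub_ge0. Qed.

Lemma unorm_cat L L' : unorm (L ++ L') = unorm L + unorm L'. Proof. exact: big_cat. Qed.
Lemma fnorm_cat F G : fnorm (F ++ G) = fnorm F + fnorm G. Proof. exact: big_cat. Qed.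
Lemma uval_cat L L' p : uval (L ++ L') p = uval L p + uval L' p. Proof. exact: big_cat. Qed.
Lemma uval1_cat i L L' p : uval1 i (L ++ L') p = uval1 i L p + uval1 i L' p. Proof. exact: big_cat. Qed.
Lemma uval2_cat j i L L' p : uval2 j i (L ++ L') p = uval2 j i L p + uval2 j i L' p. Proof. exact: big_cat. Qed.
Lemma fval_cat F G p : fval (F ++ G) p = fval F p + fval G p. Proof. exact: big_cat. Qed.

Lemma uval_derive L p i : is_derive p (delta_mx 0 i) (uval L) (uval1 i L p).
Proof.
apply: is_derive_bigseq => A.
apply: (is_derive_eq (is_deriveMM (time_derive i (ua_derive A _)) (wave_derive (uxi A) (ual A) p i))).
by ring.
Qed.

Lemma uval1_derive L p i j : is_derive p (delta_mx 0 j) (uval1 i L) (uval2 j i L p).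
Proof.
apply: is_derive_bigseq => A.
have D1 := is_deriveMM (time_derive j (ua1_derive A _)) (is_derive_cc (delta_t i) p (delta_mx 0 j)).
have D2 := is_deriveMM D1 (wave_derive (uxi A) (ual A) p j).
have D3 := is_deriveMM (is_derive_cc (freq (uxi A) i) p (delta_mx 0 j)) (swave_derive (uxi A) (ual A) p j).
have D4 := is_deriveMM (time_derive j (ua_derive A _)) D3.
by apply: (is_derive_eq (is_deriveBB D2 D4)); ring.
Qed.

Lemma uval_continuous L : {within setT, continuous (uval L)}.
Proof.
apply: within_bigseq => A; apply: withinM; last exact: wave_continuous.
exact: time_continuous (@ua_cont A).
Qed.

Lemma uval1_continuous i L : {within setT, continuous (uval1 i L)}.
Proof.
apply: within_bigseq => A; apply: withinB.
  apply: withinM; last exact: wave_continuous.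
  by apply: withinM; [exact: time_continuous (@ua1_cont A)|exact: within_cst].
apply: withinM; first exact: time_continuous (@ua_cont A).
by apply: withinM; [exact: within_cst|exact: swave_continuous].
Qed.

Lemma uval2_continuous j i L : {within setT, continuous (uval2 j i L)}.
Proof.
have c0 A := time_continuous (@ua_cont A); have c1 A := time_continuous (@ua1_cont A).
have c2 A := time_continuous (@ua2_cont A).
have cs A := @swave_continuous R (uxi A) (ual A); have cw A := @wave_continuous R (uxi A) (ual A).
have cc (c : R) : {within setT, continuous (fun _ : 'rV[R]_(1 + 3) => c)} by exact: within_cst.
apply: within_bigseq => A; apply: withinB; [apply: withinB; [apply: withinB|]|].
- by do 3!apply: withinM => //.
- by apply: withinM; apply: withinM => //.
- by apply: withinM; apply: withinM => //.
by do 3!apply: withinM => //.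
Qed.

Section Bounds.
Variables (p : 'rV[R]_(1 + 3)).
Hypothesis pt : `|p 0 tI| <= tau.

Lemma ua_bound A : `|ua A (p 0 tI)| <= ub A /\ om (uxi A) * `|ua A (p 0 tI)| <= ub A /\
  om (uxi A) * om (uxi A) * `|ua A (p 0 tI)| <= ub A.
Proof.
have H := ua_le A pt; rewrite expr2 in H; have o1 := om_ge1 (uxi A).
have a0 := normr_ge0 (ua A (p 0 tI)); have o0 := ltW (om_gt0 (uxi A)).
have h1 : `|ua A (p 0 tI)| <= om (uxi A) * `|ua A (p 0 tI)| by rewrite ler_peMl.
have h2 : om (uxi A) * `|ua A (p 0 tI)| <= om (uxi A) * om (uxi A) * `|ua A (p 0 tI)|.
  by rewrite ler_wpM2r// ler_peMl.
split; last split => //; last exact: le_trans h2 H.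
exact: le_trans h1 (le_trans h2 H).
Qed.

Lemma ua1_bound A : `|ua1 A (p 0 tI)| <= ub A.
Proof. by apply: le_trans (ua1_le A pt); rewrite ler_peMl// om_ge1. Qed.

Lemma le_mul4 (a b c d : R) (B : R) : `|a| <= 1 -> `|b| <= 1 -> `|c| * `|d| <= B -> `|c * (d * (a * b))| <= B.
Proof.
move=> a1 b1 H; rewrite !normrM mulrA; apply: le_trans H; rewrite ler_piMr ?mulr_ge0//.
by rewrite mulr_ile1.
Qed.

Lemma uval_le L : `|uval L p| <= unorm L.
Proof.
apply: norm_bigseq_le => A; rewrite normrM; have [h _] := ua_bound A.
by apply: le_trans h; rewrite ler_piMr// wave_le.
Qed.

Lemma uval1_le i L : `|uval1 i L p| <= 2 * unorm L.
Proof.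
rewrite /unorm mulr_sumr; apply: norm_bigseq_le => A.
have [_ [h2 _]] := ua_bound A; have h1 := ua1_bound A.
rewrite mulr_natl mulr2n; apply: le_trans (ler_normB _ _) _; apply: lerD.
  rewrite -mulrA -[delta_t i * _]mul1r; apply: le_mul4; rewrite ?delta_t_le ?wave_le// normr1 mulr1//.
rewrite !normrM; apply: le_trans h2; rewrite mulrC; apply: ler_wpM2r => //.
by apply: le_trans (freq_le (uxi A) i); rewrite ler_piMr// swave_le.
Qed.

Lemma uval2_le j i L : `|uval2 j i L p| <= 4 / tau * unorm L.
Proof.
rewrite /unorm mulr_sumr; apply: norm_bigseq_le => A.
have [_ [_ h3]] := ua_bound A; have h1 := ua1_le A pt; have h2 := ua2_le A pt.
have b0 := ub_ge0 A.
have bt : ub A <= ub A / tau by rewrite ler_pdivlMr// ler_piMr.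
have h2' : `|ua2 A (p 0 tI)| <= ub A / tau by rewrite ler_pdivlMr// mulrC.
have k1 : `|ua2 A (p 0 tI) * delta_t j * delta_t i * wave (uxi A) (ual A) p| <= ub A / tau.
  rewrite !normrM -!mulrA; apply: le_trans h2'; rewrite ler_piMr// mulr_ile1 ?mulr_ge0 ?delta_t_le//.
  by rewrite mulr_ile1 ?delta_t_le ?wave_le.
have k2 k l : `|ua1 A (p 0 tI) * delta_t k * (freq (uxi A) l * swave (uxi A) (ual A) p)| <= ub A / tau.
  rewrite !normrM; apply: le_trans bt; apply: le_trans h1.
  rewrite mulrC; apply: ler_pM; rewrite ?mulr_ge0//; last by rewrite ler_piMr// delta_t_le.
  by apply: le_trans (freq_le (uxi A) l); rewrite ler_piMr// swave_le.
have k3 : `|ua A (p 0 tI) * (freq (uxi A) i * (freq (uxi A) j * wave (uxi A) (ual A) p))| <= ub A / tau.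
  rewrite !normrM; apply: le_trans bt; apply: le_trans h3; rewrite mulrC; apply: ler_wpM2r => //.
  apply: ler_pM; rewrite ?mulr_ge0// ?freq_le//.
  by apply: le_trans (freq_le (uxi A) j); rewrite ler_piMr// wave_le.
apply: le_trans (ler_normB _ _) _; apply: le_trans (lerD (ler_normB _ _) (lexx _)) _.
apply: le_trans (lerD (lerD (ler_normB _ _) (lexx _)) (lexx _)) _.
apply: le_trans (lerD (lerD (lerD k1 (k2 i j)) (k2 j i)) k3) _.
by rewrite le_eqVlt; apply/orP; left; apply/eqP; field; rewrite gt_eqF.
Qed.

End Bounds.

End Atoms.

Section OneVariable.
Context {R : realType}.
Implicit Types (f g : R -> R) (x : R).

Lemma derive1M f g x df dg : is_derive x 1 f df -> is_derive x 1 g dg ->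
  is_derive x 1 (fun y => f y * g y) (df * g x + f x * dg).
Proof.
move=> Df Dg; apply: (is_derive_eq (is_deriveM Df Dg)).
by rewrite /GRing.scale/= addrC mulrC.
Qed.

Lemma derive1D f g x df dg : is_derive x 1 f df -> is_derive x 1 g dg ->
  is_derive x 1 (fun y => f y + g y) (df + dg).
Proof. by move=> Df Dg; exact: is_deriveD. Qed.

Lemma derive1Z f c x df : is_derive x 1 f df -> is_derive x 1 (fun y => c * f y) (c * df).
Proof.
by move=> Df; apply: (is_derive_eq (derive1M (is_derive_c1 c x) Df)); rewrite mul0r add0r.
Qed.

Lemma derive1_comp f g x df dg : is_derive (g x) 1 f df -> is_derive x 1 g dg ->
  is_derive x 1 (fun y => f (g y)) (df * dg).
Proof. by move=> Df Dg; exact: (@is_derive1_comp R f g x _ _ Df Dg). Qed.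

Lemma derive1_id x : is_derive x 1 (fun y : R => y) 1.
Proof. exact: is_derive_id. Qed.

Lemma derive1_scale (w x : R) : is_derive x 1 (fun y : R => w * y) w.
Proof. by apply: (is_derive_eq (derive1Z w (derive1_id x))); rewrite mulr1. Qed.

Lemma cos_scale (w x : R) : is_derive x 1 (fun y : R => cos (w * y)) (- w * sin (w * x)).
Proof.
by apply: (is_derive_eq (derive1_comp (is_derive_cos _) (derive1_scale w x))); ring.
Qed.

Lemma sin_scale (w x : R) : is_derive x 1 (fun y : R => sin (w * y)) (w * cos (w * x)).
Proof.
by apply: (is_derive_eq (derive1_comp (is_derive_sin _) (derive1_scale w x))); ring.
Qed.

Lemma cos_le (x : R) : `|cos x| <= 1. Proof. by rewrite ler_norml cos_geN1 cos_le1. Qed.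
Lemma sin_le (x : R) : `|sin x| <= 1. Proof. by rewrite ler_norml sin_geN1 sin_le1. Qed.

End OneVariable.

Section Operations.
Context {R : realType}.
Variable tau : R.
Hypotheses (tau0 : 0 < tau) (tau1 : tau <= 1).
Implicit Types (p : 'rV[R]_(1 + 3)) (xi : 'rV[R]_3) (L : seq (uatom tau)) (F G : seq (fatom tau)).

Section Free.
Variables (c d : R) (xi : 'rV[R]_3) (al : R).
Let w := om xi.
Let w0 : w != 0. Proof. by rewrite gt_eqF// om_gt0. Qed.
Let free t := c * cos (w * t) + (d / w) * sin (w * t).
Let free1 t := d * cos (w * t) - c * w * sin (w * t).
Let free2 t := - (w ^+ 2 * free t).

Let free_derive t : is_derive (t : R) 1 free (free1 t).
Proof.
apply: (is_derive_eq (derive1D (derive1Z c (cos_scale w t)) (derive1Z (d / w) (sin_scale w t)))).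
by rewrite /free1; field.
Qed.

Let free1_derive t : is_derive (t : R) 1 free1 (free2 t).
Proof.
have D := derive1D (derive1Z d (cos_scale w t)) (derive1Z (- (c * w)) (sin_scale w t)).
rewrite (_ : free1 = (fun y => d * cos (w * y) + - (c * w) * sin (w * y))); last first.
  by apply/funext => y; rewrite /free1; ring.
by apply: (is_derive_eq D); rewrite /free2 /free; field.
Qed.

Let free2_cont : continuous free2.
Proof.
move=> t; rewrite (_ : free2 = (fun y => - w ^+ 2 * free y)); last by apply/funext => y; rewrite /free2 mulNr.
exact: (derive_cont1 (derive1Z (- w ^+ 2) (free_derive t))).
Qed.

Let nn a b t : `|a * cos (w * t) + b * sin (w * t)| <= `|a| + `|b|.
Proof.
apply: le_trans (ler_normD _ _) _; apply: lerD; rewrite normrM ler_piMr//; [exact: cos_le|exact: sin_le].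
Qed.

Let ww1 : 1 <= w. Proof. exact: om_ge1. Qed.
Let wN : `|w| = w. Proof. by rewrite ger0_norm// ltW// om_gt0. Qed.

Let free_le t : `|t| <= tau -> w ^+ 2 * `|free t| <= w ^+ 2 * (`|c| + `|d|).
Proof.
move=> _; rewrite ler_wpM2l ?sqr_ge0//; apply: le_trans (nn _ _ _) _; rewrite lerD2l normrM normfV wN.
by rewrite ler_piMr// invf_le1// om_gt0.
Qed.

Let free1_le t : `|t| <= tau -> w * `|free1 t| <= w ^+ 2 * (`|c| + `|d|).
Proof.
move=> _; rewrite expr2 -mulrA ler_wpM2l ?(le_trans ler01)//.
rewrite /free1 -mulNr; apply: le_trans (nn _ _ _) _; rewrite normrN normrM wN addrC mulrDr mulrC.
by rewrite lerD2l ler_peMl.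
Qed.

Let free2_le t : `|t| <= tau -> tau * `|free2 t| <= w ^+ 2 * (`|c| + `|d|).
Proof.
move=> tt; apply: le_trans (free_le tt); rewrite /free2 normrN normrM ger0_norm ?sqr_ge0//.
by rewrite ler_piMl// mulr_ge0// sqr_ge0.
Qed.

(** The free wave with amplitude c and velocity d at time 0. *)
Definition free_atom : uatom tau := @UAtom R tau free free1 free2 _ xi al free_derive free1_derive free2_cont free_le free1_le free2_le.
End Free.

Section Duhamel.
Variable F : fatom tau.
Let w := om (fxi F).
Let w0 : w != 0. Proof. by rewrite gt_eqF// om_gt0. Qed.
Let w1 : 1 <= w. Proof. exact: om_ge1. Qed.
Let f1 s := cos (w * s) * fa F s.
Let f2 s := sin (w * s) * fa F s.
Let P1 := primitive f1.
Let P2 := primitive f2.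

Let cf1 : continuous f1.
Proof.
move=> s; apply: (@continuousM R R (fun s => cos (w * s)) (fa F)); last exact: fa_cont.
exact: derive_cont1 (cos_scale w s).
Qed.

Let cf2 : continuous f2.
Proof.
move=> s; apply: (@continuousM R R (fun s => sin (w * s)) (fa F)); last exact: fa_cont.
exact: derive_cont1 (sin_scale w s).
Qed.

Let duh t := w^-1 * (sin (w * t) * P1 t - cos (w * t) * P2 t).
Let duh1 t := cos (w * t) * P1 t + sin (w * t) * P2 t.
Let duh2 t := fa F t - w ^+ 2 * duh t.
Let cs t : cos (w * t) ^+ 2 = 1 - sin (w * t) ^+ 2. Proof. by rewrite -(cos2Dsin2 (w * t)) addrK. Qed.

Let duh_derive t : is_derive (t : R) 1 duh (duh1 t).
Proof.
have D1 := (primitiveP cf1).2 t; have D2 := (primitiveP cf2).2 t.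
have D := derive1Z w^-1 (derive1D (derive1M (sin_scale w t) D1) (derive1Z (-1) (derive1M (cos_scale w t) D2))).
rewrite (_ : duh = (fun y => w^-1 * (sin (w * y) * primitive f1 y + -1 * (cos (w * y) * primitive f2 y)))); last first.
  by apply/funext => y; rewrite /duh mulN1r.
by apply: (is_derive_eq D); rewrite /duh1 /f1 /f2 -/P1 -/P2; field.
Qed.

Let duh1_derive t : is_derive (t : R) 1 duh1 (duh2 t).
Proof.
have D1 := (primitiveP cf1).2 t; have D2 := (primitiveP cf2).2 t.
apply: (is_derive_eq (derive1D (derive1M (cos_scale w t) D1) (derive1M (sin_scale w t) D2))).
rewrite /duh2 /duh /f1 /f2 -/P1 -/P2.
transitivity ((cos (w * t) ^+ 2 + sin (w * t) ^+ 2) * fa F t + w * (cos (w * t) * P2 t - sin (w * t) * P1 t)); first by ring.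
by rewrite cos2Dsin2; field.
Qed.

Let duh2_cont : continuous duh2.
Proof.
move=> t; apply: (@continuousB R R R (fa F) (fun t => w ^+ 2 * duh t)); first exact: fa_cont.
exact: derive_cont1 (derive1Z (w ^+ 2) (duh_derive t)).
Qed.

Let b0 : 0 <= fb F / w. Proof. by rewrite divr_ge0 ?fb_ge0// ltW// om_gt0. Qed.

Let fa_bd t : `|t| <= tau -> `|fa F t| <= fb F / w.
Proof. by move=> tt; rewrite ler_pdivlMr ?om_gt0// mulrC; exact: fa_le. Qed.

Let P1_le t : `|t| <= tau -> `|P1 t| <= fb F / w * tau.
Proof.
move=> tt; apply: (@le_trans _ _ (fb F / w * `|t|)); last by rewrite ler_wpM2l.
apply: primitive_le => // s st; rewrite normrM; apply: le_trans (fa_bd (le_trans st tt)).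
by rewrite ler_piMl// cos_le.
Qed.

Let P2_le t : `|t| <= tau -> `|P2 t| <= fb F / w * tau.
Proof.
move=> tt; apply: (@le_trans _ _ (fb F / w * `|t|)); last by rewrite ler_wpM2l.
apply: primitive_le => // s st; rewrite normrM; apply: le_trans (fa_bd (le_trans st tt)).
by rewrite ler_piMl// sin_le.
Qed.

Let duh_le2 t : `|t| <= tau -> w ^+ 2 * `|duh t| <= 2 * (tau * fb F).
Proof.
move=> tt; rewrite normrM ger0_norm ?invr_ge0 ?(le_trans ler01)// expr2 -mulrA [w^-1 * _]mulrC.
rewrite [w * (_ / _)]mulrCA divff// mulr1.
apply: (@le_trans _ _ (w * (2 * (fb F / w * tau)))); last first.
  by rewrite le_eqVlt; apply/orP; left; apply/eqP; field.
rewrite ler_wpM2l ?(le_trans ler01)//; apply: le_trans (ler_normB _ _) _; rewrite mulr_natl mulr2n.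
apply: lerD; rewrite normrM.
  by apply: le_trans (P1_le tt); rewrite ler_piMl// sin_le.
by apply: le_trans (P2_le tt); rewrite ler_piMl// cos_le.
Qed.

Let tb : 0 <= tau * fb F. Proof. by rewrite mulr_ge0 ?fb_ge0// ltW. Qed.

Let duh_le t : `|t| <= tau -> w ^+ 2 * `|duh t| <= 3 * (tau * fb F).
Proof. by move=> /duh_le2 h; apply: le_trans h _; rewrite ler_wpM2r// ler_nat. Qed.

Let duh1_le t : `|t| <= tau -> w * `|duh1 t| <= 3 * (tau * fb F).
Proof.
move=> tt; apply: (@le_trans _ _ (w * (2 * (fb F / w * tau)))); last first.
  rewrite (_ : w * _ = 2 * (tau * fb F)); last by field.
  by rewrite ler_wpM2r// ler_nat.
rewrite ler_wpM2l ?(le_trans ler01)//; apply: le_trans (ler_normD _ _) _; rewrite mulr_natl mulr2n.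
apply: lerD; rewrite normrM.
  by apply: le_trans (P1_le tt); rewrite ler_piMl// cos_le.
by apply: le_trans (P2_le tt); rewrite ler_piMl// sin_le.
Qed.

Let duh2_le t : `|t| <= tau -> tau * `|duh2 t| <= 3 * (tau * fb F).
Proof.
move=> tt; rewrite mulrCA; apply: ler_wpM2l; first exact: ltW.
apply: le_trans (ler_normB _ _) _.
rewrite (_ : 3 = 1 + 2 :> R); last by ring.
rewrite mulrDl mul1r; apply: lerD.
  by apply: le_trans (fa_le F tt); rewrite ler_peMl// om_ge1.
rewrite normrM (ger0_norm (sqr_ge0 w)); apply: le_trans (duh_le2 tt) _.
by rewrite ler_wpM2l// ler_piMl// fb_ge0.
Qed.

(** Variation of constants: with C and S the primitives of cos(w s) b(s) and
    sin(w s) b(s), the function (sin(w t) C - cos(w t) S) / w solves a'' + w^2 a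
    = b with zero data. The factor 1/w gains one power of the frequency and the
    integration gains the factor tau. *)
Definition duhamel_atom : uatom tau := @UAtom R tau duh duh1 duh2 _ (fxi F) (fal F) duh_derive duh1_derive duh2_cont duh_le duh1_le duh2_le.
Lemma duhamel_atom0 : ua duhamel_atom 0 = 0 /\ ua1 duhamel_atom 0 = 0.
Proof.
have p1 : P1 0 = 0 := (primitiveP cf1).1; have p2 : P2 0 = 0 := (primitiveP cf2).1.
by rewrite /= /duh /duh1 p1 p2 !mulr0 subr0 addr0 mulr0.
Qed.

End Duhamel.


Section Fields.
Variable A : uatom tau.

Let xa t := uxi A 0 0 * ua A t.
Let xa_cont : continuous xa.
Proof. by move=> t; exact: (derive_cont1 (derive1Z (uxi A 0 0) (ua_derive A t))). Qed.
Let xa_le t : `|t| <= tau -> om (uxi A) * `|xa t| <= ub A.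
Proof.
move=> tt; apply: le_trans (ua_le A tt); rewrite normrM mulrA expr2; apply: ler_wpM2r => //.
by rewrite ler_wpM2l ?coord_le_om// ltW// om_gt0.
Qed.

Definition time_field : fatom tau := FAtom (ual A) (@ua1_cont _ _ A) (ua1_le A).
(** The x_1 derivative of cos is - sin, again a cosine after a shift of the
    phase by pi/2. *)
Definition space_field : fatom tau := FAtom (ual A + pi / 2) xa_cont xa_le.
End Fields.

Section Product.
Variables (F G : fatom tau) (s : R).
Hypothesis s1 : `|s| = 1.
Let pa t := 2^-1 * (fa F t * fa G t).
Let pa_cont : continuous pa.
Proof.
move=> t; apply: (@continuousM R R (fun=> 2^-1) (fun t => fa F t * fa G t)); first exact: cst_continuous.
by apply: (@continuousM R R (fa F) (fa G)); exact: fa_cont.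
Qed.
Let pa_le t : `|t| <= tau -> om (fxi F + s *: fxi G) * `|pa t| <= fb F * fb G.
Proof.
move=> tt; rewrite /pa !normrM ger0_norm ?invr_ge0//.
apply: (@le_trans _ _ ((om (fxi F) * `|fa F t|) * (om (fxi G) * `|fa G t|))); last first.
  by apply: ler_pM; rewrite ?mulr_ge0 ?fa_le// ltW// om_gt0.
have := ler_wpM2r (mulr_ge0 (normr_ge0 (fa F t)) (normr_ge0 (fa G t))) (om_add (fxi F) (fxi G) s1).
move: (om _) (om _) (om _) `|_| `|_| => a b c d e; lra.
Qed.
Definition mul_atom : fatom tau := FAtom (fal F + s * fal G) pa_cont pa_le.
End Product.

Definition time_fields L := map time_field L.
Definition space_fields L := map space_field L.
(** The two families are the sums and the differences of frequencies in
    wave_mul. *)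
Definition mul_fields F G := [seq mul_atom A B (@normr1 R) | A <- F, B <- G] ++
  [seq mul_atom A B (@normrN1 R) | A <- F, B <- G].
Definition cubic_term L1 L2 L3 := mul_fields (mul_fields (time_fields L1) (time_fields L2)) (space_fields L3).
Definition duhamel F := map duhamel_atom F.

Lemma fval_time_fields L p : fval (time_fields L) p = uval1 tI L p.
Proof.
rewrite /fval big_map; apply: eq_bigr => A _ /=.
by rewrite freq_tI mul0r mulr0 subr0 /delta_t eqxx mulr1.
Qed.

Lemma fval_space_fields L p : fval (space_fields L) p = uval1 (xI 0) L p.
Proof.
rewrite /fval big_map; apply: eq_bigr => A _ /=.
rewrite freq_xI /delta_t eq_sym xI_tI mulr0 mul0r sub0r /wave /swave.
have -> : phase (uxi A) (ual A + pi / 2) p = phase (uxi A) (ual A) p + pi / 2 by rewrite /phase addrA.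
by rewrite cosDpihalf; ring.
Qed.

Lemma fnorm_time_fields L : fnorm (time_fields L) = unorm L. Proof. by rewrite /fnorm big_map. Qed.
Lemma fnorm_space_fields L : fnorm (space_fields L) = unorm L. Proof. by rewrite /fnorm big_map. Qed.

Lemma fval_mul_fields F G p : fval (mul_fields F G) p = fval F p * fval G p.
Proof.
rewrite fval_cat /fval !big_allpairs_dep -big_split mulr_suml; apply: eq_bigr => A _ /=.
rewrite -big_split mulr_sumr; apply: eq_bigr => B _ /=.
have := wave_mul (fxi A) (fal A) (fxi B) (fal B) p; rewrite mul1r mulN1r.
set w := wave (fxi A) _ _; set w' := wave (fxi B) _ _; set v := wave _ _ _; set v' := wave _ _ _ => H.
by rewrite [RHS]mulrACA H; ring.
Qed.

Lemma fnorm_mul_fields F G : fnorm (mul_fields F G) = 2 * (fnorm F * fnorm G).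
Proof.
rewrite fnorm_cat /fnorm !big_allpairs_dep /= mulr_natl mulr2n.
by congr (_ + _); rewrite mulr_suml; apply: eq_bigr => A _; rewrite mulr_sumr.
Qed.

Lemma fval_cubic_term L1 L2 L3 p : fval (cubic_term L1 L2 L3) p = uval1 tI L1 p * uval1 tI L2 p * uval1 (xI 0) L3 p.
Proof. by rewrite !fval_mul_fields !fval_time_fields fval_space_fields. Qed.

Lemma fnorm_cubic_term L1 L2 L3 : fnorm (cubic_term L1 L2 L3) = 4 * (unorm L1 * unorm L2 * unorm L3).
Proof. by rewrite !fnorm_mul_fields !fnorm_time_fields fnorm_space_fields; ring. Qed.

(** The Klein-Gordon operator applied to a finite sum of waves. *)
Definition box L p := uval2 tI tI L p - \sum_(a < 3) uval2 (xI a) (xI a) L p + uval L p.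

Lemma boxE L p : box L p =
  \sum_(A <- L) (ua2 A (p 0 tI) + om (uxi A) ^+ 2 * ua A (p 0 tI)) * wave (uxi A) (ual A) p.
Proof.
rewrite /box /uval2 /uval exchange_big -sumrB -big_split; apply: eq_bigr => A _ /=.
have dx a : delta_t (xI a) = 0 :> R by rewrite /delta_t eq_sym xI_tI.
have dt : delta_t tI = 1 :> R by rewrite /delta_t eqxx.
rewrite freq_tI om2 !big_ord_recl !big_ord0 !freq_xI !dx dt.
by ring.
Qed.

Lemma box_cat L L' p : box (L ++ L') p = box L p + box L' p.
Proof. by rewrite !boxE big_cat. Qed.

Lemma box_duhamel F p : box (duhamel F) p = fval F p.
Proof. by rewrite boxE big_map; apply: eq_bigr => A _ /=; rewrite subrK. Qed.

Lemma unorm_duhamel F : unorm (duhamel F) = 3 * (tau * fnorm F).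
Proof. by rewrite /unorm big_map /= /fnorm !mulr_sumr. Qed.

Lemma duhamel_data F p : p 0 tI = 0 -> uval (duhamel F) p = 0 /\ uval1 tI (duhamel F) p = 0.
Proof.
move=> p0; rewrite /uval /uval1 !big_map !big1// => A _; have [a0 a1] := duhamel_atom0 A.
  by rewrite p0 a0 a1 !mul0r subrr.
by rewrite p0 a0 mul0r.
Qed.

End Operations.

(** * Picard iteration and local existence *)

Section Picard.
Context {R : realType}.
Variables (tau M : R).
Hypotheses (tau0 : 0 < tau) (tau1 : tau <= 1) (tauM : 288 * (tau * M ^+ 2) <= 1).
Variable lin : nat -> seq (uatom tau).
Hypotheses (lin_box : forall n p, box (lin n) p = 0)
  (lin_le : forall n, \sum_(k < n) unorm (lin k) <= M).
Implicit Types (p : 'rV[R]_(1 + 3)).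

(** The difference of the cubic terms of u ++ d and of u, written so that each
    summand contains d once. *)
Definition cubic_increment u d : seq (fatom tau) :=
  cubic_term d (u ++ d) (u ++ d) ++ cubic_term u d (u ++ d) ++ cubic_term u u d.

(** The pair of the current iterate and of its next increment. Storing
    increments as lists keeps all sums finite and makes convergence a statement
    about numbers. *)
Fixpoint picard n : seq (uatom tau) * seq (uatom tau) :=
  match n with
  | 0 => ([::], lin 0)
  | n.+1 => let: (u, d) := picard n in (u ++ d, lin n.+1 ++ duhamel tau0 tau1 (cubic_increment u d))
  end.

Definition iterate n := (picard n).1.
Definition increment n := (picard n).2.

Lemma iterateS n : iterate n.+1 = iterate n ++ increment n.
Proof. by rewrite /iterate /increment /=; case: (picard n). Qed.

Lemma incrementS n : increment n.+1 = lin n.+1 ++ duhamel tau0 tau1 (cubic_increment (iterate n) (increment n)).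
Proof. by rewrite /iterate /increment /=; case: (picard n). Qed.

Definition nonlinear (L : seq (uatom tau)) p := uval1 tI L p ^+ 2 * uval1 (xI 0) L p.

Lemma box_iterate n p : box (iterate n.+1) p = nonlinear (iterate n) p.
Proof.
elim: n => [|n IH].
  by rewrite iterateS box_cat lin_box /box /nonlinear/uval2/uval/uval1 !big_nil big1 ?subrr ?addr0 ?mulr0// => a _; rewrite big_nil.
rewrite iterateS box_cat IH incrementS box_cat lin_box add0r box_duhamel /cubic_increment !(fval_cat (cubic_term _ _ _)) !fval_cubic_term.
by rewrite iterateS /nonlinear !uval1_cat; ring.
Qed.

Lemma unorm_iterate n : unorm (iterate n) = \sum_(k < n) unorm (increment k).
Proof.
elim: n => [|n IH]; first by rewrite big_ord0 /unorm big_nil.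
by rewrite iterateS unorm_cat IH big_ord_recr.
Qed.

(** Duhamel's formula contributes the factor 3 tau and each of the three
    summands of the cubic increment 4 (2 M)^2 times the norm of the increment;
    288 tau M^2 <= 1 makes the product at most 1/2. *)
Lemma unorm_increment n : unorm (iterate n.+1) <= 2 * M ->
  unorm (increment n.+1) <= unorm (lin n.+1) + 2^-1 * unorm (increment n).
Proof.
move=> H; rewrite incrementS unorm_cat lerD2l unorm_duhamel /cubic_increment !(fnorm_cat (cubic_term _ _ _)) !fnorm_cubic_term.
rewrite -!iterateS.
have d0 := unorm_ge0 tau0 (increment n); have u0 := unorm_ge0 tau0 (iterate n).
have E : unorm (iterate n.+1) = unorm (iterate n) + unorm (increment n) by rewrite iterateS unorm_cat.
move: E H d0 u0; move: (unorm _) (unorm _) (unorm _) => d u u' E H d0 u0.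
have uu : u <= u' by rewrite E lerDl.
have u'0 : 0 <= u' := le_trans u0 uu.
have h1 : u * u' <= u' * u' by apply: ler_wpM2r.
have h2 : u * u <= u' * u' by apply: ler_pM.
have h3 : u' * u' <= (2 * M) * (2 * M) by apply: ler_pM.
have k1 : 4 * (d * u' * u') + (4 * (u * d * u') + 4 * (u * u * d)) <= d * (48 * M ^+ 2).
  have -> : 4 * (d * u' * u') + (4 * (u * d * u') + 4 * (u * u * d)) =
    d * (4 * (u' * u') + 4 * (u * u') + 4 * (u * u)) by ring.
  apply: ler_wpM2l => //; rewrite expr2; lra.
apply: (@le_trans _ _ (3 * (tau * (d * (48 * M ^+ 2))))).
  by rewrite ler_wpM2l// ler_wpM2l// ltW.
have := ler_wpM2l d0 tauM; lra.
Qed.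

(** Summing the contraction estimate over n bounds the sum of all increments by
    twice that of the free waves. *)
Lemma increment_le n : \sum_(k < n) unorm (increment k) <= 2 * M.
Proof.
have M0 : 0 <= M by have := lin_le 0; rewrite big_ord0.
have e0 k : 0 <= unorm (increment k) := unorm_ge0 tau0 _.
suff H : forall n, \sum_(k < n.+1) unorm (increment k) <= 2 * M /\
    \sum_(k < n.+1) unorm (increment k) <=
    \sum_(k < n.+1) unorm (lin k) + 2^-1 * \sum_(k < n) unorm (increment k).
  by case: n => [|n]; [rewrite big_ord0 mulr_ge0|exact: (H n).1].
elim=> [|m [IH1 IH2]].
  rewrite !big_ord_recr !big_ord0 /= mulr0 addr0 !add0r; split => //.
  have := lin_le 1; rewrite big_ord_recr big_ord0 /= add0r; move: M0; rewrite /increment/=; lra.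
have H : \sum_(k < m.+2) unorm (increment k) <=
    \sum_(k < m.+2) unorm (lin k) + 2^-1 * \sum_(k < m.+1) unorm (increment k).
  rewrite big_ord_recr /=; apply: le_trans (lerD IH2 (unorm_increment _)) _.
    by rewrite unorm_iterate.
  rewrite [X in _ <= X + _]big_ord_recr [X in _ <= _ + 2^-1 * X]big_ord_recr /=; lra.
split=> //; apply: le_trans H _; have := lin_le m.+2; lra.
Qed.

Let e n := unorm (increment n).
Let e_ge0 n : 0 <= e n := unorm_ge0 tau0 _.
Let E n := 4 / tau * e n.
Let t4 : 2 <= 4 / tau. Proof. by rewrite ler_pdivlMr//; have := tau1; lra. Qed.
Let sE : summable_seq E.
Proof.
apply: summableZ; first by apply: le_trans t4.
by exists (2 * M) => n; split; [exact: e_ge0|exact: increment_le].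
Qed.

Let O := [set p : 'rV[R]_(1 + 3) | `|p 0 tI| < tau].
Definition picardU p := ssum (fun n => uval (increment n) p).
Definition picardU1 i p := ssum (fun n => uval1 i (increment n) p).
Definition picardU2 j i p := ssum (fun n => uval2 j i (increment n) p).

Let dom0 n p : O p -> `|uval (increment n) p| <= E n.
Proof.
move=> /ltW/uval_le H; apply: le_trans (H _) _; rewrite /E -/(e n) ler_peMl ?e_ge0//.
by apply: le_trans t4; rewrite ler1n.
Qed.
Let dom1 i n p : O p -> `|uval1 i (increment n) p| <= E n.
Proof. by move=> /ltW/uval1_le H; apply: le_trans (H _ _) _; rewrite /E -/(e n) ler_wpM2r ?e_ge0. Qed.
Let dom2 j i n p : O p -> `|uval2 j i (increment n) p| <= E n.
Proof. by move=> /ltW/(uval2_le tau0 tau1) H; exact: H. Qed.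

Let line_O p i : O p -> exists2 r : R, 0 < r & forall h : R, `|h| < r -> O (p + h *: delta_mx 0 i).
Proof.
move=> pt; exists (tau - `|p 0 tI|); first by rewrite subr_gt0.
move=> h hr; have := @line_near R _ p i h _ tI hr; rewrite /O/= => H.
rewrite -[X in `|X|](subrK (p 0 tI)); apply: le_lt_trans (ler_normD _ _) _; move: H; lra.
Qed.

Let sub f : {within setT, continuous f} -> {within O, continuous (f : 'rV[R]_(1 + 3) -> R)}.
Proof. by move=> cf; exact: (continuous_subspaceW (fun p _ => Logic.I) cf). Qed.

Let series_derive (f g : nat -> 'rV[R]_(1 + 3) -> R) p i : O p ->
  (forall n q, is_derive q (delta_mx 0 i) (f n) (g n q)) ->
  (forall n q, O q -> `|f n q| <= E n) -> (forall n q, O q -> `|g n q| <= E n) ->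
  is_derive p (delta_mx 0 i) (fun q => ssum (f^~ q)) (ssum (g^~ p)).
Proof.
move=> Op Df fE gE; apply/is_derive_line0; have [r r0 Hr] := line_O i Op.
have := @ssum_derive R (fun n h => f n (p + h *: delta_mx 0 i)) (fun n h => g n (p + h *: delta_mx 0 i)) E 0 r r0 sE.
rewrite scale0r addr0; apply => n h hr; rewrite add0r.
- by apply/is_derive_line; exact: Df.
- by apply: fE; exact: Hr.
by apply: gE; exact: Hr.
Qed.

Lemma picard_Ck2 : Ck (time_slab tau) 2 picardU /\ forall p, time_slab tau p -> forall i j,
  pderiv (time_slab tau) i picardU p = picardU1 i p /\
  pderiv (time_slab tau) j (pderiv (time_slab tau) i picardU) p = picardU2 j i p.
Proof.
apply: Ck2_intro.
- by apply: ssum_continuous sE _ dom0 => n; apply: sub; exact: uval_continuous.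
- by move=> i; apply: ssum_continuous sE _ (@dom1 i) => n; apply: sub; exact: uval1_continuous.
- by move=> j i; apply: ssum_continuous sE _ (@dom2 j i) => n; apply: sub; exact: uval2_continuous.
- by move=> p i Op; apply: (series_derive Op _ dom0 (@dom1 i)) => n q; exact: uval_derive.
by move=> p i j Op; apply: (series_derive Op _ (@dom1 i) (@dom2 j i)) => n q; exact: uval1_derive.
Qed.

Lemma slab_O p : time_slab tau p -> O p.
Proof. by move=> /slabE/andP[p0 pT]; rewrite /O/= ger0_norm. Qed.

Let psum0 n p : \sum_(k < n) uval (increment k) p = uval (iterate n) p.
Proof.
elim: n => [|n IH]; first by rewrite big_ord0 /uval big_nil.
by rewrite big_ord_recr/= IH iterateS uval_cat.
Qed.
Let psum1 n i p : \sum_(k < n) uval1 i (increment k) p = uval1 i (iterate n) p.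
Proof.
elim: n => [|n IH]; first by rewrite big_ord0 /uval1 big_nil.
by rewrite big_ord_recr/= IH iterateS uval1_cat.
Qed.
Let psum2 n j i p : \sum_(k < n) uval2 j i (increment k) p = uval2 j i (iterate n) p.
Proof.
elim: n => [|n IH]; first by rewrite big_ord0 /uval2 big_nil.
by rewrite big_ord_recr/= IH iterateS uval2_cat.
Qed.

Let cvg0 p : O p -> uval (iterate n) p @[n --> \oo] --> picardU p.
Proof.
move=> Op; have := dominated_cvg sE (fun n => dom0 n Op).
by under eq_fun do rewrite psum0.
Qed.
Let cvg1 i p : O p -> uval1 i (iterate n) p @[n --> \oo] --> picardU1 i p.
Proof.
move=> Op; have := dominated_cvg sE (fun n => dom1 i n Op).
by under eq_fun do rewrite psum1.
Qed.
Let cvg2 j i p : O p -> uval2 j i (iterate n) p @[n --> \oo] --> picardU2 j i p.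
Proof.
move=> Op; have := dominated_cvg sE (fun n => dom2 j i n Op).
by under eq_fun do rewrite psum2.
Qed.

(** The iterate n + 1 solves the linear equation whose source is the cubic term
    of the iterate n (box_iterate); both sides converge. *)
Lemma picard_equation p : O p ->
  picardU2 tI tI p - \sum_(a < 3) picardU2 (xI a) (xI a) p + picardU p = picardU1 tI p ^+ 2 * picardU1 (xI 0) p.
Proof.
move=> Op.
have c1 : box (iterate n) p @[n --> \oo] -->
    picardU2 tI tI p - \sum_(a < 3) picardU2 (xI a) (xI a) p + picardU p.
  apply: cvgD; last exact: cvg0.
  apply: cvgB; first exact: cvg2.
  rewrite !big_ord_recl big_ord0; under eq_fun do rewrite !big_ord_recl big_ord0.
  by apply: cvgD; [exact: cvg2|apply: cvgD; [exact: cvg2|apply: cvgD; [exact: cvg2|exact: cvg_cst]]].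
have c2 : nonlinear (iterate n) p @[n --> \oo] --> picardU1 tI p ^+ 2 * picardU1 (xI 0) p.
  by rewrite expr2; apply: cvgM; [apply: cvgM; exact: cvg1|exact: cvg1].
have c3 : box (iterate n.+1) p @[n --> \oo] -->
    picardU2 tI tI p - \sum_(a < 3) picardU2 (xI a) (xI a) p + picardU p.
  by have := cvg_shiftS (fun n => box (iterate n) p) (nbhs (picardU2 tI tI p - \sum_(a < 3) picardU2 (xI a) (xI a) p + picardU p)) => ->.
move: c3; under eq_fun do rewrite box_iterate.
by move=> c3; exact: (cvg_unique _ c3 c2).
Qed.

Lemma picard_data p f g : p 0 tI = 0 ->
  \sum_(k < n) uval (lin k) p @[n --> \oo] --> f -> \sum_(k < n) uval1 tI (lin k) p @[n --> \oo] --> g ->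
  picardU p = f /\ picardU1 tI p = g.
Proof.
move=> p0 cf cg; have Op : O p by rewrite /O/= p0 normr0.
have H n : uval (increment n) p = uval (lin n) p /\ uval1 tI (increment n) p = uval1 tI (lin n) p.
  case: n => // n; have [a b] := duhamel_data tau0 tau1 (cubic_increment (iterate n) (increment n)) p0.
  by rewrite incrementS uval_cat uval1_cat a b !addr0.
split.
  have := dominated_cvg sE (fun n => dom0 n Op); under eq_fun do under eq_bigr do rewrite (H _).1.
  by move=> c; exact: (cvg_unique _ c cf).
have := dominated_cvg sE (fun n => dom1 tI n Op); under eq_fun do under eq_bigr do rewrite (H _).2.
by move=> c; exact: (cvg_unique _ c cg).
Qed.

Lemma picard_kg : kg_solution tau picardU.
Proof.
have [Cu Du] := picard_Ck2; split=> // p Dp; rewrite /dalembertian -/tI.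
have E1 i : pderiv (time_slab tau) i picardU p = picardU1 i p := (Du p Dp i i).1.
have E2 i : pderiv (time_slab tau) i (pderiv (time_slab tau) i picardU) p = picardU2 i i p := (Du p Dp i i).2.
rewrite /dt /dx E2 !E1 -/tI -/(xI ord0).
under eq_bigr do rewrite E2.
rewrite (_ : ord0 = 0)//.
exact: picard_equation (slab_O Dp).
Qed.

End Picard.

Section LocalExistence.
Context {R : realType}.
Implicit Types (S : seq (R * 'rV[R]_3 * R)) (x : 'rV[R]_3).

(** The weight 1 + |xi|^2 is the one carried by ub in free_atom. *)
Definition tnorm S := \sum_(s <- S) om s.1.2 ^+ 2 * `|s.1.1|.
Definition tval S x := \sum_(s <- S) s.1.1 * wave s.1.2 s.2 (event 0 x).

Lemma tnorm_ge0 S : 0 <= tnorm S.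
Proof. by apply: sumr_ge0 => s _; rewrite mulr_ge0// sqr_ge0. Qed.

(** The time of existence is chosen in terms of M alone. *)
Lemma local_existence (f g : nat -> seq (R * 'rV[R]_3 * R)) M :
  (forall n, \sum_(k < n) (tnorm (f k) + tnorm (g k)) <= M) ->
  exists2 tau, 0 < tau & exists u, kg_solution tau u /\
    forall x a b, \sum_(k < n) tval (f k) x @[n --> \oo] --> a ->
      \sum_(k < n) tval (g k) x @[n --> \oo] --> b ->
      u (event 0 x) = a /\ dt tau u (event 0 x) = b.
Proof.
move=> HM; have M0 : 0 <= M by have := HM 0; rewrite big_ord0.
(* the numeral is hidden, because its unary form makes conversion slow *)
have [kap kapE] : exists kap : R, kap = 288 by exists 288.
have kap1 : 1 <= kap by rewrite kapE ler1n.
have kap0 : 0 < kap by apply: lt_le_trans kap1.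
(* M + 1 instead of M, to have a time of existence at most 1 *)
pose tau := (kap * (M + 1) ^+ 2)^-1.
have m1 : 1 <= (M + 1) ^+ 2 by rewrite exprn_ege1// lerDr.
have d0 : 0 < kap * (M + 1) ^+ 2 by rewrite mulr_gt0// (lt_le_trans ltr01).
have tau0 : 0 < tau by rewrite invr_gt0.
have tau1 : tau <= 1 by rewrite invf_le1// mulr_ege1.
have tauM : 288 * (tau * M ^+ 2) <= 1.
  have MM : M ^+ 2 <= (M + 1) ^+ 2 by rewrite ler_pXn2r ?nnegrE ?addr_ge0// lerDl.
  rewrite -kapE; apply: (@le_trans _ _ (kap * (tau * (M + 1) ^+ 2))).
    by apply: ler_wpM2l; [exact: ltW|apply: ler_wpM2l; [exact: ltW|]].
  by rewrite mulrCA mulVf// gt_eqF.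
pose lin n := [seq free_atom tau1 s.1.1 0 s.1.2 s.2 | s <- f n] ++ [seq free_atom tau1 0 s.1.1 s.1.2 s.2 | s <- g n].
have lin_box n p : box (lin n) p = 0.
  by rewrite boxE big_cat !big_map /= !big1 ?addr0// => s _ /=; rewrite addNr mul0r.
have lin_norm n : unorm (lin n) = tnorm (f n) + tnorm (g n).
  rewrite /unorm big_cat !big_map /tnorm /=; congr (_ + _); apply: eq_bigr => s _ /=.
    by rewrite normr0 addr0.
  by rewrite normr0 add0r.
have lin_le n : \sum_(k < n) unorm (lin k) <= M by under eq_bigr do rewrite lin_norm.
have lin_data n x : uval (lin n) (event 0 x) = tval (f n) x /\ uval1 tI (lin n) (event 0 x) = tval (g n) x.
  have A1 S : uval [seq free_atom tau1 s.1.1 0 s.1.2 s.2 | s <- S] (event 0 x) = tval S x /\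
      uval1 tI [seq free_atom tau1 s.1.1 0 s.1.2 s.2 | s <- S] (event 0 x) = 0.
    rewrite /uval /uval1 !big_map /= event_tI; split.
      by apply: eq_bigr => s _ /=; rewrite mulr0 cos0 sin0 mulr1 mulr0 addr0.
    by rewrite big1// => s _ /=; rewrite mulr0 cos0 sin0 freq_tI; ring.
  have A2 S : uval [seq free_atom tau1 0 s.1.1 s.1.2 s.2 | s <- S] (event 0 x) = 0 /\
      uval1 tI [seq free_atom tau1 0 s.1.1 s.1.2 s.2 | s <- S] (event 0 x) = tval S x.
    rewrite /uval /uval1 !big_map /= event_tI; split.
      by rewrite big1// => s _ /=; rewrite mulr0 sin0; ring.
    by apply: eq_bigr => s _ /=; rewrite mulr0 cos0 sin0 freq_tI /delta_t eqxx !mulr1; ring.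
  by rewrite uval_cat uval1_cat (A1 _).1 (A1 _).2 (A2 _).1 (A2 _).2 addr0 add0r.
exists tau => //; exists (picardU tau0 tau1 lin).
have K := picard_kg tau0 tau1 tauM lin_box lin_le; split => //.
move=> x a b ca cb.
have p0 : event 0 x 0 tI = 0 :> R by rewrite event_tI.
have := @picard_data R tau M tau0 tau1 tauM lin lin_le (event 0 x) a b p0.
under eq_fun do under eq_bigr do rewrite (lin_data _ x).1.
move=> /(_ ca).
under [in X in X -> _]eq_fun do under eq_bigr do rewrite (lin_data _ x).2.
move=> /(_ cb)[-> <-]; split => //.
have [_ Du] := picard_Ck2 tau0 tau1 tauM lin_le.
have Dp : time_slab tau (event 0 x) by apply/slabE; rewrite event_tI lexx.
exact: (Du _ Dp tI tI).1.
Qed.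

End LocalExistence.

(** * Fourier series by the discrete transform *)

Section Trig.
Context {R : realType}.
Implicit Types (x y z : R).

Lemma sin_le_id z : `|sin z| <= `|z|.
Proof.
have := @mean_value_le0 R sin cos z 0 1; rewrite sin0 mul0r !subr0 mul1r; apply => y _.
by rewrite subr0 cos_le.
Qed.

Lemma cos_ge z : 1 - z ^+ 2 / 2 <= cos z.
Proof.
have -> : cos z = 1 - 2 * sin (z / 2) ^+ 2.
  by rewrite [in LHS](_ : z = (z / 2) *+ 2) ?cos_mulr2n; [rewrite cos2sin2; ring|field].
have : sin (z / 2) ^+ 2 <= (z / 2) ^+ 2.
  by rewrite -[X in X <= _]real_normK ?num_real// -[X in _ <= X]real_normK ?num_real// ler_pXn2r ?nnegrE// sin_le_id.
rewrite expr_div_n; move: (sin _ ^+ 2) (z ^+ 2) => a b; lra.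
Qed.

Lemma sin_ge z : 0 <= z <= 1 -> z / 2 <= sin z.
Proof.
move=> /andP[z0 z1].
have cs : forall x : R, 0 <= x <= z -> {for x, continuous sin} by move=> x _; exact: continuous_sin.
have Ds : forall x : R, 0 < x < z -> is_derive x 1 sin (cos x) by move=> x _; exact: is_derive_sin.
have [c /andP[c0 cz] [_]] := mean_value z0 cs Ds.
rewrite sin0 !subr0 => ->; rewrite mulrC ler_wpM2r//; apply: le_trans (cos_ge c).
have : c ^+ 2 <= 1 by rewrite expr_le1//; lra.
move: (c ^+ 2) => a; lra.
Qed.

(** A weak form of the concavity bound sin z >= 2 z / pi, sufficient for the
    decay of coefficients up to the Nyquist frequency. *)
Lemma sin_ge_quarter z : 0 <= z <= 2 -> z / 4 <= sin z.
Proof.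
move=> /andP[z0 z2].
have -> : sin z = 2 * (sin (z / 2) * cos (z / 2)).
  by rewrite (mulrC (sin _)) mulr_natl -sin_mulr2n; congr sin; rewrite -mulr_natr; field.
have h : 0 <= z / 2 <= 1 by apply/andP; split; lra.
have c2 : 2^-1 <= cos (z / 2).
  apply: le_trans (cos_ge (z / 2)); case/andP: h => h0 h1; have : (z / 2) ^+ 2 <= 1 by rewrite expr_le1.
  move: ((z / 2) ^+ 2) => a; lra.
rewrite (_ : z / 4 = 2 * ((z / 2 / 2) * 2^-1)); last by field.
rewrite ler_wpM2l//; apply: ler_pM => //; [by lra|exact: sin_ge].
Qed.

Lemma sin_natpi n : sin (n%:R * pi : R) = 0.
Proof.
elim: n => [|n IH]; first by rewrite mul0r sin0.
by rewrite -natr1 mulrDl mul1r sinDpi IH oppr0.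
Qed.

(** Weights of the real Dirichlet kernel 1 + 2 cos z + ... + 2 cos (N z). *)
Definition kernel_weight k : R := if k is 0 then 1 else 2.

Lemma dirichlet N z : (\sum_(k < N.+1) kernel_weight k * cos (k%:R * z)) * sin (z / 2) = sin (N%:R * z + z / 2).
Proof.
elim: N => [|N IH].
  by rewrite big_ord_recr big_ord0 /= !mul0r cos0 !add0r !mul1r.
rewrite big_ord_recr /= mulrDl IH /kernel_weight.
have -> : N%:R * z + z / 2 = N.+1%:R * z - z / 2 by rewrite -natr1; field.
by rewrite sinB sinD; ring.
Qed.

End Trig.

Section SecondDifference.
Context {R : realType}.
Variables (f f1 f2 : R -> R) (K : R).
Hypotheses (D1 : forall x : R, is_derive x 1 f (f1 x)) (D2 : forall x : R, is_derive x 1 f1 (f2 x))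
  (f2K : forall x, `|f2 x| <= K).

Let K0 : 0 <= K. Proof. exact: le_trans (normr_ge0 _) (f2K 0). Qed.

Let reflect (g g1 : R -> R) (y s : R) : (forall x : R, is_derive x 1 g (g1 x)) ->
  is_derive s 1 (fun s => g (y + s)) (g1 (y + s)) /\ is_derive s 1 (fun s => g (y - s)) (- g1 (y - s)).
Proof.
move=> Dg; split; first by apply: is_derive_shiftl.
have D := @derive1_comp R g (fun s => y + (-1) * s) s _ _ (Dg (y + (-1) * s)) (derive1D (is_derive_c1 y s) (derive1_scale (-1) s)).
rewrite (_ : (fun s => g (y - s)) = (fun x => g (y + -1 * x))); last by apply/funext => x; rewrite mulN1r.
by apply: (is_derive_eq D); rewrite add0r mulrN1 mulN1r.
Qed.

Lemma second_diff_le y d : `|f (y + d) - 2 * f y + f (y - d)| <= 2 * K * d ^+ 2.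
Proof.
have h1 s : `|f1 (y + s) - f1 (y - s)| <= 2 * K * `|s|.
  have := @mean_value_le0 R (fun s => f1 (y + s) - f1 (y - s)) (fun s => f2 (y + s) + f2 (y - s)) s 0 (2 * K).
  rewrite mul0r addr0 !subr0 subrr subr0; apply => x _.
    have [a b] := reflect y x D2.
    by apply: (is_derive_eq (is_deriveB a b)); rewrite opprK.
  rewrite subr0; apply: le_trans (ler_normD _ _) _; have := f2K (y + x); have := f2K (y - x); lra.
have := @mean_value_le0 R (fun s => f (y + s) + f (y - s)) (fun s => f1 (y + s) - f1 (y - s)) d 0 (2 * K * `|d|).
rewrite mul0r addr0 !subr0 (_ : f (y + d) + f (y - d) - _ = f (y + d) - 2 * f y + f (y - d)); last by ring.
rewrite -(real_normK (num_real d)) [`|d| ^+ 2]expr2 (mulrA (2 * K)); apply => x xd; last first.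
  by rewrite subr0; apply: le_trans (h1 x) _; rewrite ler_wpM2l// mulr_ge0.
have [a b] := reflect y x D1; exact: (is_deriveD a b).
Qed.

End SecondDifference.

Section DFT.
Context {R : realType}.
Variables (N : nat) (h : R -> R).
Let M := N.*2.+1.
Definition mesh : R := 2 * pi / M%:R.
Definition grid (j : nat) : R := (j%:R - N%:R) * mesh.
Definition gsum (f : R -> R) : R := \sum_(j < M) f (grid j).
(** The phase th gives cosine coefficients for th = 0 and sine coefficients for
    th = - pi/2. *)
Definition dcoef k (th : R) : R := kernel_weight k / M%:R * gsum (fun y => h y * cos (k%:R * y + th)).

Let M0 : (0 : R) < M%:R. Proof. by rewrite ltr0n. Qed.
Lemma mesh_gt0 : 0 < mesh. Proof. by rewrite divr_gt0// mulr_gt0// pi_gt0. Qed.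

Lemma gridB j l : grid j - grid l = (j%:R - l%:R) * mesh.
Proof. by rewrite /grid; ring. Qed.

(** The Dirichlet kernel vanishes at the nonzero points of a grid of 2 N + 1
    points, because there (2 N + 1) z / 2 is a multiple of pi. *)
Lemma dirichlet_grid j l : (j < M)%N -> (l < M)%N ->
  \sum_(k < N.+1) kernel_weight k * cos (k%:R * (grid j - grid l)) = (j == l)%:R * M%:R :> R.
Proof.
have [-> lM _|] := eqVneq j l.
  rewrite subrr mul1r /M; under eq_bigr do rewrite mulr0 cos0 mulr1.
  rewrite big_ord_recl /= big_const_ord iter_addr addr0 -muln2 -(natr1 (N * 2)%N) natrM -(mulr_natr 2 N); ring.
wlog lj : j l / (l < j)%N.
  move=> H jl jM lM; have [lj|jl'|E] := ltngtP l j; [exact: H| |by rewrite E eqxx in jl].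
  have lj : l != j by rewrite eq_sym.
  rewrite -(H l j jl' lj lM jM); apply: eq_bigr => k _.
  by rewrite -cosN -mulrN opprB.
move=> _ jM lM; rewrite mul0r.
have e : grid j - grid l = (j - l)%:R * mesh by rewrite gridB natrB// ltnW.
have s0 : sin ((grid j - grid l) / 2) != 0.
  rewrite gt_eqF// sin_gt0_pi// e /mesh (_ : _ / 2 = (j - l)%:R / M%:R * pi); last by field; rewrite gt_eqF.
  rewrite pmulr_rgt0 ?pi_gt0 ?divr_gt0 ?ltr0n ?subn_gt0//=.
  rewrite -[ltRHS]mul1r ltr_pM2r ?pi_gt0// ltr_pdivrMr// mul1r ltr_nat.
  by apply: leq_ltn_trans jM; rewrite leq_subr.
apply: (mulIf s0); rewrite dirichlet mul0r.
rewrite (_ : _ + _ = (j - l)%:R * pi) ?sin_natpi// e /mesh /M -muln2 -(natr1 (N * 2)%N) natrM; field.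
rewrite -natrM natr1 pnatr_eq0//.
Qed.

(** On a grid Fourier inversion is an identity between finite sums. *)
Lemma dft_inversion l : (l < M)%N ->
  \sum_(k < N.+1) (dcoef k 0 * cos (k%:R * grid l) + dcoef k (- (pi / 2)) * sin (k%:R * grid l)) = h (grid l).
Proof.
move=> lM.
transitivity (\sum_(k < N.+1) \sum_(j < M) M%:R^-1 * h (grid j) * (kernel_weight k * cos (k%:R * (grid j - grid l)))).
  apply: eq_bigr => k _; rewrite /dcoef /gsum !mulr_sumr !mulr_suml -big_split; apply: eq_bigr => j _ /=.
  by rewrite addr0 cosB cos_pihalf sin_pihalf mulrBr cosB; ring.
rewrite exchange_big /=; under eq_bigr do rewrite -mulr_sumr dirichlet_grid//.
rewrite (bigD1 (Ordinal lM))//= eqxx big1 ?addr0; first by rewrite mul1r mulrAC mulVf ?mul1r// gt_eqF.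
by move=> j jl; rewrite (_ : (j == l :> nat) = false) ?mul0r ?mulr0//; apply/negbTE; apply: contra jl => /eqP E; apply/eqP/val_inj.
Qed.


Section Decay.
Variables (h1 h2 h3 h4 : R -> R) (K0 K4 : R).
Hypotheses (D1 : forall x : R, is_derive x 1 h (h1 x)) (D2 : forall x : R, is_derive x 1 h1 (h2 x))
  (D3 : forall x : R, is_derive x 1 h2 (h3 x)) (D4 : forall x : R, is_derive x 1 h3 (h4 x))
  (hK0 : forall x, `|h x| <= K0) (hK4 : forall x, `|h4 x| <= K4)
  (h_supp : forall x, 1 <= `|x| -> h x = 0) (N24 : (24 <= N)%N).

(** The second difference is symmetric for gsum on functions supported away from
    the ends, and cosines are its eigenvectors. *)
Definition sdiff (f : R -> R) (y : R) := f (y + mesh) - 2 * f y + f (y - mesh).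

Let K40 : 0 <= K4. Proof. exact: le_trans (normr_ge0 _) (hK4 0). Qed.

Lemma mesh_le : mesh <= 6^-1.
Proof.
have p4 : pi <= 4 :> R by have := @pihalf_lt2 R; lra.
have N' : 24 <= N%:R :> R by rewrite ler_nat.
have ME : M%:R = 2 * N%:R + 1 :> R by rewrite /M -natr1 -muln2 natrM mulrC.
have M49 : (49 : R) <= M%:R by rewrite ME; lra.
rewrite /mesh ler_pdivrMr//; lra.
Qed.

(** With at least 24 points on each side, the bounds 2 <= pi <= 4 place the
    interval [-3/2, 3/2] and the support of h inside the grid. *)
Lemma half_period_ge : 19/10 <= N%:R * mesh.
Proof.
have p2 := @pi_ge2 R; have N' : 24 <= N%:R :> R by rewrite ler_nat.
have ME : M%:R = 2 * N%:R + 1 :> R by rewrite /M -natr1 -muln2 natrM mulrC.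
rewrite /mesh mulrA ler_pdivlMr// ME.
have : 0 <= (pi - 2) * N%:R :> R by apply: mulr_ge0; lra.
lra.
Qed.

Lemma gsumD f g : gsum (fun y => f y + g y) = gsum f + gsum g.
Proof. by rewrite /gsum big_split. Qed.
Lemma gsumZ c f : gsum (fun y => c * f y) = c * gsum f.
Proof. by rewrite /gsum mulr_sumr. Qed.

Lemma gsum_shift f : (forall y, N%:R * mesh <= `|y| -> f y = 0) ->
  gsum (fun y => f (y + mesh)) = gsum f.
Proof.
move=> f0; rewrite /gsum /M big_ord_recl [RHS]big_ord_recl /= addrC [in RHS]addrC.
have m0 := ltW mesh_gt0.
have g0 : f (grid 0) = 0 by apply: f0; rewrite /grid sub0r mulNr normrN ger0_norm// mulr_ge0.
rewrite g0 addr0; set X := \sum_(_ < _) _.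
have -> : X + f (grid 0 + mesh) = \sum_(k < N.*2.+1) f (grid k + mesh).
  by rewrite big_ord_recl addrC.
rewrite big_ord_recr /= [X in _ + X]f0 ?addr0; last first.
  have -> : grid N.*2 + mesh = (N%:R + 1) * mesh by rewrite /grid -muln2 natrM; ring.
  by rewrite ger0_norm; [apply: ler_wpM2r => //; rewrite lerDl|apply: mulr_ge0 => //; rewrite addr_ge0].
by apply: eq_bigr => k _; rewrite /bump /= /grid -natr1; congr f; ring.
Qed.

Lemma gsum_sdiff f g : (forall y, N%:R * mesh - 2 * mesh <= `|y| -> f y = 0) ->
  gsum (fun y => sdiff f y * g y) = gsum (fun y => f y * sdiff g y).
Proof.
move=> f0; have m0 := ltW mesh_gt0.
have E1 : gsum (fun y => f (y + mesh) * g y) = gsum (fun y => f y * g (y - mesh)).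
  rewrite -(@gsum_shift (fun y => f y * g (y - mesh))).
    by apply: eq_bigr => j _; rewrite addrK.
  move=> y hy; rewrite f0 ?mul0r//; lra.
have E2 : gsum (fun y => f (y - mesh) * g y) = gsum (fun y => f y * g (y + mesh)).
  rewrite -(@gsum_shift (fun y => f (y - mesh) * g y)).
    by apply: eq_bigr => j _; rewrite addrK.
  move=> y hy; rewrite f0 ?mul0r//.
  have := ler_normD (y - mesh) mesh; rewrite subrK (ger0_norm m0); lra.
rewrite (_ : (fun y => sdiff f y * g y) = (fun y => f (y + mesh) * g y + (-2 * (f y * g y) + f (y - mesh) * g y))); last first.
  by apply/funext => y; rewrite /sdiff; ring.
rewrite (_ : (fun y => f y * sdiff g y) = (fun y => f y * g (y - mesh) + (-2 * (f y * g y) + f y * g (y + mesh)))); last first.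
  by apply/funext => y; rewrite /sdiff; ring.
by rewrite !gsumD E1 E2.
Qed.

Lemma sdiff_cos (k th : R) y :
  sdiff (fun y => cos (k * y + th)) y = - (4 * sin (k * mesh / 2) ^+ 2) * cos (k * y + th).
Proof.
rewrite /sdiff.
have -> : k * (y + mesh) + th = (k * y + th) + (k * mesh / 2) *+ 2 by rewrite -mulr_natr; field.
have -> : k * (y - mesh) + th = (k * y + th) - (k * mesh / 2) *+ 2 by rewrite -mulr_natr; field.
have C2 : cos ((k * mesh / 2) *+ 2) = 1 - 2 * sin (k * mesh / 2) ^+ 2.
  by rewrite cos_mulr2n cos2sin2 -mulr_natl; ring.
rewrite (cosD (k * y + th)) (cosB (k * y + th)) C2.
by move: (cos _) (sin _) (sin _) (sin _) => a b c d; ring.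
Qed.

Let sd_derive (f f1 : R -> R) : (forall x : R, is_derive x 1 f (f1 x)) ->
  forall x : R, is_derive x 1 (sdiff f) (sdiff f1 x).
Proof.
move=> Df x.
have sh a : is_derive x 1 (fun y => f (y + a)) (f1 (x + a)).
  have := @is_derive_shiftl R f a x (f1 (x + a)); rewrite (addrC a x) => /(_ (Df _)).
  by rewrite (_ : (fun h => f (a + h)) = (fun y => f (y + a)))//; apply/funext => y; rewrite addrC.
have D := derive1D (derive1D (sh mesh) (derive1Z (-2) (Df x))) (sh (- mesh)).
rewrite (_ : sdiff f = (fun y => f (y + mesh) + -2 * f y + f (y + - mesh))); last first.
  by apply/funext => y; rewrite /sdiff mulNr.
by apply: (is_derive_eq D); rewrite /sdiff mulNr.
Qed.

Let sd2_le y : `|sdiff (sdiff h) y| <= 4 * K4 * mesh ^+ 4.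
Proof.
have H x : `|sdiff h2 x| <= 2 * K4 * mesh ^+ 2 by exact: second_diff_le D3 D4 hK4 x mesh.
apply: le_trans (second_diff_le (sd_derive D1) (sd_derive D2) H y mesh) _.
by rewrite le_eqVlt; apply/orP; left; apply/eqP; ring.
Qed.

(** Two summations by parts exchange the fourth power of 4 sin^2(k mesh / 2) -
    of order (k mesh)^4 after squaring - for a fourth difference of h, of order
    mesh^4. *)
Lemma dcoef_decay k th : (k <= N)%N -> `|dcoef k th| <= (K0 + 2 ^+ 15 * K4) / k.+1%:R ^+ 4.
Proof.
have K00 : 0 <= K0 := le_trans (normr_ge0 _) (hK0 0).
have M0' : 0 <= M%:R :> R := ltW M0; have Mi : 0 <= M%:R^-1 :> R by rewrite invr_ge0.
move=> kN; rewrite /dcoef.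
set c := fun y : R => cos (k%:R * y + th).
have Q0 f B : (forall y, `|f y| <= B) -> `|gsum f| <= M%:R * B.
  move=> fB; apply: le_trans (ler_norm_sum _ _ _) _; apply: le_trans (ler_sum _ (fun i _ => fB _)) _.
  by rewrite sumr_const card_ord mulr_natl.
have c1 y : `|c y| <= 1 := cos_le _.
case: k @c c1 kN => [|k] c c1 kN.
  rewrite /kernel_weight expr1n divr1 div1r normrM (ger0_norm Mi) ler_pdivrMl//.
  apply: le_trans (Q0 _ K0 _) _.
    by move=> y; rewrite normrM; apply: le_trans (hK0 y); rewrite ler_piMr// cos_le.
  by rewrite ler_wpM2l// lerDl mulr_ge0// exprn_ge0.
have m0 := mesh_gt0; have m0' := ltW m0; have mle := mesh_le; have hp := half_period_ge.
set s := sin (k.+1%:R * mesh / 2).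
have supp1 y : N%:R * mesh - 2 * mesh <= `|y| -> h y = 0 by move=> hy; apply: h_supp; lra.
have supp2 y : N%:R * mesh - 2 * mesh <= `|y| -> sdiff h y = 0.
  move=> hy; rewrite /sdiff !h_supp; first by rewrite mulr0 subrr addr0.
  - have := ler_normD (y - mesh) mesh; rewrite subrK (gtr0_norm m0); lra.
  - by lra.
  have := ler_normB (y + mesh) mesh; rewrite addrK (gtr0_norm m0); lra.
have E : (4 * s ^+ 2) ^+ 2 * gsum (fun y => h y * c y) = gsum (fun y => sdiff (sdiff h) y * c y).
  have S f : (fun y => f y * sdiff c y) = (fun y => - (4 * s ^+ 2) * (f y * c y)).
    by apply/funext => y; rewrite sdiff_cos mulrCA.
  by rewrite gsum_sdiff// S gsumZ gsum_sdiff// S gsumZ; ring.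
have s_ge : k.+1%:R * mesh / 8 <= s.
  rewrite (_ : _ / 8 = k.+1%:R * mesh / 2 / 4); last by field.
  have km : 0 <= k.+1%:R * mesh by apply: mulr_ge0.
  apply: sin_ge_quarter; apply/andP; split; first exact: divr_ge0.
  rewrite ler_pdivrMr//; have p4 : pi <= 4 :> R by have := @pihalf_lt2 R; lra.
  apply: le_trans (_ : N%:R * mesh <= _); first by rewrite ler_wpM2r// ler_nat.
  rewrite /mesh mulrA ler_pdivrMr//.
  have ME : M%:R = 2 * N%:R + 1 :> R by rewrite /M -natr1 -muln2 natrM mulrC.
  have : 0 <= (4 - pi) * N%:R :> R by apply: mulr_ge0 => //; lra.
  rewrite ME; lra.
have km0 : 0 < k.+1%:R * mesh by rewrite mulr_gt0.
have lam : (k.+1%:R * mesh) ^+ 4 / 256 <= (4 * s ^+ 2) ^+ 2.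
  have := s_ge; set z := k.+1%:R * mesh in km0 *.
  have z8 : 0 <= z / 8 by rewrite divr_ge0// ltW.
  move=> zs; have : (z / 8) ^+ 4 <= s ^+ 4 by rewrite ler_pXn2r ?nnegrE//; exact: le_trans zs.
  rewrite expr_div_n (_ : (4 * s ^+ 2) ^+ 2 = 16 * s ^+ 4); last by ring.
  move: (z ^+ 4) (s ^+ 4) => a b; lra.
have EQ : (k.+1%:R * mesh) ^+ 4 / 256 * `|gsum (fun y => h y * c y)| <= M%:R * (4 * K4 * mesh ^+ 4).
  apply: le_trans (ler_wpM2r (normr_ge0 _) lam) _.
  rewrite -[X in X * _](ger0_norm (sqr_ge0 _)) -normrM E; apply: Q0 => y.
  by rewrite normrM; apply: le_trans (sd2_le y); rewrite ler_piMr.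
have G : k.+1%:R ^+ 4 * `|gsum (fun y => h y * c y)| <= M%:R * (1024 * K4).
  have m4 : 0 < mesh ^+ 4 by rewrite exprn_gt0.
  rewrite -(ler_pM2r m4); move: EQ; rewrite exprMn.
  move: (k.+1%:R ^+ 4) (mesh ^+ 4) (M%:R) `|_| => a b d e; lra.
have k4 : (0 : R) < k.+1%:R ^+ 4 by rewrite exprn_gt0.
have kk : k.+2%:R ^+ 4 <= 16 * k.+1%:R ^+ 4 :> R.
  rewrite (_ : 16 = 2 ^+ 4); last by ring.
  by rewrite -exprMn ler_pXn2r ?nnegrE ?mulr_ge0// -natrM ler_nat mul2n doubleS !ltnS -addnn leq_addr.
have M2 : 0 <= 2 / M%:R :> R by rewrite divr_ge0.
rewrite normrM /kernel_weight (ger0_norm M2) ler_pdivlMr ?exprn_gt0//.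
rewrite (_ : 2 / M%:R * _ * _ = 2 / M%:R * (k.+2%:R ^+ 4 * `|gsum (fun y => h y * c y)|)); last by ring.
apply: (@le_trans _ _ (2 / M%:R * (16 * (M%:R * (1024 * K4))))).
  rewrite ler_wpM2l//; apply: le_trans (ler_wpM2r (normr_ge0 _) kk) _.
  by rewrite -mulrA ler_wpM2l.
rewrite (_ : 2 / M%:R * _ = 2 ^+ 15 * K4); last by field; rewrite gt_eqF.
by rewrite lerDr.
Qed.

End Decay.
End DFT.

Section FourierSeries.
Context {R : realType}.

Lemma cos_lip (a b : R) : `|cos a - cos b| <= `|a - b|.
Proof.
have := @mean_value_le0 R (fun s => cos (b + s)) (fun s => - sin (b + s)) (a - b) 0 1.
rewrite addr0 mul0r subr0 mul1r (_ : b + (a - b) = a); last by ring.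
apply => x _; last by rewrite subr0 normrN sin_le.
by apply: is_derive_shiftl; exact: is_derive_cos.
Qed.

Lemma sin_lip (a b : R) : `|sin a - sin b| <= `|a - b|.
Proof.
have := @mean_value_le0 R (fun s => sin (b + s)) (fun s => cos (b + s)) (a - b) 0 1.
rewrite addr0 mul0r subr0 mul1r (_ : b + (a - b) = a); last by ring.
apply => x _; last by rewrite subr0 cos_le.
by apply: is_derive_shiftl; exact: is_derive_sin.
Qed.

Lemma grid_near N (x : R) : `|x| <= N%:R * mesh N ->
  exists2 l, (l < N.*2.+1)%N & `|x - grid N l| <= mesh N.
Proof.
rewrite ler_norml => /andP[x1 x2]; have m0 := @mesh_gt0 R N.
pose y := (x + N%:R * mesh N) / mesh N.
have y0 : 0 <= y by apply: divr_ge0; [lra|exact: ltW].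
have yE : y * mesh N = x + N%:R * mesh N by rewrite /y divfK// gt_eqF.
have ly : (Num.truncn y)%:R <= y by rewrite truncn_le.
have yl : y < (Num.truncn y).+1%:R := truncnS_gt y.
exists (Num.truncn y).
  rewrite ltnS -(ler_nat R); apply: le_trans ly _; rewrite /y ler_pdivrMr// -muln2 natrM; lra.
have -> : x - grid N (Num.truncn y) = (y - (Num.truncn y)%:R) * mesh N by rewrite mulrBl yE /grid; ring.
rewrite normrM (gtr0_norm m0) ler_piMl//; first exact: ltW.
rewrite ger0_norm; last by rewrite subr_ge0.
by move: yl; rewrite -natr1; move: (Num.truncn y)%:R => a; lra.
Qed.

(** Comparison with the telescoping series of 1/k - 1/(k + 1). *)
Lemma tail4 (m n : nat) : (0 < m <= n)%N -> \sum_(m <= k < n) (k.+1%:R ^+ 4)^-1 <= m%:R^-1 :> R.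
Proof.
move=> /andP[m0 mn].
suff : \sum_(m <= k < n) (k.+1%:R ^+ 4)^-1 <= m%:R^-1 - n%:R^-1 :> R.
  by move/le_trans; apply; rewrite lerBlDr lerDl invr_ge0.
apply: le_trans (_ : \sum_(m <= k < n) (k%:R^-1 - k.+1%:R^-1) <= _); last first.
  have -> : \sum_(m <= k < n) (k%:R^-1 - k.+1%:R^-1) = \sum_(m <= k < n) ((- k.+1%:R^-1) - (- k%:R^-1)) :> R.
    by apply: eq_bigr => k _; rewrite opprK addrC.
  by rewrite (telescope_sumr (fun k => - k%:R^-1))// opprK addrC.
rewrite big_nat [leRHS]big_nat; apply: ler_sum => k /andP[mk _].
have k0 : (0 : R) < k%:R by rewrite ltr0n (leq_trans m0).
have k1 : (0 : R) < k.+1%:R by rewrite ltr0n.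
rewrite (_ : _ - _ = (k%:R * k.+1%:R)^-1); last by rewrite -natr1; field; rewrite natr1 !gt_eqF.
rewrite lef_pV2 ?posrE ?exprn_gt0 ?mulr_gt0//.
rewrite -natrX -natrM ler_nat; apply: leq_trans (_ : k.+1 ^ 2 <= _)%N; first by rewrite -mulnn leq_mul.
by rewrite leq_pexp2l.
Qed.

Lemma ulim_sum m (f : nat -> nat -> R) : (forall k, bounded_seq (f k)) ->
  bounded_seq (fun n => \sum_(k < m) f k n) /\ ulim (fun n => \sum_(k < m) f k n) = \sum_(k < m) ulim (f k).
Proof.
move=> bf; elim: m => [|m [IH1 IH2]].
  have b0 : bounded_seq (fun _ : nat => 0 : R) by exists 0 => n; rewrite normr0.
  rewrite (_ : (fun n => _) = (fun=> 0)); last by apply/funext => n; rewrite big_ord0.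
  split => //; rewrite big_ord0; transitivity (0 * ulim (fun _ : nat => 0 : R)); last by rewrite mul0r.
  rewrite -ulimZ//; by congr ulim; apply/funext => n; rewrite mul0r.
rewrite (_ : (fun n => _) = (fun n => \sum_(k < m) f k n + f m n)); last by apply/funext => n; rewrite big_ord_recr.
by rewrite big_ord_recr/= -IH2; split; [exact: bounded_seqD|exact: ulimD].
Qed.

Variables (h h1 h2 h3 h4 : R -> R) (K0 K4 : R).
Hypotheses (D1 : forall x : R, is_derive x 1 h (h1 x)) (D2 : forall x : R, is_derive x 1 h1 (h2 x))
  (D3 : forall x : R, is_derive x 1 h2 (h3 x)) (D4 : forall x : R, is_derive x 1 h3 (h4 x))
  (hK0 : forall x, `|h x| <= K0) (hK4 : forall x, `|h4 x| <= K4)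
  (h_supp : forall x, 1 <= `|x| -> h x = 0).

Let K := K0 + 2 ^+ 15 * K4.
Let K_ge0 : 0 <= K.
Proof.
have a := le_trans (normr_ge0 _) (hK0 0); have b := le_trans (normr_ge0 _) (hK4 0).
by rewrite addr_ge0// mulr_ge0// exprn_ge0.
Qed.

Definition pre_coef k th (n : nat) : R := if (k <= n + 24)%N then dcoef (n + 24) h k th else 0.

Lemma pre_coef_le k th n : `|pre_coef k th n| <= K / k.+1%:R ^+ 4.
Proof.
rewrite /pre_coef; case: ifP => kn; last by rewrite normr0 divr_ge0// exprn_ge0.
by apply: (dcoef_decay D1 D2 D3 D4 hK0 hK4 h_supp _ th kn); rewrite leq_addl.
Qed.

(** Coefficients of the limit function are ultrafilter limits of the
    coefficients on finer and finer grids; no integral is needed. *)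
Definition fcoef k th : R := ulim (pre_coef k th).

Let bpre k th : bounded_seq (pre_coef k th).
Proof. by exists (K / k.+1%:R ^+ 4) => n; exact: pre_coef_le. Qed.

Lemma fcoef_le k th : `|fcoef k th| <= K / k.+1%:R ^+ 4.
Proof.
rewrite ler_norml; apply/andP; split; [apply: ulim_ge|apply: ulim_le] => //; apply: nearW => n;
  by have := pre_coef_le k th n; rewrite ler_norml => /andP[].
Qed.

Definition fourier_term k (x : R) := fcoef k 0 * cos (k%:R * x) + fcoef k (- (pi / 2)) * sin (k%:R * x).

Let pre_term n k x := pre_coef k 0 n * cos (k%:R * x) + pre_coef k (- (pi / 2)) n * sin (k%:R * x).

Let pre_term_le n k x : `|pre_term n k x| <= 2 * K * (k.+1%:R ^+ 4)^-1.
Proof.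
apply: le_trans (ler_normD _ _) _; rewrite !normrM.
have a := pre_coef_le k 0 n; have b := pre_coef_le k (- (pi / 2)) n.
have a' : `|pre_coef k 0 n| * `|cos (k%:R * x)| <= K / k.+1%:R ^+ 4.
  by apply: le_trans a; rewrite ler_piMr// cos_le.
have b' : `|pre_coef k (- (pi / 2)) n| * `|sin (k%:R * x)| <= K / k.+1%:R ^+ 4.
  by apply: le_trans b; rewrite ler_piMr// sin_le.
by apply: le_trans (lerD a' b') _; rewrite -mulrA mulr_natl mulr2n.
Qed.

Let pre_term_lip n k x y : `|pre_term n k x - pre_term n k y| <= 2 * K * (k%:R * `|x - y|).
Proof.
have c1 th : `|pre_coef k th n| <= K.
  apply: le_trans (pre_coef_le k th n) _; rewrite ler_pdivrMr ?exprn_gt0// ler_peMr// exprn_ege1// ler1n//.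
have kE : `|k%:R * x - k%:R * y| = k%:R * `|x - y| by rewrite -mulrBr normrM ger0_norm.
rewrite (_ : _ - _ = pre_coef k 0 n * (cos (k%:R * x) - cos (k%:R * y)) +
   pre_coef k (- (pi / 2)) n * (sin (k%:R * x) - sin (k%:R * y))); last by rewrite /pre_term; ring.
apply: le_trans (ler_normD _ _) _; rewrite !normrM -(mulrA 2) -kE (_ : 2 * (K * `|k%:R * x - k%:R * y|) = K * `|k%:R * x - k%:R * y| + K * `|k%:R * x - k%:R * y|); last by ring.
by apply: lerD; apply: ler_pM => //; [exact: cos_lip|exact: sin_lip].
Qed.

(** At a grid point close to x the discrete inversion formula holds, its tail is
    bounded uniformly in the grid by the decay of coefficients, and finitely
    many remaining terms pass to the limit. *)
Lemma fourier_partial x m : `|x| <= 3/2 -> (0 < m)%N ->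
  `|h x - \sum_(k < m) fourier_term k x| <= 2 * K / m%:R.
Proof.
move=> x32 m0; apply/ler_addgt0Pr => e e0.
have [d d0 Hd] : exists2 d : R, 0 < d & forall y, `|y - x| < d -> `|h y - h x| <= e / 2.
  have /cont1_epsP H : {for x, continuous h} := derive_cont1 (D1 x).
  have e2 : 0 < e / 2 by rewrite divr_gt0.
  by have [d d0 Hd] := H _ e2; exists d => // y /Hd/ltW.
have [bT uT] : bounded_seq (fun n => \sum_(k < m) pre_term n k x) /\
    ulim (fun n => \sum_(k < m) pre_term n k x) = \sum_(k < m) fourier_term k x.
  have H k : bounded_seq (fun n => pre_term n k x).
    by exists (2 * K * (k.+1%:R ^+ 4)^-1) => n; exact: pre_term_le.
  have [a b] := ulim_sum m H; split => //; rewrite b; apply: eq_bigr => k _.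
  have bZ th c : bounded_seq (fun n => c * pre_coef k th n).
    by have [B HB] := bpre k th; exists (`|c| * B) => n; rewrite normrM ler_wpM2l.
  rewrite /fourier_term mulrC [X in _ + X]mulrC -!ulimZ// -ulimD//.
  by congr ulim; apply/funext => n; rewrite /pre_term mulrC [X in _ + X]mulrC.
pose L := 2 * K * (m%:R * m%:R).
have L0 : 0 <= L by rewrite !mulr_ge0.
pose eta := Num.min d (e / (2 * (L + 1))).
have eta0 : 0 < eta by rewrite lt_min d0 divr_gt0// mulr_gt0//; lra.
have eta8 : 0 < eta / 8 by rewrite divr_gt0.
have main n : (m <= n)%N -> n.+1%:R^-1 < eta / 8 -> `|h x - \sum_(k < m) pre_term n k x| <= 2 * K / m%:R + e.
  move=> mn nn; have N24 : (24 <= n + 24)%N by rewrite leq_addl.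
  have hp := @half_period_ge R _ N24.
  have xg : `|x| <= (n + 24)%:R * mesh (n + 24) by apply: le_trans x32 (le_trans _ hp); lra.
  have [l lM xl] := grid_near xg.
  have me : mesh (n + 24) < eta.
    have p4 : pi <= 4 :> R by have := @pihalf_lt2 R; lra.
    have n1 : (0 : R) < n.+1%:R by rewrite ltr0n.
    apply: (@le_lt_trans _ _ (8 * n.+1%:R^-1)); last by move: nn; move: (n.+1%:R^-1) => a; lra.
    rewrite /mesh; apply: ler_pM; rewrite ?invr_ge0//.
    - by apply: mulr_ge0 => //; exact: ltW (pi_gt0 R).
    - lra.
    by rewrite lef_pV2 ?posrE ?ltr0n// ler_nat ltnS -addnn addnCA leq_addr.
  set y := grid (n + 24) l in xl.
  have yh : h y = \sum_(k < m) pre_term n k y + \sum_(m <= k < (n + 24).+1) pre_term n k y.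
    have mN : (m <= (n + 24).+1)%N by rewrite leqW// (leq_trans mn)// leq_addr.
    rewrite -(big_mkord xpredT (fun k => pre_term n k y)) -big_cat_nat//= big_mkord.
    rewrite -(dft_inversion h lM); apply: eq_bigr => k _.
    by rewrite /pre_term /pre_coef -ltnS ltn_ord.
  have t1 : `|\sum_(m <= k < (n + 24).+1) pre_term n k y| <= 2 * K / m%:R.
    apply: le_trans (ler_norm_sum _ _ _) _; apply: le_trans (ler_sum _ (fun k _ => pre_term_le n k y)) _.
    rewrite -mulr_sumr ler_wpM2l ?mulr_ge0// tail4// m0/= leqW// (leq_trans mn)// leq_addr//.
  have t2 : `|\sum_(k < m) pre_term n k x - \sum_(k < m) pre_term n k y| <= e / 2.
    rewrite -sumrB; apply: le_trans (ler_norm_sum _ _ _) _.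
    apply: (@le_trans _ _ (\sum_(k < m) 2 * K * (m%:R * eta))).
      apply: ler_sum => k _; apply: le_trans (pre_term_lip n k x y) _; rewrite ler_wpM2l ?mulr_ge0//.
      apply: ler_pM => //; first by rewrite ler_nat ltnW.
      by apply: le_trans xl _; exact: ltW.
    rewrite sumr_const card_ord -[leLHS]mulr_natr (_ : _ * m%:R = L * eta); last by rewrite /L; ring.
    apply: (@le_trans _ _ (L * (e / (2 * (L + 1))))); first by rewrite ler_wpM2l// /eta ge_min lexx orbT.
    rewrite (_ : L * _ = (L / (L + 1)) * (e / 2)); last by field; rewrite gt_eqF// ltr_wpDl.
    rewrite ler_piMl//; first by rewrite divr_ge0// ltW.
    by rewrite ler_pdivrMr ?ltr_wpDl// mul1r lerDl.
  have t3 : `|h y - h x| <= e / 2.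
    by apply: Hd; rewrite distrC; apply: le_lt_trans xl (lt_le_trans me _); rewrite /eta ge_min lexx.
  rewrite (_ : h x - _ = - (h y - h x) + - (\sum_(k < m) pre_term n k x - \sum_(k < m) pre_term n k y) +
    \sum_(m <= k < (n + 24).+1) pre_term n k y); last by rewrite yh; ring.
  apply: le_trans (ler_normD _ _) _; apply: le_trans (lerD (ler_normD _ _) (lexx _)) _; rewrite !normrN.
  move: t1 t2 t3; move: `|_| `|_| `|_| (2 * K / m%:R) => a b c q; lra.
have near_main : \forall n \near \oo, `|h x - \sum_(k < m) pre_term n k x| <= 2 * K / m%:R + e.
  near=> n; apply: main; first by near: n; exact: nbhs_infty_ge.
  by near: n; exact: (near_infty_natSinv_lt (PosNum eta8)).
rewrite -uT distrC ler_norml; apply/andP; split.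
  rewrite lerBrDr; apply: ulim_ge => //; apply: filterS near_main => n.
  by rewrite ler_norml => /andP[]; move: (\sum_(k < m) _) => a; lra.
rewrite lerBlDr; apply: ulim_le => //; apply: filterS near_main => n.
by rewrite ler_norml => /andP[]; move: (\sum_(k < m) _) => a; lra.
Unshelve. all: by end_near. Qed.

End FourierSeries.

(** * Smooth cut-off functions *)

Section Smooth.
Context {R : realType}.
Implicit Types (f g : R -> R) (x y : R).

(** The derivatives are quantified existentially, which makes stability under
    products, composition and primitives an induction on k. *)
Fixpoint smooth k f : Prop :=
  match k with
  | 0 => continuous f
  | k'.+1 => exists f1, (forall x : R, is_derive x 1 f (f1 x)) /\ smooth k' f1
  end.

Lemma smoothW k f : smooth k.+1 f -> smooth k f.
Proof.
elim: k f => [|k IH] f [f1 [Df Sf]]; first by move=> x; exact: derive_cont1 (Df x).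
by exists f1; split => //; exact: IH.
Qed.

Lemma smooth_continuous k f : smooth k f -> continuous f.
Proof. by elim: k => // k IH /smoothW. Qed.

Lemma smooth_cst k (c : R) : smooth k (fun=> c).
Proof.
elim: k c => [|k IH] c; first exact: cst_continuous.
by exists (fun=> 0); split => // x; exact: is_derive_c1.
Qed.

Lemma smooth_id k : smooth k (fun x => x).
Proof.
case: k => [|k]; first by move=> x; exact: cvg_id.
by exists (fun=> 1); split; [move=> x; exact: derive1_id|exact: smooth_cst].
Qed.

Lemma smoothD k f g : smooth k f -> smooth k g -> smooth k (fun x => f x + g x).
Proof.
elim: k f g => [|k IH] f g; first by move=> cf cg x; apply: (@continuousD R R R f g); [exact: cf|exact: cg].
move=> [f1 [Df Sf]] [g1 [Dg Sg]]; exists (fun x => f1 x + g1 x).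
by split; [move=> x; exact: derive1D|exact: IH].
Qed.

Lemma smoothM k f g : smooth k f -> smooth k g -> smooth k (fun x => f x * g x).
Proof.
elim: k f g => [|k IH] f g; first by move=> cf cg x; apply: (@continuousM R R f g); [exact: cf|exact: cg].
move=> Sf' Sg'; have Sf := smoothW Sf'; have Sg := smoothW Sg'.
move: Sf' Sg' => [f1 [Df Sf1]] [g1 [Dg Sg1]]; exists (fun x => f1 x * g x + f x * g1 x).
by split; [move=> x; exact: derive1M|apply: smoothD; exact: IH].
Qed.

Lemma smoothX k f n : smooth k f -> smooth k (fun x => f x ^+ n).
Proof.
move=> Sf; elim: n => [|n IH].
  rewrite (_ : (fun x => _) = (fun=> 1)); first exact: smooth_cst.
  by apply/funext => x; rewrite expr0.
rewrite (_ : (fun x => _) = (fun x => f x * f x ^+ n)); first exact: smoothM.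
by apply/funext => x; rewrite exprS.
Qed.

Lemma smooth_affine k f (a b : R) : smooth k f -> smooth k (fun x => f (a * x + b)).
Proof.
elim: k f => [|k IH] f.
  move=> cf x; apply: (@continuous_comp _ _ _ (fun x => a * x + b) f); last exact: cf.
  exact: (derive_cont1 (derive1D (derive1_scale a x) (is_derive_c1 b x))).
move=> [f1 [Df Sf]]; exists (fun x => f1 (a * x + b) * a); split.
  move=> x; apply: (is_derive_eq (derive1_comp (Df _) (derive1D (derive1_scale a x) (is_derive_c1 b x)))).
  by rewrite addr0.
by apply: smoothM; [exact: IH|exact: smooth_cst].
Qed.

Lemma smooth_primitive k f : smooth k f -> smooth k (primitive f).
Proof.
move=> Sf; apply: smoothW; exists f; split => //.
exact: (primitiveP (smooth_continuous Sf)).2.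
Qed.

(** The derivative of x^-n exp(-1/x) is a combination of two functions of the
    same family, whence smoothness of all of them at once. *)
Definition flat n x : R := if 0 < x then x^-1 ^+ n * expR (- x^-1) else 0.

Lemma flat_le n : exists2 C, 0 < C & forall x, `|flat n x| <= C * x ^+ 2.
Proof.
have C0 : (0 : R) < (n.+2)`!%:R by rewrite ltr0n fact_gt0.
exists (n.+2)`!%:R => // x; rewrite /flat; case: ltP => x0; last by rewrite normr0 mulr_ge0// sqr_ge0.
have y0 : 0 < x^-1 by rewrite invr_gt0.
rewrite ger0_norm; last by rewrite mulr_ge0 ?expR_ge0// exprn_ge0// ltW.
have H := le_trans (_ : _ <= 1 + _) (expR_ge1Dxn n.+1 (ltW y0)).
have {}H : x^-1 ^+ n.+2 / (n.+2)`!%:R <= expR x^-1 by apply: H; rewrite lerDr.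
rewrite ler_pdivrMr// in H.
rewrite expRN ler_pdivrMr ?expR_gt0// -(ler_pM2r (_ : 0 < x^-1 ^+ 2)) ?exprn_gt0// -exprD addn2.
apply: le_trans H _; rewrite le_eqVlt; apply/orP; left; apply/eqP; field.
by rewrite gt_eqF.
Qed.

Lemma inv_derive x n : x != 0 -> is_derive x 1 (fun y : R => y^-1 ^+ n) (- (n%:R * x^-1 ^+ n.+1)).
Proof.
move=> x0; elim: n => [|n IH].
  rewrite (_ : (fun y => _) = (fun=> 1)); last by apply/funext => y; rewrite expr0.
  by apply: (is_derive_eq (is_derive_c1 1 x)); rewrite mul0r oppr0.
have Di : is_derive x 1 (fun y : R => y^-1) (- x^-1 ^+ 2).
  have := @is_deriveV R (fun y : R => y) x 1 1 x0 (derive1_id x).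
  by move/is_derive_eq; apply; rewrite /GRing.scale/= mulr1 exprVn.
rewrite (_ : (fun y => _) = (fun y => y^-1 * y^-1 ^+ n)); last by apply/funext => y; rewrite exprS.
by apply: (is_derive_eq (derive1M Di IH)); rewrite -natr1 !exprS; ring.
Qed.

Lemma flat_derive n x : is_derive x 1 (flat n) (- n%:R * flat n.+1 x + flat n.+2 x).
Proof.
have [x0|x0|->] := ltgtP x 0.
- rewrite /flat [0 < x]ltNge ltW//= mulr0 addr0; have r0 : 0 < - x by rewrite oppr_gt0.
  apply: (is_derive_near r0 _ (is_derive_c1 0 x)) => h; rewrite ltr_norml => /andP[_ hx].
  by rewrite ifF//; apply/negbTE; rewrite -leNgt; lra.
- have De : is_derive x 1 (fun y => y^-1 ^+ n * expR (- y^-1)) (- n%:R * flat n.+1 x + flat n.+2 x).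
    have xn0 : x != 0 by rewrite gt_eqF.
    have D1 := inv_derive n xn0; have := inv_derive 1 xn0.
    rewrite (_ : (fun y => y^-1 ^+ 1) = (fun y => y^-1))// => Di.
    have D2 := @derive1_comp R expR (fun y => -1 * y^-1) x _ _ (is_derive_expR (-1 * x^-1)) (derive1Z (-1) Di).
    rewrite (_ : (fun y => expR (-1 * y^-1)) = (fun y => expR (- y^-1))) in D2; last first.
      by apply/funext => y; rewrite mulN1r.
    apply: (is_derive_eq (derive1M D1 D2)).
    by rewrite /flat x0 !exprS expr0 !mulr1 mulN1r; ring.
  apply: (is_derive_near x0 _ De) => h; rewrite ltr_norml => /andP[hx _].
  by rewrite /flat ifT//; lra.
apply/is_derive1_epsP => e e0; have [C C0 HC] := flat_le n.
exists (e / C); first by rewrite divr_gt0.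
move=> h hd; rewrite /flat ltxx mulr0 addr0 mul0r !subr0 add0r -/(flat n h).
apply: le_trans (HC h) _; rewrite -(real_normK (num_real h)) expr2 mulrA ler_wpM2r//.
by rewrite mulrC -ler_pdivlMr// ltW.
Qed.

Lemma smooth_flat k n : smooth k (flat n).
Proof.
elim: k n => [|k IH] n; first by move=> x; exact: (derive_cont1 (flat_derive n x)).
exists (fun x => - n%:R * flat n.+1 x + flat n.+2 x); split; first exact: flat_derive.
by apply: smoothD => //; apply: smoothM => //; exact: smooth_cst.
Qed.

(** A primitive of the bump exp(-1/(1 - x)) exp(-1/(1 + x)) is a smooth step;
    the cut-off function is a product of two rescaled steps, normalised by the
    total mass kappa. *)
Lemma cutoff_ex : exists chi : R -> R, [/\ forall k, smooth k chi,
  forall x, `|x| <= 2^-1 -> chi x = 1 & forall x, 1 <= `|x| -> chi x = 0].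
Proof.
pose beta x := flat 0 (-1 * x + 1) * flat 0 (1 * x + 1).
have flat0 x : 0 <= flat 0 x by rewrite /flat; case: ifP => // _; rewrite mulr_ge0 ?expR_ge0.
have beta0 x : 0 <= beta x by exact: mulr_ge0.
have Sb k : smooth k beta by apply: smoothM; apply: smooth_affine; exact: smooth_flat.
pose Phi := primitive beta.
have DPhi x : is_derive x 1 Phi (beta x) := (primitiveP (smooth_continuous (Sb 0%N))).2 x.
have cPhi x : {for x, continuous Phi} := derive_cont1 (DPhi x).
have cst (a b : R) : a <= b -> (forall x, a < x < b -> beta x = 0) -> Phi a = Phi b.
  move=> ab b0; have [c _ [H1 H2]] := mean_value ab (fun x _ => cPhi x) (fun x _ => DPhi x).
  move: ab; rewrite le_eqVlt => /predU1P[-> //|ab].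
  by move: H2; rewrite b0 ?H1// mul0r => /eqP; rewrite subr_eq0 => /eqP ->.
have out x : 1 <= `|x| -> beta x = 0.
  rewrite ler_normr /beta /flat => /orP[x1|x1].
    by rewrite [X in X * _]ifF ?mul0r//; apply/negbTE; rewrite -leNgt; lra.
  by rewrite [X in _ * X]ifF ?mulr0//; apply/negbTE; rewrite -leNgt; lra.
have left x : x <= -1 -> Phi x = Phi (-1).
  move=> x1; apply: cst => // y /andP[_ y1]; apply: out; rewrite ler_normr; apply/orP; right; lra.
have right x : 1 <= x -> Phi x = Phi 1.
  move=> x1; apply/esym; apply: cst => // y /andP[y1 _]; apply: out; rewrite ler_normr; apply/orP; left; lra.
pose kappa := Phi 1 - Phi (-1).
have kappa0 : 0 < kappa.
  have m (a b : R) : a <= b -> Phi a <= Phi b /\ (- 2^-1 = a -> 2^-1 = b -> Phi a < Phi b).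
    move=> ab; have [c /andP[ac cb] [_ H2]] := mean_value ab (fun x _ => cPhi x) (fun x _ => DPhi x).
    split; first by rewrite -subr_ge0 H2 mulr_ge0// subr_ge0.
    move=> ea eb; rewrite -subr_gt0 H2 mulr_gt0//; last by lra.
    rewrite /beta /flat !ifT; [|lra|lra]; rewrite !expr0 !mul1r.
    by rewrite mulr_gt0// expR_gt0.
  have [a1 _] := m (-1) (- 2^-1) ltac:(lra).
  have [a2 _] := m (2^-1) 1 ltac:(lra).
  have [_ a3] := m (- 2^-1) (2^-1) ltac:(lra).
  by have := a3 erefl erefl; rewrite /kappa; lra.
pose Psi x := kappa^-1 * (Phi x + - Phi (-1)).
have SPsi k : smooth k Psi.
  apply: smoothM; first exact: smooth_cst.
  by apply: smoothD; [exact: smooth_primitive|exact: smooth_cst].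
have Psi1 y : 1 <= y -> Psi y = 1 by move=> y1; rewrite /Psi right// mulVf// gt_eqF.
have Psi0 y : y <= -1 -> Psi y = 0 by move=> y1; rewrite /Psi left// subrr mulr0.
exists (fun x => Psi (4 * x + 3) * Psi (-4 * x + 3)); split.
- by move=> k; apply: smoothM; exact: smooth_affine.
- by move=> x; rewrite ler_norml => /andP[x1 x2]; rewrite !Psi1 ?mulr1//; lra.
move=> x; rewrite ler_normr => /orP[x1|x1].
  by rewrite [X in _ * X]Psi0 ?mulr0//; lra.
by rewrite [X in X * _]Psi0 ?mul0r//; lra.
Qed.

End Smooth.

(** * Compactly supported data as absolutely convergent wave sums *)

Section CompactSupport.
Context {R : realType}.
Implicit Types (f : R -> R).

Lemma derive_support f (f1 : R -> R) : (forall x : R, is_derive x 1 f (f1 x)) ->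
  (forall x, 1 < `|x| -> f x = 0) -> forall x, 1 < `|x| -> f1 x = 0.
Proof.
move=> Df f0 x x1; rewrite -(derive_val (is_derive := Df x)).
have r0 : 0 < `|x| - 1 by rewrite subr_gt0.
have D0 : is_derive x 1 f 0.
  apply: (is_derive_near r0 _ (is_derive_c1 0 x)) => k kr; apply: f0.
  have := ler_normB (x + k) k; rewrite addrK; move: kr; lra.
by rewrite (derive_val (is_derive := D0)).
Qed.

Lemma continuous_support_bounded f : continuous f -> (forall x, 1 < `|x| -> f x = 0) ->
  exists K, forall x, `|f x| <= K.
Proof.
move=> cf f0.
have cn : {within `[(-1)%R, 1%R], continuous (fun x => `|f x|)}.
  by apply: continuous_subspaceT => x; apply: (@continuous_comp _ _ _ f (fun y => `|y|)); [exact: cf|exact: norm_continuous].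
have [c _ Hc] := @EVT_max R _ (-1) 1 ltac:(lra) cn.
exists `|f c| => x; have [x1|x1] := leP `|x| 1; last by rewrite f0// normr0.
by apply: Hc; rewrite in_itv/= -ler_norml.
Qed.

Lemma setT_proper n (p : 'rV[R]_n) i :
  ProperFilter (within [set h : R | [set: 'rV[R]_n] (p + h *: delta_mx 0 i)] 0^').
Proof.
rewrite (_ : within _ _ = (0 : R)^'); first exact: _.
apply/seteqP; split=> A; rewrite /within/=; last by apply: filterS => h.
by apply: filterS => h; apply.
Qed.

(** A partial derivative of a product of functions of separate variables is
    again such a product. *)
Lemma Ck_prod k (f : 'I_3 -> R -> R) : (forall i, smooth k (f i)) ->
  Ck setT k (fun x : 'rV[R]_3 => \prod_(i < 3) f i (x 0 i)).
Proof.
have C0 (g : 'I_3 -> R -> R) : (forall i, continuous (g i)) ->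
    {within setT, continuous (fun x : 'rV[R]_3 => \prod_(i < 3) g i (x 0 i))}.
  move=> cg.
  rewrite (_ : (fun x => _) = (fun x : 'rV[R]_3 => g ord0 (x 0 ord0) * (g (lift ord0 ord0) (x 0 (lift ord0 ord0)) *
    g (lift ord0 (lift ord0 ord0)) (x 0 (lift ord0 (lift ord0 ord0)))))); last first.
    by apply/funext => x; rewrite !big_ord_recl big_ord0 mulr1.
  have cc j : {within setT, continuous (fun x : 'rV[R]_3 => g j (x 0 j))}.
    apply: continuous_subspaceT => x; apply: (@continuous_comp _ _ _ (fun x : 'rV[R]_3 => x 0 j) (g j)); last exact: cg.
    exact: coord_continuous.
  by apply: withinM => //; apply: withinM.
elim: k f => [|k IH] f Sf; first exact: C0.
split; first by apply: C0 => i; exact: (smooth_continuous (Sf i)).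
move=> i; have [f1 [Df Sf1]] := Sf i.
pose g j := if j == i then f1 else f j.
have D p : is_derive p (delta_mx 0 i) (fun x : 'rV[R]_3 => \prod_(i < 3) f i (x 0 i)) (\prod_(j < 3) g j (p 0 j)).
  apply/is_derive_line0; pose c := \prod_(j < 3 | j != i) f j (p 0 j).
  have E (h : R) : \prod_(j < 3) f j ((p + h *: delta_mx 0 i) 0 j) = c * f i (p 0 i + h).
    rewrite (bigD1 i)//= mulrC !mxE !eqxx mulr1; congr (_ * _).
    by apply: eq_bigr => j /negbTE ji; rewrite !mxE ji mulr0 addr0.
  rewrite (_ : (fun h => _) = (fun h : R => c * f i (p 0 i + h))); last by apply/funext => h.
  have Di : is_derive (0 : R) 1 (fun h : R => f i (p 0 i + h)) (f1 (p 0 i)).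
    by apply: is_derive_shiftl; rewrite addr0.
  apply: (is_derive_eq (derive1Z c Di)).
  rewrite [RHS](bigD1 i)//= {1}/g eqxx mulrC; congr (_ * _).
  by apply: eq_bigr => j /negbTE ji; rewrite /g ji.
split; first by move=> p _; exact: (pderiv_is_derive (D p) (setT_proper _ _)).1.
apply: (@Ck_eq _ _ k _ _ (fun p : 'rV[R]_3 => \prod_(j < 3) g j (p 0 j))).
  by move=> p _; exact: (pderiv_is_derive (D p) (setT_proper _ _)).2.
apply: IH => j; rewrite /g; case: eqP => _ //; exact: smoothW.
Qed.

Lemma Cc_infty_prod (f : 'I_3 -> R -> R) : (forall i k, smooth k (f i)) ->
  (forall i x, 1 <= `|x| -> f i x = 0) ->
  Cc_infty (fun x : 'rV[R]_3 => \prod_(i < 3) f i (x 0 i)).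
Proof.
move=> Sf f0; split; first by move=> k; apply: Ck_prod => i.
have K := @box_compact R 3 0 1; have cK := compact_closed (@norm_hausdorff _ 'rV[R]_3) K.
apply: subclosed_compact K _; first exact: closed_closure.
rewrite [X in _ `<=` X](iffLR (closure_id _) cK).
apply: closure_subset => x /= nz i; rewrite mxE subr0 leNgt; apply/negP => xi.
by move/eqP: nz; apply; rewrite (bigD1 i)//= f0 ?mul0r// ltW.
Qed.

End CompactSupport.

Section Wiener.
Context {R : realType}.
Implicit Types (S T : seq (R * 'rV[R]_3 * R)) (x : 'rV[R]_3) (X : set 'rV[R]_3) (F G : 'rV[R]_3 -> R).

(** Functions that are given on X by an absolutely convergent sum of waves, with
    the summability required by local_existence. Outside X the sum is free: a
    compactly supported function agrees with its periodisation only on X. *)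
Definition wiener X F := exists (S : nat -> seq (R * 'rV[R]_3 * R)) M,
  (forall n, \sum_(k < n) tnorm (S k) <= M) /\
  forall x, X x -> \sum_(k < n) tval (S k) x @[n --> \oo] --> F x.

Definition tmul S T :=
  [seq (2^-1 * (s.1.1 * t.1.1), s.1.2 + 1 *: t.1.2, s.2 + t.2) | s <- S, t <- T] ++
  [seq (2^-1 * (s.1.1 * t.1.1), s.1.2 + -1 *: t.1.2, s.2 - t.2) | s <- S, t <- T].

Lemma tval_cat S T x : tval (S ++ T) x = tval S x + tval T x. Proof. exact: big_cat. Qed.
Lemma tnorm_cat S T : tnorm (S ++ T) = tnorm S + tnorm T. Proof. exact: big_cat. Qed.

Lemma tval_mul S T x : tval (tmul S T) x = tval S x * tval T x.
Proof.
rewrite /tval big_cat !big_allpairs_dep /= -big_split mulr_suml; apply: eq_bigr => s _ /=.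
rewrite -big_split mulr_sumr; apply: eq_bigr => t _ /=.
have := wave_mul s.1.2 s.2 t.1.2 t.2 (event 0 x).
move: (wave _ _ _) (wave _ _ _) (wave _ _ _) (wave _ _ _) => a b c d H.
by rewrite [RHS]mulrACA H; ring.
Qed.

Lemma tnorm_mul S T : tnorm (tmul S T) <= 4 * (tnorm S * tnorm T).
Proof.
have H (s t : R * 'rV[R]_3 * R) (r : R) : `|r| = 1 ->
    om (s.1.2 + r *: t.1.2) ^+ 2 * `|2^-1 * (s.1.1 * t.1.1)| <=
    2 * ((om s.1.2 ^+ 2 * `|s.1.1|) * (om t.1.2 ^+ 2 * `|t.1.1|)).
  move=> r1; rewrite !normrM ger0_norm ?invr_ge0//.
  have h : om (s.1.2 + r *: t.1.2) ^+ 2 <= 4 * (om s.1.2 ^+ 2 * om t.1.2 ^+ 2).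
    rewrite (_ : 4 * _ = (2 * (om s.1.2 * om t.1.2)) ^+ 2); last by ring.
    have o0 xi : 0 <= om xi :> R := ltW (om_gt0 xi).
    by rewrite ler_pXn2r ?nnegrE ?mulr_ge0// om_add.
  have := ler_wpM2r (mulr_ge0 (normr_ge0 s.1.1) (normr_ge0 t.1.1)) h.
  move: (om _ ^+ 2) (om _ ^+ 2) (om _ ^+ 2) `|_| `|_| => a b c d e; lra.
have E : 4 * (tnorm S * tnorm T) = \sum_(s <- S) \sum_(t <- T)
    (2 * ((om s.1.2 ^+ 2 * `|s.1.1|) * (om t.1.2 ^+ 2 * `|t.1.1|)) +
     2 * ((om s.1.2 ^+ 2 * `|s.1.1|) * (om t.1.2 ^+ 2 * `|t.1.1|))).
  rewrite /tnorm mulr_suml mulr_sumr; apply: eq_bigr => s _.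
  by rewrite !mulr_sumr; apply: eq_bigr => t _; ring.
rewrite E {1}/tnorm big_cat !big_allpairs_dep /= -big_split; apply: ler_sum => s _ /=.
rewrite -big_split; apply: ler_sum => t _ /=; apply: lerD; apply: H.
  exact: normr1.
exact: normrN1.
Qed.

Fixpoint pcat (S : nat -> seq (R * 'rV[R]_3 * R)) n :=
  if n is m.+1 then pcat S m ++ S m else [::].

Lemma tval_pcat (S : nat -> seq _) n x : tval (pcat S n) x = \sum_(k < n) tval (S k) x.
Proof.
elim: n => [|n IH]; first by rewrite big_ord0 /tval big_nil.
by rewrite big_ord_recr /= -IH tval_cat.
Qed.

Lemma tnorm_pcat (S : nat -> seq _) n : tnorm (pcat S n) = \sum_(k < n) tnorm (S k).
Proof.
elim: n => [|n IH]; first by rewrite big_ord0 /tnorm big_nil.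
by rewrite big_ord_recr /= -IH tnorm_cat.
Qed.

(** The partial sums of the product series are chosen to be exactly the products
    of partial sums. *)
Lemma wienerM X F G : wiener X F -> wiener X G -> wiener X (fun x => F x * G x).
Proof.
move=> [S [M [SM SF]]] [T [M' [TM TG]]].
pose K n := tmul (S n) (pcat T n.+1) ++ tmul (pcat S n) (T n).
have EK n x : \sum_(k < n) tval (K k) x = tval (pcat S n) x * tval (pcat T n) x.
  elim: n => [|n IH]; first by rewrite big_ord0 /tval !big_nil mul0r.
  rewrite big_ord_recr /= IH (tval_cat (tmul _ _)) !tval_mul /= (tval_cat (pcat _ _)) (tval_cat (pcat _ _)).
  by ring.
exists K, (8 * (M * M')); split; last first.
  move=> x Xx; under eq_fun do rewrite EK !tval_pcat.
  by apply: cvgM; [exact: SF|exact: TG].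
have M0 : 0 <= M by have := SM 0; rewrite big_ord0.
have M'0 : 0 <= M' by have := TM 0; rewrite big_ord0.
move=> n; apply: (@le_trans _ _ (\sum_(k < n) (4 * M' * tnorm (S k) + 4 * M * tnorm (T k)))).
  apply: ler_sum => k _; rewrite (tnorm_cat (tmul _ _)); apply: lerD.
    apply: le_trans (tnorm_mul _ _) _; rewrite -mulrA ler_wpM2l// mulrC ler_wpM2r ?tnorm_ge0//.
    by rewrite tnorm_pcat.
  apply: le_trans (tnorm_mul _ _) _; rewrite -mulrA ler_wpM2l// ler_wpM2r ?tnorm_ge0//.
  by rewrite tnorm_pcat.
rewrite big_split /= -!mulr_sumr.
have h1 := ler_wpM2l (mulr_ge0 (ler0n R 4) M'0) (SM n); have h2 := ler_wpM2l (mulr_ge0 (ler0n R 4) M0) (TM n).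
apply: le_trans (lerD h1 h2) _; rewrite le_eqVlt; apply/orP; left; apply/eqP; ring.
Qed.

Lemma wienerZ X F c : wiener X F -> wiener X (fun x => c * F x).
Proof.
move=> [S [M [SM SF]]]; pose K n := [seq (c * s.1.1, s.1.2, s.2) | s <- S n].
exists K, (`|c| * M); split.
  move=> n; rewrite (_ : \sum_(k < n) _ = `|c| * \sum_(k < n) tnorm (S k)); first by rewrite ler_wpM2l.
  rewrite mulr_sumr; apply: eq_bigr => k _; rewrite /tnorm big_map mulr_sumr.
  by apply: eq_bigr => s _ /=; rewrite normrM mulrCA.
move=> x Xx; rewrite (_ : (fun n => _) = (fun n => c * \sum_(k < n) tval (S k) x)).
  by apply: cvgM; [exact: cvg_cst|exact: SF].
apply/funext => n; rewrite mulr_sumr; apply: eq_bigr => k _; rewrite /tval big_map mulr_sumr.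
by apply: eq_bigr => s _ /=; rewrite mulrA.
Qed.

Lemma sum_inv_square n : \sum_(k < n) (k.+1%:R ^+ 2)^-1 <= 2 :> R.
Proof.
suff : \sum_(k < n) (k.+1%:R ^+ 2)^-1 <= 2 - 2 * n.+1%:R^-1 :> R.
  by move/le_trans; apply; rewrite lerBlDr lerDl mulr_ge0.
elim: n => [|n IH]; first by rewrite big_ord0 invr1; lra.
rewrite big_ord_recr /=; apply: le_trans (lerD IH (lexx _)) _.
have a0 : (1 : R) <= n.+1%:R by rewrite ler1n.
rewrite -(natr1 n.+1); move: (n.+1%:R) a0 => a a1.
have a0 : 0 < a by lra.
suff : (a ^+ 2)^-1 <= 2 * a^-1 - 2 * (a + 1)^-1 by lra.
have -> : 2 * a^-1 - 2 * (a + 1)^-1 = 2 / (a * (a + 1)).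
  by field; rewrite !gt_eqF//; lra.
have d0 : 0 < a * (a + 1) by rewrite mulr_gt0//; lra.
rewrite ler_pdivlMr// mulrC ler_pdivrMr ?exprn_gt0//; nra.
Qed.

(** Rescaling by d only changes frequencies by the factor 1/d, and the decay of
    order 4 leaves a convergent series after multiplication by the weight. *)
Lemma wiener_coord (h : R -> R) (d : R) i : smooth 4 h -> (forall y, 1 <= `|y| -> h y = 0) -> 0 < d ->
  wiener [set x | `|x 0 i| <= 3/2 * d] (fun x => h (d^-1 * x 0 i)).
Proof.
move=> [h1 [D1 [h2 [D2 [h3 [D3 [h4 [D4 c4]]]]]]]] h0 d0.
have s0 y : 1 < `|y| -> h y = 0 by move=> /ltW; exact: h0.
have s4 := derive_support D4 (derive_support D3 (derive_support D2 (derive_support D1 s0))).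
have [K0 hK0] := continuous_support_bounded (fun y => derive_cont1 (D1 y)) s0.
have [K4 hK4] := continuous_support_bounded c4 s4.
pose K := K0 + 2 ^+ 15 * K4.
pose w k : R := k%:R / d.
pose S (k : nat) := [:: (fcoef h k 0, w k *: (delta_mx 0 i : 'rV[R]_3), 0 : R);
                 (fcoef h k (- (pi / 2)), w k *: (delta_mx 0 i : 'rV[R]_3), - (pi / 2))].
have phE k al x : phase (w k *: (delta_mx 0 i : 'rV[R]_3)) al (event 0 x) = k%:R * (d^-1 * x 0 i) + al.
  rewrite /phase (bigD1 i)//= big1 ?addr0; last by move=> j /negbTE ji; rewrite !mxE ji andbF mulr0 mul0r.
  by rewrite event_xI !mxE !eqxx mulr1 mulrA.
have SE k x : tval (S k) x = fourier_term h k (d^-1 * x 0 i).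
  rewrite /tval /S !big_cons big_nil /= addr0 /wave !phE addr0 /fourier_term.
  by rewrite cosBpihalf.
have K_ge0 : 0 <= K.
  have a := le_trans (normr_ge0 _) (hK0 0); have b := le_trans (normr_ge0 _) (hK4 0).
  by rewrite addr_ge0// mulr_ge0// exprn_ge0.
exists S, (2 * (1 + d^-1 ^+ 2) * K * 2); split.
  move=> n; apply: (@le_trans _ _ (\sum_(k < n) 2 * (1 + d^-1 ^+ 2) * K * (k.+1%:R ^+ 2)^-1)); last first.
    by rewrite -mulr_sumr ler_wpM2l ?sum_inv_square// !mulr_ge0// addr_ge0// sqr_ge0.
  apply: ler_sum => k _; rewrite /tnorm /S !big_cons big_nil /= addr0 -mulrDr.
  have o2 : om (w k *: (delta_mx 0 i : 'rV[R]_3)) ^+ 2 <= (1 + d^-1 ^+ 2) * k.+1%:R ^+ 2.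
    rewrite om2 (bigD1 i)//= big1 ?addr0; last by move=> j /negbTE ji; rewrite !mxE ji andbF mulr0 expr2 mul0r.
    rewrite !mxE !eqxx mulr1 /w exprMn mulrDl mul1r; apply: lerD.
      by rewrite exprn_ege1// ler1n.
    by rewrite mulrC ler_wpM2l ?sqr_ge0// ler_pXn2r ?nnegrE// ler_nat.
  have c1 := fcoef_le D1 D2 D3 D4 hK0 hK4 h0 k 0; have c2 := fcoef_le D1 D2 D3 D4 hK0 hK4 h0 k (- (pi / 2)).
  have cc : `|fcoef h k 0| + `|fcoef h k (- (pi / 2))| <= 2 * (K / k.+1%:R ^+ 4).
    by apply: le_trans (lerD c1 c2) _; rewrite mulr_natl mulr2n.
  apply: le_trans (ler_pM (sqr_ge0 _) _ o2 cc) _; first by rewrite addr_ge0.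
  rewrite le_eqVlt; apply/orP; left; apply/eqP; field.
  by rewrite (gt_eqF d0) nat1r pnatr_eq0.
move=> x xd; under eq_fun do under eq_bigr do rewrite SE.
have xs : `|d^-1 * x 0 i| <= 3/2.
  have di : 0 <= d^-1 by rewrite invr_ge0 ltW.
  by rewrite normrM (ger0_norm di) ler_pdivrMl// mulrC.
apply/cvgrPdist_le => e e0; near=> m.
have m0 : (0 < m)%N by near: m; exact: nbhs_infty_gt.
apply: le_trans (fourier_partial D1 D2 D3 D4 hK0 hK4 h0 xs m0) _.
have : 2 * (K0 + 2 ^+ 15 * K4) / e <= m%:R by near: m; exact: nbhs_infty_ger.
by rewrite ler_pdivrMr// => H; rewrite ler_pdivrMr ?ltr0n// (mulrC e).
Unshelve. all: by end_near. Qed.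

End Wiener.

(** * Truncation and continuation of solutions *)

Section LocalSolutions.
Context {R : realType}.
Implicit Types (p q : 'rV[R]_(1 + 3)) (x : 'rV[R]_3) (u v : 'rV[R]_(1 + 3) -> R).

(** Agreement of two functions and of their time slabs on a small cube around p. *)
Definition locally_equal T u T' v p (r : R) := forall q, (forall i, `|q 0 i - p 0 i| < r) ->
  (time_slab T q <-> time_slab T' q) /\ (time_slab T q -> u q = v q).

Lemma locally_equal_pderiv T u T' v p r i : 0 < r -> time_slab T p -> locally_equal T u T' v p r ->
  locally_equal T (pderiv (time_slab T) i u) T' (pderiv (time_slab T') i v) p (r / 2).
Proof.
move=> r0 Dp H q qp; have r2 : 0 < r / 2 by rewrite divr_gt0.
have qr : forall i, `|q 0 i - p 0 i| < r by move=> j; apply: lt_trans (qp j) _; lra.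
split; first exact: (H q qr).1.
move=> Dq; apply: (@pderiv_congr _ _ _ _ _ _ _ _ (r / 2)) => //; first exact: (H q qr).2.
move=> h hr; apply: H => k; have := line_near q i k hr; have := qp k.
rewrite !ltr_norml => /andP[? ?] /andP[? ?]; apply/andP; split; lra.
Qed.

(** Being a solution is a local property, even when the local solutions live on
    slabs of different heights. *)
Lemma kg_local T u : (forall p, time_slab T p -> exists T' v, exists2 r, 0 < r &
  kg_solution T' v /\ locally_equal T u T' v p r) -> kg_solution T u.
Proof.
move=> H; split.
  apply: Ck_local => p /H[T' [v [r r0 [[Cv _] E]]]].
  by exists (time_slab T'), v, r.
move=> p Dp; have [T' [v [r r0 [[_ Ev] E]]]] := H p Dp.
have pr s : 0 < s -> forall i, `|p 0 i - p 0 i| < s by move=> s0 i; rewrite subrr normr0.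
have r2 : 0 < r / 2 by rewrite divr_gt0.
have r4 : 0 < r / 2 / 2 by rewrite divr_gt0.
have Dp' : time_slab T' p := (E p (pr r r0)).1.1 Dp.
have E0 := (E p (pr r r0)).2 Dp.
have E1 i := (locally_equal_pderiv i r0 Dp E (pr _ r2)).2 Dp.
have E2 i j := (locally_equal_pderiv j r2 Dp (locally_equal_pderiv i r0 Dp E) (pr _ r4)).2 Dp.
rewrite /dalembertian /dt /dx E0 E2 !E1; under eq_bigr do rewrite E2.
exact: Ev.
Qed.

Lemma kg_zero T : kg_solution T (fun _ => 0 : R) /\
  forall p, time_slab T p -> dt T (fun _ => 0 : R) p = 0.
Proof.
have c0 D : {within D, continuous (fun _ : 'rV[R]_(1 + 3) => 0 : R)} by exact: within_cst.
have d0 p i : is_derive p (delta_mx 0 i) (fun _ : 'rV[R]_(1 + 3) => 0 : R) 0 by exact: is_derive_cc.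
have [C0 H] := @Ck2_intro R T (fun=> 0) (fun _ _ => 0) (fun _ _ _ => 0) (c0 _) (fun _ => c0 _)
  (fun _ _ => c0 _) (fun p i _ => d0 p i) (fun p _ j _ => d0 p j).
have H1 p i : time_slab T p -> pderiv (time_slab T) i (fun=> 0) p = 0 by move=> Dp; exact: (H p Dp i i).1.
split; last by move=> p; exact: H1.
split=> // p Dp; rewrite /dalembertian /dt /dx (H p Dp _ _).2 !(H1 p)// mulr0.
by rewrite big1 ?subrr ?addr0// => a _; exact: (H p Dp _ _).2.
Qed.

Lemma coord_le_ball (x y : 'rV[R]_3) rho i : 0 < rho -> \sum_(a < 3) (x 0 a - y 0 a) ^+ 2 < rho ^+ 2 ->
  `|x 0 i - y 0 i| < rho.
Proof.
move=> r0 H; rewrite -(@ltr_pXn2r _ 2) ?nnegrE//; last exact: ltW.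
rewrite real_normK ?num_real//; apply: le_lt_trans H.
by rewrite (bigD1 i)//= lerDl sumr_ge0// => a _; exact: sqr_ge0.
Qed.

Lemma event_time_line x (t h : R) i : (event t x + h *: delta_mx 0 (lshift 3 ord0)) 0 (xI i) = x 0 i.
Proof.
rewrite -/tI -[RHS](event_xI t x i); move: (event t x) => q.
by rewrite !mxE -/tI xI_tI andbF mulr0 addr0.
Qed.

(** The series solution U is periodic in space. Up to the time d/16 it vanishes
    where some coordinate is between 9/8 d and 5/4 d, by comparison with the
    zero solution, and can be continued by 0. *)
Lemma truncated_solution (f g : 'rV[R]_3 -> R) d : 0 < d ->
  (forall x i, d <= `|x 0 i| -> f x = 0 /\ g x = 0) ->
  wiener [set x | forall i, `|x 0 i| <= 3/2 * d] f ->
  wiener [set x | forall i, `|x 0 i| <= 3/2 * d] g ->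
  exists T u, classical_solution f g T u.
Proof.
move=> d0 fg0 [fs [M [fM fC]]] [gs [M' [gM gC]]].
have fgM n : \sum_(k < n) (tnorm (fs k) + tnorm (gs k)) <= M + M'.
  by rewrite big_split; apply: lerD.
have [tau tau0 [U [KU HU]]] := local_existence fgM.
pose T0 := Num.min tau (d / 8); pose T := T0 / 2.
have T00 : 0 < T0 by rewrite lt_min tau0 divr_gt0.
have T0d : T0 <= d / 8 by rewrite /T0 ge_min lexx orbT.
have T0t : T0 <= tau by rewrite /T0 ge_min lexx.
have Tpos : 0 < T by rewrite divr_gt0.
have TT0 : T < T0 by rewrite /T; lra.
have Dx0 x : time_slab T0 (event 0 x) by apply/slabE; rewrite event_tI lexx.
have data x : (forall i, `|x 0 i| <= 3/2 * d) -> U (event 0 x) = f x /\ dt T0 U (event 0 x) = g x.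
  move=> Xx; have [a b] := HU x _ _ (fC x Xx) (gC x Xx); split=> //.
  by rewrite -b /dt (pderiv_restrict _ _ T0t).
have vanish q i : time_slab T q -> (forall j, `|q 0 (xI j)| <= 5/4 * d) -> 9/8 * d <= `|q 0 (xI i)| -> U q = 0.
  move=> /slabE/andP[q0 qT] qX qi; rewrite -(eventK q).
  have rT : 0 < T < T0 by rewrite Tpos.
  have [K0 Z0] := kg_zero T0.
  apply: (cone_uniqueness rT (kg_restrict T0t KU) K0); last by rewrite q0.
  move=> x Hx; have Hc j := coord_le_ball j Tpos Hx.
  have Xx j : `|x 0 j| <= 3/2 * d.
    have := Hc j; rewrite mxE -/(xI j) => h; have := qX j; have := ler_normD (x 0 j - q 0 (xI j)) (q 0 (xI j)).
    rewrite subrK; move: h T0d TT0 d0; clear; move: `|_| `|_| `|_| => a b c; lra.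
  have fx : f x = 0 /\ g x = 0.
    apply: (fg0 x i); have := Hc i; rewrite mxE -/(xI i) distrC => h.
    have := ler_normD (q 0 (xI i) - x 0 i) (x 0 i); rewrite subrK.
    by move: h T0d TT0 d0 qi; clear; move: `|_| `|_| `|_| => a b c; lra.
  by rewrite (data x Xx).1 (data x Xx).2 fx.1 fx.2 Z0.
pose u p := if `[< forall i, `|p 0 (xI i)| < 5/4 * d >] then U p else 0.
have Ku : kg_solution T u.
  apply: kg_local => p Dp.
  have [inside|] := pselect (forall i, `|p 0 (xI i)| < 5/4 * d).
    have [m m0 Hm] : exists2 m, 0 < m & forall i, `|p 0 (xI i)| + m <= 5/4 * d.
      pose m := Num.min (5/4 * d - `|p 0 (xI ord0)|) (Num.min (5/4 * d - `|p 0 (xI (lift ord0 ord0))|)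
        (5/4 * d - `|p 0 (xI (lift ord0 (lift ord0 ord0)))|)).
      exists m; first by rewrite !lt_min !subr_gt0 !inside.
      have H i : m <= 5/4 * d - `|p 0 (xI i)|.
        case: i => [[|[|[|//]]] Hi].
        - by rewrite (_ : Ordinal Hi = ord0) ?ge_min ?lexx//; exact: val_inj.
        - by rewrite (_ : Ordinal Hi = lift ord0 ord0) ?ge_min ?ge_min ?lexx ?orbT//; exact: val_inj.
        by rewrite (_ : Ordinal Hi = lift ord0 (lift ord0 ord0)) ?ge_min ?ge_min ?lexx ?orbT//; exact: val_inj.
      by move=> i; have := H i; lra.
    exists T, U, m => //; split; first by apply: kg_restrict KU; lra.
    move=> q qp; split=> // _; rewrite /u asboolT// => i.
    have := qp (xI i); have := Hm i; have := ler_normD (q 0 (xI i) - p 0 (xI i)) (p 0 (xI i)).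
    by rewrite subrK; move: `|_| `|_| `|_| => a b c; lra.
  move=> /existsNP[i /negP]; rewrite -leNgt => pi.
  exists T, (fun=> 0), (d / 8); first by rewrite divr_gt0.
  split; first exact: (kg_zero T).1.
  move=> q qp; split=> // Dq; rewrite /u; case: asboolP => // qX.
  apply: (vanish q i Dq); first by move=> j; exact: ltW.
  have := qp (xI i); rewrite distrC; have := ler_normD (p 0 (xI i) - q 0 (xI i)) (q 0 (xI i)).
  by rewrite subrK; move: pi; move: `|_| `|_| `|_| => a b c; lra.
exists T, u; apply/classical_kg; split=> //.
  move=> x; rewrite /u; case: asboolP => [xX|/existsNP[i /negP]].
    by apply: (data x _).1 => i; have := xX i; rewrite event_xI => /ltW; lra.
  by rewrite -leNgt event_xI => xi; rewrite (fg0 x i _).1//; lra.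
move=> x; have DT : time_slab T (event 0 x) by apply/slabE; rewrite event_tI lexx.
have [xX|/existsNP[i /negP]] := pselect (forall i, `|x 0 i| < 5/4 * d).
  rewrite -(data x _).2; last by move=> i; have := xX i; lra.
  rewrite /dt -(pderiv_restrict _ _ (ltW TT0) DT); apply: (@pderiv_congr _ _ _ _ _ _ _ _ 1) => //.
    by rewrite /u asboolT// => i; rewrite event_xI.
  move=> h _; split=> // _; rewrite /u asboolT// => i.
  by rewrite event_time_line.
rewrite -leNgt => xi; rewrite (fg0 x i _).2; last by lra.
transitivity (dt T (fun=> 0) (event 0 x)); last exact: (kg_zero T).2.
rewrite /dt; apply: (@pderiv_congr _ _ _ _ _ _ _ _ 1) => //.
  by rewrite /u asboolF// => H; have := H i; rewrite event_xI; lra.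
move=> h _; split=> // _; rewrite /u asboolF// => H; have := H i.
by rewrite event_time_line; lra.
Qed.

(** The data agree everywhere, so that any cone may be used. *)
Lemma solutions_agree (f g : 'rV[R]_3 -> R) T T' u v p : classical_solution f g T u ->
  classical_solution f g T' v -> 0 <= p 0 tI -> p 0 tI < T -> p 0 tI < T' -> u p = v p.
Proof.
move=> /classical_kg[T0 Ku uf ug] /classical_kg[T'0 Kv vf vg] p0 pT pT'.
pose m := Num.min T T'; (* any radius strictly between the time of p and both lifespans *)
pose rho := (p 0 tI + m) / 2.
have pm : p 0 tI < m by rewrite lt_min pT.
have mT : m <= T by rewrite ge_min lexx.
have mT' : m <= T' by rewrite ge_min lexx orbT.
have rm : 0 < rho < m by rewrite /rho; apply/andP; split; lra.
rewrite -(eventK p); apply: (cone_uniqueness rm (kg_restrict mT Ku) (kg_restrict mT' Kv)).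
  move=> x _; have Dx : time_slab m (event 0 x) by apply/slabE; rewrite event_tI lexx/=; lra.
  by split; first (by rewrite uf vf); rewrite /dt (pderiv_restrict _ _ mT Dx) (pderiv_restrict _ _ mT' Dx) -/(dt T u _) ug -vg.
by rewrite p0/= /rho; lra.
Qed.

(** The union of all solutions with the given data is a solution up to the
    supremum of their lifespans, which is therefore attained. *)
Lemma blowup_of_bounded_lifespan (f g : 'rV[R]_3 -> R) L :
  (exists T u, classical_solution f g T u) ->
  (forall T u, classical_solution f g T u -> T <= L) ->
  blows_up_in_finite_time f g.
Proof.
move=> [T1 [u1 Hu1]] HL; pose A := [set T | exists u, classical_solution f g T u].
have A1 : A T1 by exists u1.
have supA : has_sup A by split; [exists T1|exists L => T [u]; exact: HL].
have Ale T : A T -> T <= sup A by move=> AT; exact: sup_upper_bound.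
have pick (t : R) : {S : R * ('rV[R]_(1 + 3) -> R) | t < sup A -> t < S.1 /\ classical_solution f g S.1 S.2}.
  apply: cid; have [tA|At] := ltP t (sup A); last by exists (0, fun=> 0).
  by have [T [v Hv] tT] := sup_gt (ex_intro _ _ A1 : A !=set0) tA; exists (T, v).
pose u p := (sval (pick (p 0 tI))).2 p.
have uE T v p : classical_solution f g T v -> 0 <= p 0 tI -> p 0 tI < T -> u p = v p.
  move=> Hv p0 pT; rewrite /u; case: (pick _) => [[T' w] /= [|tT' Hw]].
    by apply: lt_le_trans pT _; apply: Ale; exists v.
  exact: (solutions_agree Hw Hv p0 tT' pT).
have loc p T v : classical_solution f g T v -> time_slab (sup A) p -> p 0 tI < T ->
    locally_equal (sup A) u T v p (T - p 0 tI).
  move=> Hv /slabE/andP[p0 pA] pT q qp; have := qp tI; rewrite ltr_norml => /andP[_ qT].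
  have {}qT : q 0 tI < T by lra.
  have TA : T <= sup A by apply: Ale; exists v.
  split; first by split=> /slabE/andP[q0 _]; apply/slabE; rewrite q0/=; lra.
  by move=> /slabE/andP[q0 _]; exact: uE Hv q0 qT.
have T10 : 0 < T1 by case: Hu1.
have supA0 : 0 < sup A := lt_le_trans T10 (Ale _ A1).
exists (sup A), u; split.
  rewrite /max_existence_time -/A; by apply: ereal_sup_EFin; case: supA.
apply/classical_kg; split=> //.
- apply: kg_local => p Dp; have /slabE/andP[p0 pA] := Dp.
  have [[T v] /= /(_ pA) [pT Hv]] := pick (p 0 tI); exists T, v, (T - p 0 tI); first by rewrite subr_gt0.
  by split; [have /classical_kg[] := Hv|exact: loc].
- move=> x; rewrite (uE T1 u1) ?event_tI//; by case: Hu1.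
move=> x; have Dx : time_slab (sup A) (event 0 x) by apply/slabE; rewrite event_tI lexx.
have r0 : 0 < T1 - event 0 x 0 tI by rewrite event_tI subr0.
have H := loc (event 0 x) T1 u1 Hu1 Dx; rewrite event_tI in H; have {}H := H T10.
have r1 : 0 < T1 - 0 by rewrite subr0.
have [_ _ _ _ <-] := Hu1.
apply: (locally_equal_pderiv tI r1 Dx H _).2 => // i.
by rewrite subrr normr0 divr_gt0.
Qed.

End LocalSolutions.

(** * Blow-up along a characteristic *)

Section Bootstrap.
Context {R : realType}.
Variables (a b tau : R).

(** The part up to time tau of the domain of dependence of the interval [a, b]. *)
Definition in_triangle (t x : R) := [/\ 0 <= t, t <= tau, a + t <= x & x <= b - t].

(** Slices of the triangle are compact, so that a property which extends a
    little beyond each point of a slice extends uniformly to later slices; the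
    supremum of the good times is then the final time. *)
Lemma continuous_induction (Q : R -> R -> Prop) :
  (forall t x, in_triangle t x -> t < tau -> Q t x -> exists2 d, 0 < d &
     forall s x', t <= s -> s - t < d -> `|x' - x| < d -> Q s x') ->
  (forall x, in_triangle 0 x -> Q 0 x) ->
  (forall t x, in_triangle t x -> 0 < t ->
     (forall s x', in_triangle s x' -> s < t -> Q s x') -> Q t x) ->
  forall t x, in_triangle t x -> Q t x.
Proof.
move=> Qopen Q0 Qstep.
have [tau0|tau0] := ltP tau 0.
  by move=> t x [t0 tt _ _]; have := le_lt_trans (le_trans t0 tt) tau0; rewrite ltxx.
pose A := [set t | 0 <= t <= tau /\ forall s x, in_triangle s x -> s <= t -> Q s x].
have A0 : A 0.
  split=> [|s x Dsx s0]; first by rewrite lexx.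
  have s00 : s = 0 by case: Dsx => s1 _ _ _; apply/eqP; rewrite eq_le s0.
  by move: Dsx; rewrite s00; exact: Q0.
have supA : has_sup A.
  by split; [exists 0|exists tau => t [/andP[]]].
set T := sup A.
have T0 : 0 <= T by apply: ub_le_sup supA.2 _ A0.
have Ttau : T <= tau by apply: ge_sup; [exact: supA.1|move=> t [/andP[]]].
have below s x : in_triangle s x -> s < T -> Q s x.
  move=> Dsx sT; have Ts : 0 < T - s by rewrite subr_gt0.
  have [r [_ Ar] sr] := sup_adherent Ts supA.
  by apply: Ar => //; apply/ltW; move: sr; rewrite -/T opprB addrC subrK.
have upto s x : in_triangle s x -> s <= T -> Q s x.
  move=> Dsx; rewrite le_eqVlt => /predU1P[sT|]; last exact: below.
  have [s0|s0] := ltP 0 s; first by apply: Qstep => // s' x' D' s's; apply: below; rewrite // -sT.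
  have s00 : s = 0 by case: Dsx => s1 _ _ _; apply/eqP; rewrite eq_le s0.
  by move: Dsx; rewrite s00; exact: Q0.
suff TE : T = tau by move=> t x Dtx; apply: upto => //; rewrite TE; case: Dtx.
apply/eqP; rewrite eq_le Ttau /= leNgt; apply/negP => Tlt.
have cK : compact `[a + T, b - T]%classic by exact: segment_compact.
move/compact_near_coveringP : cK => /(_ R (0^'+) (fun d x => forall s, T <= s -> s - T < d -> Q s x) _).
case.
  move=> x /=; rewrite in_itv/= => /andP[ax xb].
  have Dx : in_triangle T x by split.
  have [d d0 Hd] := Qopen T x Dx Tlt (upto T x Dx (lexx _)).
  exists (ball x d, [set d' | d' < d]).
    by split; [exact: nbhsx_ballx|exact: nbhs_right_lt].
  move=> [x' d'] /= []; rewrite /ball/= => xx' dd' s Ts sd; apply: Hd => //; first exact: lt_trans sd dd'.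
  by rewrite distrC.
move=> r /= r0 Hr.
pose d := Num.min (r / 2) (tau - T).
have d0 : 0 < d by rewrite lt_min divr_gt0//= subr_gt0.
have dr : d < r.
  by rewrite gt_min ltr_pdivrMr// ltr_pMr// ltr1n.
have Kd := Hr d.
have HQ s x : in_triangle s x -> s - T < d -> Q s x.
  move=> Dsx sd; have [sT|/ltW Ts] := leP s T; first exact: upto.
  apply: (Kd _ d0 x) => //=; first by rewrite /ball/= sub0r normrN gtr0_norm.
  by case: Dsx => s0 st ax xb; rewrite in_itv/=; apply/andP; split; lra.
have : A (T + d / 2).
  split=> [|s x Dsx sT].
    have : d <= tau - T by rewrite ge_min lexx orbT.
    by move=> ?; apply/andP; split; lra.
  by apply: HQ => //; lra.
move=> /(ub_le_sup supA.2); rewrite -/T gerDl leNgt divr_gt0//.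
Qed.

(** Derivatives are two-sided for positive times only; at time 0 continuity is
    enough. *)
Lemma char_ge0 (g dg : R -> R) (t : R) : 0 < t ->
  (forall s : R, 0 < s <= t -> is_derive s 1 g (dg s)) ->
  (forall s : R, 0 < s < t -> 0 <= dg s) ->
  (forall e : R, 0 < e -> exists2 d : R, 0 < d & forall s : R, 0 < s < d -> `|g s - g 0| < e) ->
  g 0 <= g t.
Proof.
move=> t0 Dg dg0 cg; rewrite leNgt; apply/negP => gt.
have [|d d0 Hd] := cg (g 0 - g t); first by rewrite subr_gt0.
pose s := Num.min d t / 2.
have m0 : 0 < Num.min d t by rewrite lt_min d0.
have s0 : 0 < s by rewrite divr_gt0.
have : s < Num.min d t by rewrite /s ltr_pdivrMr// ltr_pMr// ltr1n.
rewrite lt_min => /andP[sd st].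
have : g s <= g t.
  apply: (@nondecr_derive R g dg s t (ltW st)) => x /andP[sx xt].
  - by apply: (@derive_cont1 _ _ _ (dg x)); apply: Dg; rewrite (lt_le_trans s0).
  - by apply: Dg; rewrite (lt_trans s0)//= ltW.
  - by apply: dg0; rewrite (lt_trans s0).
have := ltr_normlW (eq_ind_r (fun z => z < _) (Hd s (introT andP (conj s0 sd))) (distrC (g 0) (g s))).
lra.
Qed.

End Bootstrap.

Section Blowup1D.
Context {R : realType}.
Variables (T a b tau : R) (p q w px qx : R -> R -> R).
Hypotheses (tau0 : 0 < tau) (tauT : tau < T) (tauE : a + tau <= b - tau).

Definition half_strip := [set z : R * R | 0 <= z.1 < T].
Let cont (f : R -> R -> R) := {within half_strip, continuous (fun z => f z.1 z.2)}.
Hypotheses (cp : cont p) (cq : cont q) (cw : cont w) (cpx : cont px) (cqx : cont qx).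

(** The cubic term u_t^2 u_x in the unknowns p = u_t + u_x and q = u_t - u_x; Fp
    and Fq are its partial derivatives. *)
Definition Fpq (p q : R) := (p + q) ^+ 2 * (p - q) / 8.
Definition Fp (p q : R) := (p + q) * (3 * p - q) / 8.
Definition Fq (p q : R) := (p + q) * (p - 3 * q) / 8.
(** The right-hand side of both characteristic equations. *)
Definition Ft t x := Fpq (p t x) (q t x) - w t x.
Definition Fx t x := Fp (p t x) (q t x) * px t x + Fq (p t x) (q t x) * qx t x - (p t x - q t x) / 2.

Let lft (f : R -> R -> R) (t x s : R) := f s (x + t - s).
Let rgt (f : R -> R -> R) (t x s : R) := f s (x - t + s).
Let tri := in_triangle a b tau.
Hypotheses
  (Dp : forall t x, tri t x -> 0 < t -> is_derive t 1 (lft p t x) (Ft t x))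
  (Dp' : forall t x, tri t x -> 0 < t -> is_derive t 1 (rgt p t x) (Ft t x + 2 * px t x))
  (Dq : forall t x, tri t x -> 0 < t -> is_derive t 1 (rgt q t x) (Ft t x))
  (Dq' : forall t x, tri t x -> 0 < t -> is_derive t 1 (lft q t x) (Ft t x - 2 * qx t x))
  (Dw : forall t x, tri t x -> 0 < t -> is_derive t 1 (lft w t x) (q t x))
  (Dw' : forall t x, tri t x -> 0 < t -> is_derive t 1 (rgt w t x) (p t x))
  (Dpx : forall t x, tri t x -> 0 < t -> is_derive t 1 (lft px t x) (Fx t x))
  (Dqx : forall t x, tri t x -> 0 < t -> is_derive t 1 (rgt qx t x) (Fx t x)).

Variables (pm eps Wm : R).
Hypotheses (pm0 : 0 < pm) (eps0 : 0 < eps) (epsm : 3 / 2 <= eps * pm) (Wmm : Wm <= pm ^+ 3 / 24).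

Lemma char_deriveM (f g : R -> R) (s df dg : R) : is_derive s 1 f df -> is_derive s 1 g dg ->
  is_derive s 1 (fun z => f z * g z) (df * g s + f s * dg).
Proof.
move=> Df Dg; apply: (is_derive_eq (is_deriveM Df Dg)).
by rewrite /GRing.scale/= addrC mulrC.
Qed.

Lemma char_deriveD (f g : R -> R) (s df dg : R) : is_derive s 1 f df -> is_derive s 1 g dg ->
  is_derive s 1 (fun z => f z + g z) (df + dg).
Proof. by move=> Df Dg; exact: is_deriveD. Qed.

Lemma char_deriveB (f g : R -> R) (s df dg : R) : is_derive s 1 f df -> is_derive s 1 g dg ->
  is_derive s 1 (fun z => f z - g z) (df - dg).
Proof. by move=> Df Dg; exact: is_deriveB. Qed.

Lemma derive_inv_square (f : R -> R) (s df : R) : f s != 0 -> is_derive s 1 f df ->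
  is_derive s 1 (fun z => (f z ^+ 2)^-1) (- (2 * df / f s ^+ 3)).
Proof.
move=> fs Df; have ns : f s * f s != 0 by rewrite mulf_neq0.
have D := char_deriveM Df Df.
have DE : is_derive s 1 (fun z => (f z * f z)^-1) (- (f s * f s) ^- 2 *: (df * f s + f s * df)).
  split; first by apply: derivableV => //; case: D.
  by rewrite deriveV//; case: D => _ ->.
rewrite (_ : (fun z => _) = (fun z => (f z * f z)^-1)); last by apply/funext => z; rewrite expr2.
by apply: (is_derive_eq DE); rewrite /GRing.scale/=; field.
Qed.

Lemma derive_Fpq (f g : R -> R) (s df dg : R) : is_derive s 1 f df -> is_derive s 1 g dg ->
  is_derive s 1 (fun z => Fpq (f z) (g z)) (Fp (f s) (g s) * df + Fq (f s) (g s) * dg).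
Proof.
move=> Df Dg.
rewrite (_ : (fun z => _) = (fun z => (f z + g z) * (f z + g z) * (f z - g z) * 8^-1)); last first.
  by apply/funext => z; rewrite /Fpq expr2.
have DS := char_deriveD Df Dg; have DE := char_deriveM (char_deriveM (char_deriveM DS DS) (char_deriveB Df Dg)) (is_derive_c1 8^-1 s).
by apply: (is_derive_eq DE); rewrite /Fp /Fq; field.
Qed.

Definition gap_p t x := p t x - pm.
Definition gap_pq t x := p t x - 3 * q t x.
Definition gap_px t x := px t x - Ft t x - eps.
Definition gap_qx t x := 3 * qx t x - Ft t x.
Definition gap_w t x := (Wm - w t x) * p t x - 8.

(** In this region p is large and dominates q, and px and qx dominate Ft
    strongly enough for the region to be invariant. The last gap keeps w below
    p^3 / 24, so that it does not spoil the growth of p. *)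
Definition trapped t x := [/\ 0 < gap_p t x, 0 < q t x, 0 < gap_pq t x &
  [/\ 0 < gap_px t x, 0 < gap_qx t x & 0 < gap_w t x]].

Let contc (c : R) : cont (fun _ _ => c). Proof. exact: within_cst. Qed.

Let cFt : cont Ft.
Proof.
rewrite /cont (_ : (fun z => _) = (fun z : R * R => (p z.1 z.2 + q z.1 z.2) * (p z.1 z.2 + q z.1 z.2) *
   (p z.1 z.2 - q z.1 z.2) * 8^-1 - w z.1 z.2)).
  apply: withinB => //; apply: withinM; last exact: contc.
  by apply: withinM; [apply: withinM; apply: withinD|apply: withinB].
by apply/funext => z; rewrite /Ft /Fpq expr2.
Qed.

Let cgap_p : cont gap_p. Proof. by apply: withinB => //; exact: contc. Qed.
Let cgap_pq : cont gap_pq. Proof. by apply: withinB => //; apply: withinM => //; exact: contc. Qed.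
Let cgap_px : cont gap_px. Proof. by apply: withinB; [exact: withinB|exact: contc]. Qed.
Let cgap_qx : cont gap_qx. Proof. by apply: withinB => //; apply: withinM => //; exact: contc. Qed.
Let cgap_w : cont gap_w.
Proof.
apply: withinB; last exact: contc.
by apply: withinM => //; apply: withinB => //; exact: contc.
Qed.

Lemma cont_eps (f : R -> R -> R) t x : cont f -> 0 <= t < T -> forall e, 0 < e ->
  exists2 d, 0 < d & forall s x', 0 <= s < T -> `|s - t| < d -> `|x' - x| < d -> `|f s x' - f t x| < e.
Proof.
move=> /subspace_continuousP/(_ (t, x)) H tT e e0.
have /cvgrPdist_lt/(_ e e0) := H tT.
rewrite near_withinE near_simpl => /nbhs_ballP[d /= d0 Hd]; exists d => // s x' sT st xx.
by rewrite distrC; apply: (Hd (s, x')) => //; split; rewrite /ball/= distrC.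
Qed.

Let tri_T t x : tri t x -> 0 <= t < T.
Proof. by case=> t0 tt _ _; rewrite t0 (le_lt_trans tt). Qed.

Lemma trapped_open t x : tri t x -> t < tau -> trapped t x -> exists2 d, 0 < d &
     forall s x', t <= s -> s - t < d -> `|x' - x| < d -> trapped s x'.
Proof.
move=> Dtx ttau [h1 h2 h3 [h4 h5 h6]].
have op (f : R -> R -> R) : cont f -> 0 < f t x -> exists2 d, 0 < d &
     forall s x', t <= s -> s - t < d -> `|x' - x| < d -> 0 < f s x'.
  move=> cf f0; have [d d0 Hd] := @cont_eps f t x cf (tri_T Dtx) _ f0.
  exists (Num.min d (T - t)); first by rewrite lt_min d0 subr_gt0; case/andP: (tri_T Dtx).
  move=> s x'; rewrite !lt_min => ts /andP[sd sT] /andP[xd _].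
  have t0 : 0 <= t by case: Dtx.
  have sT' : 0 <= s < T by rewrite (le_trans t0 ts) -(ltrD2r (- t)).
  have st : `|s - t| < d by rewrite ger0_norm ?subr_ge0.
  by have := Hd s x' sT' st xd; rewrite ltr_norml ltrBrDl subrr => /andP[].
have [d1 d10 H1] := op _ cgap_p h1; have [d2 d20 H2] := op _ cq h2; have [d3 d30 H3] := op _ cgap_pq h3.
have [d4 d40 H4] := op _ cgap_px h4; have [d5 d50 H5] := op _ cgap_qx h5; have [d6 d60 H6] := op _ cgap_w h6.
exists (Num.min (Num.min d1 (Num.min d2 d3)) (Num.min d4 (Num.min d5 d6))).
  by rewrite !lt_min d10 d20 d30 d40 d50 d60.
move=> s x' ts; rewrite !lt_min => /andP[/and3P[a1 a2 a3] /and3P[a4 a5 a6]] /andP[/and3P[b1 b2 b3] /and3P[b4 b5 b6]].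
by split; [exact: H1|exact: H2|exact: H3|split; [exact: H4|exact: H5|exact: H6]].
Qed.

Lemma lft_shift (f : R -> R -> R) t x s : lft f s (x + t - s) = lft f t x.
Proof. by apply/funext => z; rewrite /lft subrK. Qed.

Lemma rgt_shift (f : R -> R -> R) t x s : rgt f s (x - t + s) = rgt f t x.
Proof. by apply/funext => z; rewrite /rgt addrK. Qed.

Lemma tri_lft t x s : tri t x -> 0 <= s <= t -> tri s (x + t - s).
Proof. by move=> [t0 tt ax xb] /andP[s0 st]; split; lra. Qed.

Lemma tri_rgt t x s : tri t x -> 0 <= s <= t -> tri s (x - t + s).
Proof. by move=> [t0 tt ax xb] /andP[s0 st]; split; lra. Qed.

Lemma lft_right_cont (f : R -> R -> R) t x : cont f ->
  forall e : R, 0 < e -> exists2 d : R, 0 < d & forall s : R, 0 < s < d -> `|lft f t x s - lft f t x 0| < e.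
Proof.
move=> cf e e0; have T0 : (0 : R) <= 0 < T by rewrite lexx (lt_trans tau0).
have [d d0 Hd] := @cont_eps f 0 (x + t) cf T0 e e0.
exists (Num.min d T); first by rewrite lt_min d0 (lt_trans tau0).
move=> s /andP[s0]; rewrite lt_min => /andP[sd sT]; rewrite /lft subr0; apply: Hd.
- by rewrite (ltW s0).
- by rewrite subr0 gtr0_norm.
- by rewrite addrAC subrr sub0r normrN gtr0_norm.
Qed.

Lemma rgt_right_cont (f : R -> R -> R) t x : cont f ->
  forall e : R, 0 < e -> exists2 d : R, 0 < d & forall s : R, 0 < s < d -> `|rgt f t x s - rgt f t x 0| < e.
Proof.
move=> cf e e0; have T0 : (0 : R) <= 0 < T by rewrite lexx (lt_trans tau0).
have [d d0 Hd] := @cont_eps f 0 (x - t) cf T0 e e0.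
exists (Num.min d T); first by rewrite lt_min d0 (lt_trans tau0).
move=> s /andP[s0]; rewrite lt_min => /andP[sd sT]; rewrite /rgt addr0; apply: Hd.
- by rewrite (ltW s0).
- by rewrite subr0 gtr0_norm.
- by rewrite addrAC subrr add0r gtr0_norm.
Qed.

(** A quantity that is positive at time 0 and does not decrease along
    characteristics stays positive. *)
Lemma lft_pos (f df : R -> R -> R) t x : cont f ->
  (forall t x, tri t x -> 0 < t -> is_derive t 1 (lft f t x) (df t x)) ->
  tri t x -> 0 < t -> (forall x, tri 0 x -> 0 < f 0 x) ->
  (forall s x', tri s x' -> s < t -> 0 <= df s x') -> 0 < f t x.
Proof.
move=> cf Df Dtx t0 f0 H.
have Ex : lft f t x t = f t x by rewrite /lft addrK.
rewrite -Ex; apply: (@lt_le_trans _ _ (lft f t x 0)).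
  rewrite /lft subr0; apply: f0; have := @tri_lft t x 0 Dtx; rewrite subr0; apply.
  by rewrite lexx ltW.
apply: (@char_ge0 R _ (fun s => df s (x + t - s)) _ t0); last exact: lft_right_cont.
  move=> s /andP[s0 st]; rewrite -(lft_shift f t x s); apply: Df => //.
  by apply: tri_lft => //; rewrite (ltW s0).
by move=> s /andP[s0 st]; apply: H => //; apply: tri_lft => //; rewrite !ltW.
Qed.

Lemma rgt_pos (f df : R -> R -> R) t x : cont f ->
  (forall t x, tri t x -> 0 < t -> is_derive t 1 (rgt f t x) (df t x)) ->
  tri t x -> 0 < t -> (forall x, tri 0 x -> 0 < f 0 x) ->
  (forall s x', tri s x' -> s < t -> 0 <= df s x') -> 0 < f t x.
Proof.
move=> cf Df Dtx t0 f0 H.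
have Ex : rgt f t x t = f t x by rewrite /rgt subrK.
rewrite -Ex; apply: (@lt_le_trans _ _ (rgt f t x 0)).
  rewrite /rgt addr0; apply: f0; have := @tri_rgt t x 0 Dtx; rewrite addr0; apply.
  by rewrite lexx ltW.
apply: (@char_ge0 R _ (fun s => df s (x - t + s)) _ t0); last exact: rgt_right_cont.
  move=> s /andP[s0 st]; rewrite -(rgt_shift f t x s); apply: Df => //.
  by apply: tri_rgt => //; rewrite (ltW s0).
by move=> s /andP[s0 st]; apply: H => //; apply: tri_rgt => //; rewrite !ltW.
Qed.

Lemma dlft_Ft t x : tri t x -> 0 < t -> is_derive t 1 (lft Ft t x)
  (Fp (p t x) (q t x) * Ft t x + Fq (p t x) (q t x) * (Ft t x - 2 * qx t x) - q t x).
Proof.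
move=> Dtx t0; have D := char_deriveB (derive_Fpq (Dp Dtx t0) (Dq' Dtx t0)) (Dw Dtx t0).
by apply: (is_derive_eq D); rewrite /lft addrK.
Qed.

Lemma drgt_Ft t x : tri t x -> 0 < t -> is_derive t 1 (rgt Ft t x)
  (Fp (p t x) (q t x) * (Ft t x + 2 * px t x) + Fq (p t x) (q t x) * Ft t x - p t x).
Proof.
move=> Dtx t0; have D := char_deriveB (derive_Fpq (Dp' Dtx t0) (Dq Dtx t0)) (Dw' Dtx t0).
by apply: (is_derive_eq D); rewrite /rgt subrK.
Qed.

(** The common derivative of gap_px along the characteristics of p and of gap_qx
    along those of q. The coefficients 1 and 3 of px and qx in these gaps are
    the ones for which the two derivatives coincide. *)
Let V t x := Fp (p t x) (q t x) * (px t x - Ft t x) + Fq (p t x) (q t x) * (3 * qx t x - Ft t x) -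
   (p t x - 3 * q t x) / 2.

Lemma dlft_gap_px t x : tri t x -> 0 < t -> is_derive t 1 (lft gap_px t x) (V t x).
Proof.
move=> Dtx t0; have D := char_deriveB (char_deriveB (Dpx Dtx t0) (dlft_Ft Dtx t0)) (is_derive_c1 eps t).
by apply: (is_derive_eq D); rewrite /V /Fx; field.
Qed.

Lemma drgt_gap_qx t x : tri t x -> 0 < t -> is_derive t 1 (rgt gap_qx t x) (V t x).
Proof.
move=> Dtx t0; have D := char_deriveB (char_deriveM (is_derive_c1 3 t) (Dqx Dtx t0)) (drgt_Ft Dtx t0).
by apply: (is_derive_eq D); rewrite /V /Fx; field.
Qed.

Lemma Fpq_ge (P Q : R) : 0 <= Q -> 3 * Q <= P -> P ^+ 3 / 12 <= Fpq P Q.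
Proof.
move=> Q0 QP; rewrite /Fpq -subr_ge0; pose d := P - 3 * Q.
have d0 : 0 <= d by rewrite subr_ge0.
have -> : (P + Q) ^+ 2 * (P - Q) / 8 - P ^+ 3 / 12 =
  7 / 4 * Q ^+ 3 + 7 / 4 * (Q ^+ 2 * d) + 1 / 2 * (Q * d ^+ 2) + d ^+ 3 / 24.
  by rewrite /d; field.
by rewrite !addr_ge0// mulr_ge0// ?invr_ge0// ?mulr_ge0// ?exprn_ge0// ?divr_ge0.
Qed.


(** Fpq is at least p^3 / 12 when 3 q <= p; half of it absorbs w. *)
Lemma trapped_Ft t x : trapped t x -> p t x ^+ 3 / 24 <= Ft t x.
Proof.
move=> [h1 h2 h3 [h4 h5 h6]]; rewrite /Ft.
have h3' : 3 * q t x <= p t x by rewrite -subr_ge0 ltW.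
have P1 : pm < p t x by rewrite -subr_gt0.
have P0 := lt_trans pm0 P1.
have wW : w t x < Wm.
  rewrite -subr_gt0 -(pmulr_lgt0 _ P0); apply: lt_trans (_ : 8 < _); first by [].
  by rewrite -subr_gt0.
have P3 : pm ^+ 3 <= p t x ^+ 3 by rewrite lerXn2r ?nnegrE// ltW.
move: (Fpq_ge (ltW h2) h3') Wmm P3 wW.
move: (p t x ^+ 3) (pm ^+ 3) (Fpq _ _) (w t x) Wm => P' m' F' w' W' *; lra.
Qed.

Lemma trapped_V t x : trapped t x -> 0 <= V t x.
Proof.
move=> [h1 h2 h3 [h4 h5 h6]]; rewrite /V.
have P1 : pm < p t x by rewrite -subr_gt0.
have P0 := lt_trans pm0 P1.
move: h1 h2 h3 h4 h5; rewrite /gap_p /gap_pq /gap_px /gap_qx /Fp /Fq.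
move: (p t x) (q t x) (px t x) (qx t x) (Ft t x) P1 P0 => P Q X Y G P1 P0 h1 h2 h3 h4 h5.
have e1 : eps * P >= 3 / 2 by apply: le_trans epsm _; rewrite ler_pM2l// ltW.
have F1 : P ^+ 2 / 3 <= (P + Q) * (3 * P - Q) / 8 by nra.
have F2 : 0 <= (P + Q) * (P - 3 * Q) / 8.
  by rewrite divr_ge0// mulr_ge0// ltW// addr_gt0.
have e2 := mulr_ge0 F2 (ltW h5).
have e3 : P ^+ 2 / 3 * eps <= (P + Q) * (3 * P - Q) / 8 * (X - G).
  apply: ler_pM => //; [|exact: ltW|]; last by lra.
  by rewrite divr_ge0// sqr_ge0.
have e4 : P / 2 <= P ^+ 2 / 3 * eps by nra.
lra.
Qed.

Hypothesis trapped0 : forall x, tri 0 x -> trapped 0 x.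

(** All six quantities are nondecreasing along their characteristics inside the
    region, and the region is open. *)
Lemma trapped_all t x : tri t x -> trapped t x.
Proof.
move: t x; apply: continuous_induction => //; first exact: trapped_open.
move=> t x Dtx t0 H.
have Dgap_p t' x' : tri t' x' -> 0 < t' -> is_derive t' 1 (lft gap_p t' x') (Ft t' x').
  move=> D' t'0; have D := char_deriveB (Dp D' t'0) (is_derive_c1 pm t').
  by apply: (is_derive_eq D); rewrite subr0.
have Dgap_pq t' x' : tri t' x' -> 0 < t' -> is_derive t' 1 (rgt gap_pq t' x') (2 * (px t' x' - Ft t' x')).
  move=> D' t'0; have D := char_deriveB (Dp' D' t'0) (char_deriveM (is_derive_c1 3 t') (Dq D' t'0)).
  by apply: (is_derive_eq D); ring.
have Dgap_w t' x' : tri t' x' -> 0 < t' -> is_derive t' 1 (lft gap_w t' x') (- q t' x' * p t' x' + (Wm - w t' x') * Ft t' x').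
  move=> D' t'0; have D := char_deriveB (char_deriveM (char_deriveB (is_derive_c1 Wm t') (Dw D' t'0)) (Dp D' t'0)) (is_derive_c1 8 t').
  by apply: (is_derive_eq D); rewrite /lft addrK; ring.
have Fpos s x' : tri s x' -> s < t -> 0 <= Ft s x'.
  move=> Ds st; have Ts := H s x' Ds st; apply: le_trans (trapped_Ft Ts).
  have [h1 _ _ _] := Ts; rewrite mulr_ge0 ?invr_ge0// exprn_ge0// ltW// (lt_trans pm0)//.
  by rewrite -subr_gt0.
have K0 (f : R -> R -> R) : (forall x, trapped 0 x -> 0 < f 0 x) -> forall x, tri 0 x -> 0 < f 0 x.
  by move=> Hf x' D0; apply: Hf; exact: trapped0.
split; last split.
- by apply: (lft_pos cgap_p Dgap_p Dtx t0 _ Fpos); apply: K0 => x' [].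
- by apply: (rgt_pos cq Dq Dtx t0 _ Fpos); apply: K0 => x' [].
- apply: (rgt_pos cgap_pq Dgap_pq Dtx t0); first by apply: K0 => x' [].
  move=> s x' Ds st; have [_ _ _ [h4 _ _]] := H s x' Ds st.
  by rewrite mulr_ge0// ltW// -(ltrD2r (- eps)) sub0r (lt_trans _ h4)// oppr_lt0.
- by apply: (lft_pos cgap_px dlft_gap_px Dtx t0); [apply: K0 => x' [_ _ _ []]|move=> s x' Ds st; apply: trapped_V; exact: H].
- by apply: (rgt_pos cgap_qx drgt_gap_qx Dtx t0); [apply: K0 => x' [_ _ _ []]|move=> s x' Ds st; apply: trapped_V; exact: H].
apply: (lft_pos cgap_w Dgap_w Dtx t0); first by apply: K0 => x' [_ _ _ []].
move=> s x' Ds st; have Ts := H s x' Ds st; have HF := trapped_Ft Ts.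
have [h1 h2 h3 [h4 h5 h6]] := Ts.
have P0 : 0 < p s x' by rewrite (lt_trans pm0)// -subr_gt0.
move: HF h2 h3 h6; rewrite /gap_pq /gap_w; move: (p s x') (q s x') (w s x') (Ft s x') P0 => P Q W G P0 HF h2 h3 h6.
have e1 : 8 * (P ^+ 2 / 24) <= (Wm - W) * P * (P ^+ 2 / 24).
  by apply: ler_wpM2r; [rewrite divr_ge0// sqr_ge0|lra].
have W0 : 0 <= Wm - W by rewrite -(pmulr_lge0 _ P0); lra.
have e2 := ler_wpM2l W0 HF.
nra.
Qed.

(** Along x + t = b the function f = p satisfies f' >= f^3 / 24, hence - 1 / f^2
    - s / 12 is nondecreasing and tau cannot exceed 12 / f(0)^2. *)
Theorem blowup_time : p 0 b ^+ 2 * tau < 12.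
Proof.
have tau0' := ltW tau0.
have Db s : 0 <= s <= tau -> tri s (b - s) by have tE := tauE; move=> /andP[s0 st]; split; lra.
have Tb s : 0 <= s <= tau -> [/\ pm < p s (b - s) & p s (b - s) ^+ 3 / 24 <= Ft s (b - s)].
  move=> st; have Ts := trapped_all (Db s st); split; last exact: trapped_Ft.
  by have [+ _ _ _] := Ts; rewrite /gap_p subr_gt0.
(* the right edge of the triangle *)
pose f s := p s (b - s).
have fE s : lft p s (b - s) = f by apply/funext => z; rewrite /lft /f subrK.
have Df s : 0 < s <= tau -> is_derive s 1 f (Ft s (b - s)).
  by move=> /andP[s0 st]; rewrite -(fE s); apply: Dp => //; apply: Db; rewrite st ltW.
pose g s := - (f s) ^- 2 - s / 12.
pose dg s := 2 * Ft s (b - s) / f s ^+ 3 - 12^-1.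
have f0 s : 0 <= s <= tau -> 0 < f s by move=> /Tb[/(lt_trans pm0)].
have : g 0 <= g tau.
  apply: (@char_ge0 R g dg tau tau0).
  - move=> s /[dup] st /andP[s0 s1].
    have fs : 0 < f s by apply: f0; rewrite s1 ltW.
    have D2 := char_deriveM (is_derive_id s (1 : R)) (is_derive_c1 12^-1 s).
    have nf : f s != 0 by rewrite gt_eqF.
    rewrite (_ : g = (fun z => 0 - (f z ^+ 2)^-1 - z * 12^-1)); last by apply/funext => z; rewrite sub0r.
    by apply: (is_derive_eq (char_deriveB (char_deriveB (is_derive_c1 0 s) (derive_inv_square nf (Df s st))) D2)); rewrite /dg; ring.
  - move=> s /andP[s0 s1]; have st : 0 <= s <= tau by rewrite !ltW.
    have [h1 h2] := Tb s st; have fs := f0 s st.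
    rewrite /dg subr_ge0 ler_pdivlMr ?exprn_gt0//; move: h2; rewrite -/(f s); lra.
  - move=> e e0.
    have nf : f 0 != 0 by rewrite gt_eqF// f0// lexx.
    have e2 : 0 < e / 2 by rewrite divr_gt0.
    have /derive_cont1/cont1_epsP/(_ _ e2)[d1 d10 H1] := @derive_inv_square id (f 0) 1 nf (is_derive_id (f 0) (1 : R)).
    have [d2 d20 H2] := lft_right_cont 0 b cp d10; rewrite -[b]subr0 fE in H2.
    exists (Num.min d2 e); first by rewrite lt_min d20.
    move=> s /andP[s0]; rewrite lt_min => /andP[sd se].
    have /H1 H3 : `|f s - f 0| < d1 by apply: H2; rewrite s0.
    rewrite (_ : g s - g 0 = - (((f s) ^+ 2)^-1 - ((f 0) ^+ 2)^-1) - s / 12); last by rewrite /g; ring.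
    apply: le_lt_trans (ler_normB _ _) _; rewrite normrN (splitr e) ltrD//.
    by rewrite gtr0_norm ?divr_gt0//; lra.
have fb : 0 < f 0 by apply: f0; rewrite lexx.
have ft : 0 < f tau by apply: f0; rewrite lexx tau0'.
have V0 : 0 < (f tau) ^- 2 by rewrite invr_gt0 exprn_gt0.
have f00 : f 0 = p 0 b by rewrite /f subr0.
rewrite /g mul0r subr0 -f00 => H.
have : tau / 12 < (f 0) ^- 2 by lra.
have F0 : 0 < f 0 ^+ 2 by rewrite exprn_gt0.
by rewrite -(ltr_pM2l F0) mulfV ?gt_eqF//; lra.
Qed.

End Blowup1D.

(** * Solutions with locally plane data *)

Section PlaneData.
Context {R : realType}.
Implicit Types (p q : 'rV[R]_(1 + 3)) (x y : 'rV[R]_3) (u v : 'rV[R]_(1 + 3) -> R).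

Lemma kg_shift T u (v : 'rV[R]_(1 + 3)) : v 0 tI = 0 -> kg_solution T u ->
  kg_solution T (fun p => u (p + v)) /\ forall p, dt T (fun p => u (p + v)) p = dt T u (p + v).
Proof.
move=> v0 [Cu Eu].
have Dv p : time_slab T p <-> time_slab T (p + v).
  by split=> /slabE H; apply/slabE; move: H; rewrite mxE v0 addr0.
have E1 i : pderiv (time_slab T) i (fun p => u (p + v)) = (fun p => pderiv (time_slab T) i u (p + v)).
  by apply/funext => p; exact: pderiv_shift.
have E2 i j : pderiv (time_slab T) j (pderiv (time_slab T) i (fun p => u (p + v))) =
    (fun p => pderiv (time_slab T) j (pderiv (time_slab T) i u) (p + v)).
  by rewrite E1; apply/funext => p; exact: (@pderiv_shift _ _ (time_slab T) (pderiv (time_slab T) i u)).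
split; last by move=> p; rewrite /dt E1.
split; first exact: Ck_shift.
move=> p Dp; rewrite /dalembertian /dt /dx E2 !E1; under eq_bigr do rewrite E2.
exact: (Eu _ ((Dv p).1 Dp)).
Qed.

Lemma line_coord3 x a (h : R) i : (x + h *: delta_mx 0 a) 0 i = x 0 i + h * (i == a)%:R.
Proof. by rewrite !mxE eqxx. Qed.

Lemma event_shift (t h : R) x a : event t x + h *: delta_mx 0 (xI a) = event t (x + h *: delta_mx 0 a).
Proof.
apply/rowP => k; rewrite line_coord; case: (@split_ordP 1 3 k) => j ->.
  by rewrite (ord1 j) -/tI !event_tI eq_sym xI_tI mulr0 addr0.
by rewrite -/(xI j) !event_xI line_coord3 (inj_eq (@rshift_inj _ _)).
Qed.

Variables (T rho : R) (u : 'rV[R]_(1 + 3) -> R) (f0 g0 : R -> R).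
Hypotheses (Ku : kg_solution T u) (rho0 : 0 < rho)
  (Hf : forall x, (forall i, `|x 0 i| < rho) -> u (event 0 x) = f0 (x 0 0))
  (Hg : forall x, (forall i, `|x 0 i| < rho) -> dt T u (event 0 x) = g0 (x 0 0)).

(** The translate of u in a direction orthogonal to x_1 is a solution with the
    same data near the point. *)
Lemma transversal_shift a (h t : R) x : a != 0 -> 0 <= t -> t < T -> t < rho / 4 -> `|h| <= rho / 4 ->
  (forall i, `|x 0 i| <= rho / 2) -> u (event t x + h *: delta_mx 0 (xI a)) = u (event t x).
Proof.
move=> a0 t0 tT tr hr xr; pose m := Num.min T (rho / 4); pose r := (t + m) / 2.
have tm : t < m by rewrite lt_min tT.
have mT : m <= T by rewrite ge_min lexx.
have mr : m <= rho / 4 by rewrite ge_min lexx orbT.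
have rT : 0 < r < T by rewrite /r; apply/andP; split; lra.
have r0 : 0 < r by case/andP: rT.
have rr : r < rho / 4 by rewrite /r; lra.
have v0 : (h *: delta_mx 0 (xI a) : 'rV[R]_(1 + 3)) 0 tI = 0.
  by rewrite !mxE eq_sym xI_tI mulr0.
have [Kv Hv] := kg_shift v0 Ku.
apply: (cone_uniqueness rT Kv Ku); last by rewrite t0/= /r; lra.
move=> y Hy; rewrite Hv event_shift.
have yr i : `|y 0 i| < rho / 2 + rho / 4.
  have := coord_le_ball i r0 Hy; have := xr i; have := ler_normD (y 0 i - x 0 i) (x 0 i); rewrite subrK.
  by move: rr; clear; move: `|_| `|_| `|_| => b c d; lra.
have yr1 i : `|y 0 i| < rho by have := yr i; have := rho0; lra.
have zr i : `|(y + h *: delta_mx 0 a) 0 i| < rho.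
  rewrite line_coord3; apply: le_lt_trans (ler_normD _ _) _; rewrite normrM.
  have : `|h| * `|(i == a)%:R| <= `|h| by case: (i == a); rewrite ?normr1 ?normr0 ?mulr1 ?mulr0.
  move=> H; apply: le_lt_trans (lerD (lexx _) (le_trans H hr)) _; have := yr i; lra.
have z0 : (y + h *: delta_mx 0 a) 0 0 = y 0 0 by rewrite line_coord3 eq_sym (negbTE a0) mulr0 addr0.
by rewrite !Hf ?Hg// z0.
Qed.

Let D := time_slab T.

Lemma transversal_dx a (t : R) x : a != 0 -> 0 <= t -> t < T -> t < rho / 4 ->
  (forall i, `|x 0 i| <= rho / 2) -> pderiv D (xI a) u (event t x) = 0.
Proof.
move=> a0 t0 tT tr xr; have Dp : D (event t x) by apply/slabE; rewrite event_tI t0.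
have r4 : 0 < rho / 4 by rewrite divr_gt0.
have := (pderiv_is_derive (is_derive_cc (u (event t x)) (event t x) (delta_mx 0 (xI a))) (slab_proper _ Dp)).2.
move=> H; rewrite -[RHS]H; apply: (@pderiv_congr _ _ _ _ _ _ _ _ (rho / 4)) => // h hr.
by split=> // _; apply: transversal_shift => //; exact: ltW.
Qed.

(** The point at time t and position s on the first coordinate axis. *)
Definition axis (t s : R) : 'rV[R]_(1 + 3) := event t (s *: delta_mx 0 0).

Lemma axis_line t s (k h : R) : axis t s + k *: delta_mx 0 tI + h *: delta_mx 0 (xI 0) = axis (t + k) (s + h).
Proof.
apply/rowP => l; rewrite !line_coord; case: (@split_ordP 1 3 l) => j ->.
  by rewrite (ord1 j) -/tI !event_tI eqxx mulr1 eq_sym xI_tI mulr0 addr0.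
rewrite -/(xI j) xI_tI mulr0 addr0 !event_xI (inj_eq (@rshift_inj _ _)) !mxE/=; ring.
Qed.

Lemma axis_x t s (h : R) : axis t s + h *: delta_mx 0 (xI 0) = axis t (s + h).
Proof. by have := axis_line t s 0 h; rewrite scale0r !addr0. Qed.

Lemma axis_slab t s : 0 <= t < T -> D (axis t s).
Proof. by move=> tT; apply/slabE; rewrite event_tI. Qed.

Lemma axis_coord (s : R) i : `|s| <= rho / 2 -> `|(s *: delta_mx 0 0 : 'rV[R]_3) 0 i| <= rho / 2.
Proof.
move=> sr; rewrite !mxE eqxx/=; case: (i == 0); rewrite ?mulr1// mulr0 normr0; by have := rho0; lra.
Qed.

Let U1 i := pderiv D i u.
Let U2 j i := pderiv D j (pderiv D i u).

(** On the axis the derivatives in the two other variables vanish by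
    transversal_dx, so that the equation is one-dimensional. *)
Lemma axis_equation t s : 0 <= t -> t < T -> t < rho / 4 -> `|s| <= rho / 2 ->
  U2 tI tI (axis t s) - U2 (xI 0) (xI 0) (axis t s) + u (axis t s) =
  U1 tI (axis t s) ^+ 2 * U1 (xI 0) (axis t s).
Proof.
move=> t0 tT tr sr; have Dp : D (axis t s) by apply: axis_slab; rewrite t0.
rewrite -(Ku.2 _ Dp) /dalembertian /dt /dx -/tI; congr (_ - _ + _).
rewrite (bigD1 (0 : 'I_3))//= big1 ?addr0// => a a0; rewrite -/(xI a).
have := (pderiv_is_derive (is_derive_cc 0 (axis t s) (delta_mx 0 (xI a))) (slab_proper _ Dp)).2.
move=> H; rewrite -[RHS]H; apply: (@pderiv_congr _ _ _ _ _ _ _ _ (rho / 2)); first by rewrite divr_gt0.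
  by apply: transversal_dx => // i; exact: axis_coord.
move=> h hr; split=> // _; rewrite event_shift; apply: transversal_dx => // i.
rewrite line_coord3 !mxE eqxx/=; have [i0|] := eqVneq i 0.
  by rewrite i0 eq_sym (negbTE a0) mulr1 mulr0 addr0.
rewrite mulr0 add0r => _; case: (i == a); rewrite ?mulr1 ?mulr0 ?normr0; first exact: ltW.
by have := rho0; lra.
Qed.

Lemma axis_continuity (F : 'rV[R]_(1 + 3) -> R) t s : {within D, continuous F} -> 0 < t < T ->
  forall e, 0 < e -> exists2 d, 0 < d & forall k h : R, `|k| < d -> `|h| < d ->
    `|F (axis (t + k) (s + h)) - F (axis t s)| < e.
Proof.
move=> /within_epsP cF /andP[t0 tT] e e0.
have Dp : D (axis t s) by apply: axis_slab; rewrite (ltW t0).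
have [d d0 Hd] := cF _ Dp e e0; exists (Num.min d (Num.min t (T - t))); first by rewrite !lt_min d0 t0 subr_gt0.
move=> k h; rewrite !lt_min => /and3P[kd kt kT] /andP[hd _]; apply: Hd.
  by apply: axis_slab; move: kt kT; rewrite !ltr_norml => /andP[? ?] /andP[? ?]; apply/andP; split; lra.
move=> i; rewrite -axis_line !line_coord.
case: (@split_ordP 1 3 i) => j ->.
  rewrite (ord1 j) -/tI eqxx mulr1 eq_sym xI_tI mulr0 addr0; by rewrite addrC addKr.
rewrite -/(xI j) xI_tI mulr0 addr0 addrC addKr.
by case: eqP; rewrite ?mulr1 ?mulr0 ?normr0.
Qed.

Lemma axis_dx (F : 'rV[R]_(1 + 3) -> R) (t s : R) : Ck D 1 F -> 0 < t < T ->
  is_derive s 1 (fun h => F (axis t h)) (pderiv D (xI 0) F (axis t s)).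
Proof.
move=> CF tT; have tT' : 0 < axis t s 0 tI < T by rewrite event_tI.
have := Ck1_is_derive (xI 0) CF tT'.
have -> : axis t s = axis t 0 + s *: delta_mx 0 (xI 0) by rewrite axis_x add0r.
move/is_derive_line; rewrite (_ : (fun h => F (axis t 0 + h *: _)) = (fun h => F (axis t h)))//.
by apply/funext => h; rewrite axis_x add0r.
Qed.

Lemma axis_diag (F : 'rV[R]_(1 + 3) -> R) (c t s : R) : Ck D 1 F -> 0 < t < T ->
  is_derive (0 : R) 1 (fun k => F (axis (t + k) (s + c * k)))
    (pderiv D tI F (axis t s) + c * pderiv D (xI 0) F (axis t s)).
Proof.
move=> CF /[dup] tT /andP[t0 tT']; pose r := Num.min t (T - t).
have r0 : 0 < r by rewrite lt_min t0 subr_gt0.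
have near k : `|k| < r -> 0 < t + k < T.
  by rewrite lt_min !ltr_norml => /andP[/andP[? ?] /andP[? ?]]; apply/andP; split; lra.
have near' k h : `|k| < r -> 0 < axis (t + k) (s + h) 0 tI < T by rewrite event_tI; exact: near.
rewrite (_ : (fun k => _) = (fun k => F (axis (t + 1 * k) (s + c * k)))); last by apply/funext => k; rewrite mul1r.
have := @derive_diag R (fun k h => F (axis (t + k) (s + h)))
  (fun k => pderiv D tI F (axis (t + k) s)) (fun k h => pderiv D (xI 0) F (axis (t + k) (s + h))) r 1 c r0.
rewrite !addr0 (mul1r (pderiv _ _ _ _)); apply.
- move=> k kr; have := Ck1_is_derive tI CF (near' k 0 kr); rewrite addr0.
  have -> : axis (t + k) s = axis t s + k *: delta_mx 0 tI.
    by have := axis_line t s k 0; rewrite scale0r !addr0.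
  move/is_derive_line; rewrite (_ : (fun h => F (axis t s + h *: _)) = (fun h => F (axis (t + h) s)))//.
  by apply/funext => h; have := axis_line t s h 0; rewrite scale0r !addr0 => ->.
- move=> k h kr _; have H := @is_derive_shiftl R (fun z : R => F (axis (t + k) z)) s h _ (axis_dx (s + h) CF (near k kr)).
  exact: H.
exact: (axis_continuity s (CF.2 (xI 0)).2 tT).
Qed.

Definition riemann c P := U1 tI P - c * U1 (xI 0) P.
Definition riemann_x c P := U2 (xI 0) tI P - c * U2 (xI 0) (xI 0) P.
(** The function Ft of the one-dimensional system, in terms of u. *)
Definition source P := U1 tI P * U1 tI P * U1 (xI 0) P - u P.
Definition source_x P := 2 * U1 tI P * U2 (xI 0) tI P * U1 (xI 0) P + U1 tI P * U1 tI P * U2 (xI 0) (xI 0) P - U1 (xI 0) P.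

Let C2 : Ck D 2 u := Ku.1.
Let C1 i : Ck D 1 (U1 i) := (C2.2 i).2.
Let C0 j i : {within D, continuous (U2 j i)} := ((C2.2 i).2.2 j).2.

Section Point.
Variables (t s : R).
Hypotheses (tT : 0 < t < T) (tr : t < rho / 4) (sr : `|s| <= rho / 2).

Let wave_eq : U2 tI tI (axis t s) - U2 (xI 0) (xI 0) (axis t s) = source (axis t s).
Proof.
have /andP[t0 tT'] := tT; by rewrite /source -expr2 -(axis_equation (ltW t0) tT' tr sr) addrK.
Qed.

Let swap : U2 tI (xI 0) (axis t s) = U2 (xI 0) tI (axis t s).
Proof. by apply: pderiv_swap => //; rewrite event_tI. Qed.

Let riemann_diag c d : is_derive (0 : R) 1 (fun k => riemann c (axis (t + k) (s + d * k)))
  (U2 tI tI (axis t s) + (d - c) * U2 (xI 0) tI (axis t s) - c * d * U2 (xI 0) (xI 0) (axis t s)).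
Proof.
have D1 := axis_diag d s (C1 tI) tT; have D2 := derive1Z c (axis_diag d s (C1 (xI 0)) tT).
apply: (is_derive_eq (is_deriveB D1 D2)).
rewrite -[pderiv D tI (U1 tI)]/(U2 tI tI) -[pderiv D (xI 0) (U1 tI)]/(U2 (xI 0) tI).
rewrite -[pderiv D tI (U1 (xI 0))]/(U2 tI (xI 0)) -[pderiv D (xI 0) (U1 (xI 0))]/(U2 (xI 0) (xI 0)) swap.
by move: (U2 tI tI _) (U2 (xI 0) tI _) (U2 (xI 0) (xI 0) _); clear => x y z; ring.
Qed.

Lemma riemann_along c : c ^+ 2 = 1 ->
  is_derive (0 : R) 1 (fun k => riemann c (axis (t + k) (s + c * k))) (source (axis t s)).
Proof.
move=> c2; apply: (is_derive_eq (riemann_diag c c)).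
by rewrite subrr mul0r addr0 -expr2 c2 mul1r wave_eq.
Qed.

Lemma riemann_across c : c ^+ 2 = 1 ->
  is_derive (0 : R) 1 (fun k => riemann c (axis (t + k) (s + - c * k)))
   (source (axis t s) - 2 * c * riemann_x c (axis t s)).
Proof.
move=> c2; apply: (is_derive_eq (riemann_diag c (- c))); rewrite -wave_eq /riemann_x.
rewrite (_ : c * - c = - 1); last by rewrite mulrN -expr2 c2.
have {}c2 : 2 * c * c = 2 by rewrite -mulrA -expr2 c2 mulr1.
rewrite mulrBr (mulrA (2 * c) c) c2.
by move: (U2 tI tI _) (U2 (xI 0) tI _) (U2 (xI 0) (xI 0) _); clear => x y z; ring.
Qed.

End Point.

Lemma riemann_dx c (t s : R) : 0 < t < T ->
  is_derive s 1 (fun h => riemann c (axis t h)) (riemann_x c (axis t s)).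
Proof.
by move=> tT; exact: (is_deriveB (axis_dx s (C1 tI) tT) (derive1Z c (axis_dx s (C1 (xI 0)) tT))).
Qed.

Lemma source_dx (t s : R) : 0 < t < T ->
  is_derive s 1 (fun h => source (axis t h)) (source_x (axis t s)).
Proof.
move=> tT; have Dt := axis_dx s (C1 tI) tT; have Dx := axis_dx s (C1 (xI 0)) tT.
have Du := axis_dx s (Ck_le C2) tT.
rewrite (_ : (fun h => _) = (fun h => U1 tI (axis t h) * U1 tI (axis t h) * U1 (xI 0) (axis t h) - u (axis t h))); last first.
  by apply/funext => h; rewrite /source.
apply: (is_derive_eq (is_deriveB (derive1M (derive1M Dt Dt) Dx) Du)).
rewrite /source_x -[pderiv D (xI 0) (U1 tI)]/(U2 (xI 0) tI) -[pderiv D (xI 0) (U1 (xI 0))]/(U2 (xI 0) (xI 0)) -/(U1 (xI 0)).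
by move: (U2 (xI 0) tI _) (U2 (xI 0) (xI 0) _) (U1 tI _) (U1 (xI 0) _); clear => x y z w; ring.
Qed.

Lemma source_x_continuous : {within D, continuous source_x}.
Proof.
have cU1 i : {within D, continuous (U1 i)} := (C1 i).1.
have c2 : {within D, continuous (fun _ : 'rV[R]_(1 + 3) => 2 : R)} by exact: within_cst.
apply: withinB => //; apply: withinD.
  by apply: withinM => //; apply: withinM => //; exact: withinM.
by apply: withinM => //; exact: withinM.
Qed.

(** The solution has two derivatives only, so the equation for the x-derivative
    of a Riemann invariant cannot be obtained by differentiating the equation;
    exchanging the order of derivatives with derive_swap gives it along
    characteristics. *)
Lemma riemann_x_along c t s : c ^+ 2 = 1 -> 0 < t < T -> t < rho / 4 -> `|s| <= rho / 4 ->
  is_derive (0 : R) 1 (fun k => riemann_x c (axis (t + k) (s + c * k))) (source_x (axis t s)).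
Proof.
move=> c2 /[dup] tT /andP[t0 tT'] tr sr.
have c1 : `|c| = 1.
  by apply/eqP; rewrite -(@eqrXn2 _ 2)// expr1n real_normK ?num_real// c2.
pose r := Num.min (rho / 16) (Num.min t (Num.min (T - t) (rho / 4 - t))).
have r0 : 0 < r by rewrite !lt_min t0 !subr_gt0 tT' tr divr_gt0.
have near k : `|k| < r -> [/\ 0 < t + k < T, t + k < rho / 4 & `|k| < rho / 16].
  rewrite !lt_min => /and4P[k1]; rewrite 3!ltr_norml => /andP[? ?] /andP[? ?] /andP[? ?].
  by split; [apply/andP; split; lra|lra|exact: k1].
have nearx k h : `|k| < r -> `|h| < r -> `|s + c * k + h| <= rho / 2.
  move=> /near[_ _ kr] /near[_ _ hr]; apply: le_trans (ler_normD _ _) _.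
  have := ler_normD s (c * k); rewrite normrM c1 mul1r => H.
  apply: le_trans (lerD H (lexx _)) _; have := rho0; lra.
have := @derive_swap R (fun k h => riemann c (axis (t + k) (s + c * k + h)))
  (fun k h => source (axis (t + k) (s + c * k + h)))
  (fun k => riemann_x c (axis (t + k) (s + c * k)))
  (fun k h => source_x (axis (t + k) (s + c * k + h))) r r0.
rewrite !addr0 mulr0 addr0; apply.
- move=> k h kr hr; have [kT kr' _] := near k kr.
  have := riemann_along kT kr' (nearx k h kr hr) c2.
  have E : (fun k' => riemann c (axis (t + k + k') (s + c * k + h + c * k'))) =
     (fun k' => (fun l => riemann c (axis (t + l) (s + c * l + h))) (k + k')).
    by apply/funext => k'; congr riemann; congr axis; ring.
  rewrite E => H; apply/is_derive1_epsP => e e0.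
  have [d d0 Hd] := iffLR (is_derive1_epsP _ _ _) H e e0; exists d => // l ld.
  by have := Hd l ld; rewrite add0r addr0.
- move=> k kr; have [kT _ _] := near k kr; have H := riemann_dx c (s + c * k) kT.
  by apply: (@is_derive_shiftl R (fun z : R => riemann c (axis (t + k) z)) (s + c * k) 0); rewrite addr0.
- move=> k h kr hr; have [kT _ _] := near k kr.
  exact: (@is_derive_shiftl R (fun z : R => source (axis (t + k) z)) (s + c * k) h _ (source_dx (s + c * k + h) kT)).
move=> e e0; have [d d0 Hd] := axis_continuity s source_x_continuous tT e0.
exists (d / 2); first by rewrite divr_gt0.
move=> k h kd hd; rewrite -(addrA s (c * k) h); apply: Hd; first by lra.
apply: le_lt_trans (ler_normD _ _) _; rewrite normrM c1 mul1r; lra.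
Qed.

End PlaneData.

Lemma FpqE (R : realType) (x y : R) : Fpq (x - -1 * y) (x - 1 * y) = x * x * y.
Proof. by rewrite /Fpq; field. Qed.

Lemma Fpq_gradientE (R : realType) (x y x' y' : R) :
  Fp (x - -1 * y) (x - 1 * y) * (x' - -1 * y') + Fq (x - -1 * y) (x - 1 * y) * (x' - 1 * y')
    - (x - -1 * y - (x - 1 * y)) / 2 = 2 * x * x' * y + x * x * y' - y.
Proof. by rewrite /Fp /Fq; field. Qed.

Section Lifespan.
Context {R : realType}.
Variables (T rho : R) (u : 'rV[R]_(1 + 3) -> R) (f0 f1 f2 g0 g1 : R -> R).
Hypotheses (Ku : kg_solution T u) (rho0 : 0 < rho)
  (Hf : forall x : 'rV[R]_3, (forall i, `|x 0 i| < rho) -> u (event 0 x) = f0 (x 0 0))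
  (Hg : forall x : 'rV[R]_3, (forall i, `|x 0 i| < rho) -> dt T u (event 0 x) = g0 (x 0 0))
  (Df0 : forall x : R, is_derive x 1 f0 (f1 x)) (Df1 : forall x : R, is_derive x 1 f1 (f2 x))
  (Dg0 : forall x : R, is_derive x 1 g0 (g1 x)).

Let axis0 (s : R) i : `|s| < rho -> `|(s *: delta_mx 0 0 : 'rV[R]_3) 0 i| < rho.
Proof.
move=> sr; rewrite !mxE/=; case: (i == 0); rewrite ?mulr1// mulr0 normr0.
exact: rho0.
Qed.

Let axis00 (s : R) : (s *: delta_mx 0 0 : 'rV[R]_3) 0 0 = s.
Proof. by rewrite !mxE !eqxx mulr1. Qed.

Lemma axis_initial_dx (F : 'rV[R]_(1 + 3) -> R) (phi phi1 : R -> R) : 0 < T ->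
  (forall s, `|s| < rho -> F (axis 0 s) = phi s) -> (forall s : R, is_derive s 1 phi (phi1 s)) ->
  forall s, `|s| < rho -> pderiv (time_slab T) (xI 0) F (axis 0 s) = phi1 s.
Proof.
move=> T0 E Dphi s sr; have Ds : time_slab T (axis 0 s) by apply: axis_slab; rewrite lexx.
have r0 : 0 < rho - `|s| by rewrite subr_gt0.
suff D0 : is_derive (axis 0 s) (delta_mx 0 (xI 0)) F (phi1 s).
  exact: (pderiv_is_derive D0 (slab_proper _ Ds)).2.
apply/is_derive_line0.
have Dp : is_derive (0 : R) 1 (fun h : R => phi (s + h)) (phi1 s).
  by apply: is_derive_shiftl; rewrite addr0.
apply: (is_derive_near r0 _ Dp) => h hr; rewrite !add0r axis_x; apply: E.
by apply: le_lt_trans (ler_normD _ _) _; move: hr; lra.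
Qed.

Lemma axis_strip (F : 'rV[R]_(1 + 3) -> R) : {within time_slab T, continuous F} ->
  {within half_strip T, continuous (fun z => F (axis z.1 z.2))}.
Proof.
move=> /within_epsP cF; apply/subspace_continuousP => z Hz; apply/cvgrPdist_lt => e e0.
have [d d0 Hd] := cF _ (axis_slab z.2 Hz) e e0.
rewrite near_withinE; apply/nbhs_ballP; exists d => // y [b1 b2] Hy.
rewrite distrC; apply: Hd; first exact: axis_slab.
move=> i; rewrite -[y.1](subrK z.1) -[y.2](subrK z.2) (addrC _ z.1) (addrC _ z.2) -axis_line !line_coord.
case: (@split_ordP 1 3 i) => j ->.
  rewrite (ord1 j) -/tI eqxx mulr1 eq_sym xI_tI mulr0 addr0 addrC addKr distrC; exact: b1.
rewrite -/(xI j) xI_tI mulr0 addr0 addrC addKr.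
case: eqP; rewrite ?mulr1 ?mulr0 ?normr0// distrC => _; exact: b2.
Qed.

Let derive_at (g : R -> R) (t d : R) : is_derive (0 : R) 1 (fun k => g (t + k)) d -> is_derive t 1 g d.
Proof.
move=> H; apply/is_derive1_epsP => e e0.
have [r r0 Hr] := iffLR (is_derive1_epsP _ _ _) H e e0; exists r => // k kr.
by have := Hr k kr; rewrite add0r addr0.
Qed.

Let derive_lft (F : 'rV[R]_(1 + 3) -> R) (t s d : R) :
  is_derive (0 : R) 1 (fun k => F (axis (t + k) (s + -1 * k))) d ->
  is_derive t 1 (fun r => F (axis r (s + t - r))) d.
Proof.
move=> H; apply: derive_at; rewrite (_ : (fun k => _) = (fun k => F (axis (t + k) (s + -1 * k))))//.
by apply/funext => k; congr F; congr axis; ring.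
Qed.

Let derive_rgt (F : 'rV[R]_(1 + 3) -> R) (t s d : R) :
  is_derive (0 : R) 1 (fun k => F (axis (t + k) (s + 1 * k))) d ->
  is_derive t 1 (fun r => F (axis r (s - t + r))) d.
Proof.
move=> H; apply: derive_at; rewrite (_ : (fun k => _) = (fun k => F (axis (t + k) (s + 1 * k))))//.
by apply/funext => k; congr F; congr axis; ring.
Qed.

(** The hypothesis on [a, b] states that the data are trapped at time 0. *)
Theorem lifespan_bound (a b tau pm eps Wm : R) : 0 < tau -> tau < T -> tau < rho / 4 ->
  a + tau <= b - tau -> - (rho / 4) <= a -> b <= rho / 4 ->
  0 < pm -> 0 < eps -> 3 / 2 <= eps * pm -> Wm <= pm ^+ 3 / 24 ->
  (forall x, a <= x <= b -> [/\ pm < g0 x + f1 x, 0 < g0 x - f1 x, 3 * (g0 x - f1 x) < g0 x + f1 x &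
     [/\ g0 x ^+ 2 * f1 x - f0 x + eps < g1 x + f2 x, g0 x ^+ 2 * f1 x - f0 x < 3 * (g1 x - f2 x) &
       8 < (Wm - f0 x) * (g0 x + f1 x)]]) ->
  (g0 b + f1 b) ^+ 2 * tau < 12.
Proof.
move=> tau0 tauT taur ab ar br pm0 eps0 epsm Wmm init.
have T0 : 0 < T := lt_trans tau0 tauT.
have C2 := Ku.1; have C1 i : Ck (time_slab T) 1 (pderiv (time_slab T) i u) := (C2.2 i).2.
pose p t s := riemann T u (-1) (axis t s); pose q t s := riemann T u 1 (axis t s).
pose w t s := u (axis t s).
pose px t s := riemann_x T u (-1) (axis t s); pose qx t s := riemann_x T u 1 (axis t s).
have cc (c : R) : {within time_slab T, continuous (fun _ : 'rV[R]_(1 + 3) => c)} by exact: within_cst.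
have c1 c : {within time_slab T, continuous (riemann T u c)}.
  by apply: withinB; [exact: (C1 tI).1|apply: withinM => //; exact: (C1 (xI 0)).1].
have c2 c : {within time_slab T, continuous (riemann_x T u c)}.
  by apply: withinB; [exact: ((C1 tI).2 (xI 0)).2|apply: withinM => //; exact: ((C1 (xI 0)).2 (xI 0)).2].
have one : (1 : R) ^+ 2 = 1 by rewrite expr1n.
have mone : (-1 : R) ^+ 2 = 1 by rewrite sqrrN expr1n.
have pt t s : in_triangle a b tau t s -> 0 < t -> [/\ 0 < t < T, t < rho / 4, `|s| <= rho / 4 & `|s| <= rho / 2].
  move=> [t0 tt h1 h2] t0'; have s4 : `|s| <= rho / 4 by rewrite ler_norml; apply/andP; split; lra.
  by split=> //; [apply/andP; split; lra|lra|have := rho0; lra].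
have FtE t s : Ft p q w t s = source T u (axis t s).
  by rewrite /Ft /p /q /w /riemann FpqE.
have FxE t s : Fx p q px qx t s = source_x T u (axis t s).
  by rewrite /Fx /p /q /px /qx /riemann /riemann_x Fpq_gradientE.
have B : p 0 b ^+ 2 * tau < 12.
  apply: (@blowup_time R T a b tau p q w px qx tau0 tauT ab
    (axis_strip (c1 _)) (axis_strip (c1 _)) (axis_strip C2.1) (axis_strip (c2 _)) (axis_strip (c2 _))
    _ _ _ _ _ _ _ _ pm eps Wm pm0 eps0 epsm Wmm).
  - move=> t s D0 /(pt _ _ D0)[tT tr _ s2]; rewrite FtE; apply: derive_lft.
    exact: (riemann_along Ku rho0 Hf Hg tT tr s2 mone).
  - move=> t s D0 /(pt _ _ D0)[tT tr _ s2]; rewrite FtE; apply: derive_rgt.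
    have := riemann_across Ku rho0 Hf Hg tT tr s2 mone; rewrite opprK => H.
    by apply: (is_derive_eq H); rewrite /px; ring.
  - move=> t s D0 /(pt _ _ D0)[tT tr _ s2]; rewrite FtE; apply: derive_rgt.
    exact: (riemann_along Ku rho0 Hf Hg tT tr s2 one).
  - move=> t s D0 /(pt _ _ D0)[tT tr _ s2]; rewrite FtE; apply: derive_lft.
    have := riemann_across Ku rho0 Hf Hg tT tr s2 one => H.
    by apply: (is_derive_eq H); rewrite /qx mulr1.
  - move=> t s D0 /(pt _ _ D0)[tT tr _ s2]; apply: derive_lft.
    apply: (is_derive_eq (axis_diag (-1) s (Ck_le C2) tT)); rewrite /q /riemann mul1r mulN1r //.
  - move=> t s D0 /(pt _ _ D0)[tT tr _ s2]; apply: derive_rgt.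
    apply: (is_derive_eq (axis_diag 1 s (Ck_le C2) tT)); rewrite /p /riemann mul1r mulN1r opprK //.
  - move=> t s D0 /(pt _ _ D0)[tT tr s4 _]; rewrite FxE; apply: derive_lft.
    exact: (riemann_x_along Ku rho0 Hf Hg mone tT tr s4).
  - move=> t s D0 /(pt _ _ D0)[tT tr s4 _]; rewrite FxE; apply: derive_rgt.
    exact: (riemann_x_along Ku rho0 Hf Hg one tT tr s4).
  move=> x [_ _]; rewrite addr0 subr0 => ax xb.
  have xr : `|x| < rho by rewrite ltr_norml; have := rho0; move=> ?; apply/andP; split; lra.
  have e0 s : `|s| < rho -> u (axis 0 s) = f0 s.
    by move=> sr; rewrite Hf ?axis00// => i; exact: axis0.
  have eg s : `|s| < rho -> pderiv (time_slab T) tI u (axis 0 s) = g0 s.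
    by move=> sr; rewrite -[LHS]/(dt T u _) Hg ?axis00// => i; exact: axis0.
  have e1 := axis_initial_dx T0 e0 Df0; have e2 := axis_initial_dx T0 e1 Df1.
  have e3 := axis_initial_dx T0 eg Dg0.
  have [|h1 h2 h3 [h4 h5 h6]] := init x; first by rewrite ax.
  rewrite /trapped /gap_p /gap_pq /gap_px /gap_qx /gap_w !FtE /p /q /w /px /qx /source /riemann /riemann_x.
  rewrite e0// eg// e1// e2// e3// -expr2 !mulN1r !opprK !mul1r.
  by split; [lra|lra|lra|split; lra].
have br' : `|b| < rho.
  by rewrite ltr_norml; have := rho0; move=> ?; apply/andP; split; lra.
move: B; rewrite /p /riemann mulN1r opprK.
have e0 s : `|s| < rho -> u (axis 0 s) = f0 s.
  by move=> sr; rewrite Hf ?axis00// => i; exact: axis0.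
rewrite (axis_initial_dx T0 e0 Df0)// -[pderiv _ tI u _]/(dt T u _) Hg ?axis00// => i.
exact: axis0.
Qed.

End Lifespan.

(** * Power data concentrating at the origin *)

Section PowerData.
Context {R : realType}.

Lemma power_derive (c : R) n (x : R) : is_derive x 1 (fun y : R => c * y ^+ n) (c * (n%:R * x ^+ n.-1)).
Proof.
apply: derive1Z; elim: n => [|n IH].
  by apply: (is_derive_eq (is_derive_c1 1 x)); rewrite mul0r.
rewrite (_ : (fun y => _) = (fun y => y * y ^+ n)); last by apply/funext => y; rewrite exprS.
apply: (is_derive_eq (derive1M (derive1_id x) IH)); rewrite /= -natr1.
by case: n {IH} => [|n] /=; rewrite ?exprS; ring.
Qed.

End PowerData.

Section PowerEstimates.
Context {R : realType}.
Variables (B L : R).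
Hypotheses (B0 : 0 < B) (L0 : 0 < L) (Lsmall : L * 2 ^+ 31 <= 1) (BL : B ^+ 2 * L ^+ 31 = 50).

(** Half of the smallest value of p at time 0 on [L/2, L]. *)
Definition pmin := 2^-1 * (B * (L / 2) ^+ 15).
(** Half of the smallest value of px at time 0 on [L/2, L]. *)
Definition pxmin := 15 / 2 * (B * (L / 2) ^+ 14).
(** The largest value of u at time 0 on [L/2, L], plus what the last gap of
    trapped requires. *)
Definition wmax := B / 40 * L ^+ 16 + 8 / pmin.

Let L2 : 0 < L / 2. Proof. by rewrite divr_gt0. Qed.

Lemma pmin_gt0 : 0 < pmin. Proof. by rewrite /pmin !mulr_gt0// exprn_gt0. Qed.
Lemma pxmin_gt0 : 0 < pxmin. Proof. by rewrite /pxmin !mulr_gt0// exprn_gt0. Qed.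

Lemma L_le1 : L <= 1.
Proof.
apply: le_trans Lsmall; rewrite ler_peMr//; first exact: ltW.
by rewrite exprn_ege1// ler1n.
Qed.

Lemma pxmin_pmin : 3 / 2 <= pxmin * pmin.
Proof.
have E : (pxmin * pmin) * (2 ^+ 29 * (L * L)) = 15 / 4 * 50.
  rewrite -BL /pxmin /pmin !expr_div_n; field.
  by [].
have h : 2 ^+ 29 * (L * L) <= 1.
  rewrite mulrCA mulrA mulr_ile1//; [by rewrite mulr_ge0 ?exprn_ge0 ?ltW|exact: ltW| |exact: L_le1].
  apply: le_trans Lsmall; apply: ler_wpM2l; first exact: ltW.
  by rewrite ler_weXn2l// ler1n.
have := mulr_gt0 pxmin_gt0 pmin_gt0; have H0 : 0 < 2 ^+ 29 * (L * L) by rewrite !mulr_gt0// exprn_gt0.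
move: (pxmin * pmin) (2 ^+ 29 * (L * L)) E h H0; clear => a b E h H0 a0.
have := ler_wpM2l (ltW a0) h; rewrite E; lra.
Qed.

Lemma wmax_le : wmax <= pmin ^+ 3 / 24.
Proof.
pose be := B * L ^+ 15; have be0 : 0 < be by rewrite mulr_gt0// exprn_gt0.
have b2L : be ^+ 2 * L = 50 by rewrite -BL /be; ring.
have pE : pmin = be / 2 ^+ 16 by rewrite /pmin /be expr_div_n; field.
have b36 : 2 ^+ 36 <= be ^+ 2.
  rewrite -(ler_pM2r L0) b2L; have -> : 2 ^+ 36 * L = 32 * (L * 2 ^+ 31) by ring.
  by move: (L * 2 ^+ 31) Lsmall => z; lra.
have b72 : 2 ^+ 72 <= be ^+ 4.
  have -> : be ^+ 4 = be ^+ 2 * be ^+ 2 by ring.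
  have -> : 2 ^+ 72 = 2 ^+ 36 * 2 ^+ 36 :> R by rewrite -exprD.
  by apply: ler_pM => //; rewrite exprn_ge0.
have k19 : 4 <= 2 ^+ 19 :> R.
  have -> : 4 = 2 ^+ 2 :> R by ring.
  by rewrite ler_weXn2l// ler1n.
rewrite -(ler_pM2r be0) pE /wmax pE.
have -> : (B / 40 * L ^+ 16 + 8 / (be / 2 ^+ 16)) * be = 50 / 40 + 2 ^+ 19.
  have -> : B / 40 * L ^+ 16 = be * L / 40 by rewrite /be; field.
  rewrite -b2L; have -> : 2 ^+ 19 = 8 * 2 ^+ 16 :> R by rewrite (exprD 2 3 16); ring.
  move: (2 ^+ 16) (exprn_gt0 16 (ltr0n R 2)) => z z0; field.
  by rewrite !gt_eqF.
have -> : (be / 2 ^+ 16) ^+ 3 / 24 * be = be ^+ 4 / 2 ^+ 48 / 24.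
  have -> : 2 ^+ 48 = (2 ^+ 16) ^+ 3 :> R by rewrite -exprM.
  by move: (2 ^+ 16) (exprn_gt0 16 (ltr0n R 2)) => z z0; field; rewrite gt_eqF.
have z0 : 0 < 2 ^+ 48 :> R by rewrite exprn_gt0.
rewrite ler_pdivlMr// ler_pdivlMr//; apply: le_trans b72.
have -> : 2 ^+ 72 = 32 * 2 ^+ 19 * 2 ^+ 48 :> R.
  have -> : 32 = 2 ^+ 5 :> R by ring.
  by rewrite -!exprD.
rewrite ler_pM2r//; move: (2 ^+ 19) k19 => z; lra.
Qed.

(** With exponent 15 for p, p^3 against p_x compares (18/125) B^2 x^31 with 15,
    and B^2 L^31 = 50 makes the ratio smaller than 1/2. *)
Lemma power_data_trapped x : L / 2 <= x <= L ->
  [/\ pmin < 3 / 5 * B * x ^+ 15 + B / 40 * (16 * x ^+ 15),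
      0 < 3 / 5 * B * x ^+ 15 - B / 40 * (16 * x ^+ 15),
      3 * (3 / 5 * B * x ^+ 15 - B / 40 * (16 * x ^+ 15)) < 3 / 5 * B * x ^+ 15 + B / 40 * (16 * x ^+ 15) &
   [/\ (3 / 5 * B * x ^+ 15) ^+ 2 * (B / 40 * (16 * x ^+ 15)) - B / 40 * x ^+ 16 + pxmin
         < 3 / 5 * B * (15 * x ^+ 14) + B / 40 * 16 * (15 * x ^+ 14),
       (3 / 5 * B * x ^+ 15) ^+ 2 * (B / 40 * (16 * x ^+ 15)) - B / 40 * x ^+ 16
         < 3 * (3 / 5 * B * (15 * x ^+ 14) - B / 40 * 16 * (15 * x ^+ 14)) &
       8 < (wmax - B / 40 * x ^+ 16) * (3 / 5 * B * x ^+ 15 + B / 40 * (16 * x ^+ 15))]].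
Proof.
move=> /andP[xl xL]; have x0 : 0 < x := lt_le_trans L2 xl.
have x0' := ltW x0; have L2' := ltW L2; have L0' := ltW L0; have B0' := ltW B0.
have B40 : 0 <= B / 40 by rewrite divr_ge0.
have pw n : (L / 2) ^+ n <= x ^+ n by apply: lerXn2r; rewrite ?nnegrE.
have pw' n : x ^+ n <= L ^+ n by apply: lerXn2r; rewrite ?nnegrE.
have P0 : 0 < B * x ^+ 15 by rewrite mulr_gt0// exprn_gt0.
have Y0 : 0 < B * x ^+ 14 by rewrite mulr_gt0// exprn_gt0.
have hp : pmin <= 2^-1 * (B * x ^+ 15) by rewrite /pmin ler_wpM2l// ler_wpM2l.
have hpx : pxmin <= 15 / 2 * (B * x ^+ 14).
  by rewrite /pxmin; apply: ler_wpM2l; [rewrite divr_ge0|apply: ler_wpM2l].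
have f0 : 0 <= B / 40 * x ^+ 16 by rewrite mulr_ge0// exprn_ge0.
have f1 : B / 40 * x ^+ 16 <= B / 40 * L ^+ 16 by rewrite ler_wpM2l.
have S1 : (3 / 5 * B * x ^+ 15) ^+ 2 * (B / 40 * (16 * x ^+ 15)) <= 36 / 5 * (B * x ^+ 14).
  have -> : (3 / 5 * B * x ^+ 15) ^+ 2 * (B / 40 * (16 * x ^+ 15)) = 18 / 125 * (B * x ^+ 14) * (B ^+ 2 * x ^+ 31) by field.
  have : B ^+ 2 * x ^+ 31 <= 50 by rewrite -BL ler_wpM2l ?sqr_ge0.
  move: (B ^+ 2 * x ^+ 31) (B * x ^+ 14) Y0 => z y y0 z50.
  have := ler_wpM2l (ltW y0) z50; lra.
have e1 : 3 / 5 * B * x ^+ 15 + B / 40 * (16 * x ^+ 15) = B * x ^+ 15 by field.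
have e2 : 3 / 5 * B * x ^+ 15 - B / 40 * (16 * x ^+ 15) = 5^-1 * (B * x ^+ 15) by field.
have e3 : 3 / 5 * B * (15 * x ^+ 14) + B / 40 * 16 * (15 * x ^+ 14) = 15 * (B * x ^+ 14) by field.
have e4 : 3 / 5 * B * (15 * x ^+ 14) - B / 40 * 16 * (15 * x ^+ 14) = 3 * (B * x ^+ 14) by field.
rewrite e1 e2 e3 e4; have pm0 := pmin_gt0.
have W : 8 < (wmax - B / 40 * x ^+ 16) * (B * x ^+ 15).
  have h : 8 / pmin <= wmax - B / 40 * x ^+ 16 by rewrite /wmax; move: f1; lra.
  apply: (@lt_le_trans _ _ (8 / pmin * (B * x ^+ 15))); last by apply: ler_wpM2r h; exact: ltW.
  rewrite mulrAC ltr_pdivlMr// ltr_pM2l//; move: hp P0; move: (B * x ^+ 15) => z; lra.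
move: hp hpx f0 S1 P0 Y0 pm0 W; move: (_ ^+ 2 * _) (B / 40 * _) (B * x ^+ 15) (B * x ^+ 14) pmin pxmin.
by clear => s f p y pm px *; split; [lra|lra|lra|split; lra].
Qed.

Lemma power_data_contra : 12 <= (3 / 5 * B * L ^+ 15 + B / 40 * (16 * L ^+ 15)) ^+ 2 * (L / 4).
Proof.
have -> : (3 / 5 * B * L ^+ 15 + B / 40 * (16 * L ^+ 15)) ^+ 2 * (L / 4) = B ^+ 2 * L ^+ 31 / 4 by field.
rewrite BL; lra.
Qed.

End PowerEstimates.

Section Assembly.
Context {R : realType}.

Lemma wiener_sub (X Y : set 'rV[R]_3) F : X `<=` Y -> wiener Y F -> wiener X F.
Proof. by move=> XY [S [M [SM SF]]]; exists S, M; split=> // x /XY; exact: SF. Qed.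

Lemma wiener_prod (h : 'I_3 -> R -> R) (d : R) : (forall i, smooth 4 (h i)) ->
  (forall i y, 1 <= `|y| -> h i y = 0) -> 0 < d ->
  wiener [set x | forall i, `|x 0 i| <= 3/2 * d] (fun x => \prod_(i < 3) h i ((d^-1 *: x) 0 i)).
Proof.
move=> Sh h0 d0.
have H i : wiener [set x | forall i, `|x 0 i| <= 3/2 * d] (fun x => h i (d^-1 * x 0 i)).
  by apply: wiener_sub (wiener_coord i (Sh i) (h0 i) d0) => x /(_ i).
have := wienerM (H ord0) (wienerM (H (lift ord0 ord0)) (H (lift ord0 (lift ord0 ord0)))).
rewrite (_ : (fun x => _) = (fun x : 'rV[R]_3 => \prod_(i < 3) h i ((d^-1 *: x) 0 i)))//.
by apply/funext => x; rewrite !big_ord_recl big_ord0 !mxE mulr1.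
Qed.

(** Large enough for the length L of short_pulse_blowup to be at most d/8. *)
Definition amp : R := 50 * 8 ^+ 31.
Lemma amp_gt0 : 0 < amp. Proof. by rewrite mulr_gt0// exprn_gt0. Qed.

Variable chi : R -> R.
Hypotheses (chiS : forall k, smooth k chi) (chi1 : forall x, `|x| <= 2^-1 -> chi x = 1)
  (chi0 : forall x, 1 <= `|x| -> chi x = 0).

Definition profile (c : R) n (i : 'I_3) : R -> R :=
  if i == 0 then (fun y => c * y ^+ n * chi y) else chi.
Definition datum c n (x : 'rV[R]_3) := \prod_(i < 3) profile c n i (x 0 i).

Lemma profile_smooth c n i k : smooth k (profile c n i).
Proof.
rewrite /profile; case: eqP => _ //; apply: smoothM => //; apply: smoothM; first exact: smooth_cst.
by apply: smoothX; exact: smooth_id.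
Qed.

Lemma profile0 c n i y : 1 <= `|y| -> profile c n i y = 0.
Proof. by move=> y1; rewrite /profile; case: eqP => _; rewrite chi0// mulr0. Qed.

Lemma datum_inner c n (d : R) (x : 'rV[R]_3) : 0 < d -> (forall i, `|x 0 i| < d / 2) ->
  datum c n (d^-1 *: x) = c * (d^-1 * x 0 0) ^+ n.
Proof.
move=> d0 xd; have X i : chi ((d^-1 *: x) 0 i) = 1.
  apply: chi1; rewrite mxE normrM ger0_norm ?invr_ge0; last exact: ltW.
  by rewrite ler_pdivrMl// ltW.
rewrite /datum (bigD1 (0 : 'I_3))//= big1 ?mulr1; last by move=> i /negbTE i0; rewrite /profile i0 X.
by rewrite /profile eqxx X mulr1 mxE.
Qed.

Lemma datum_outer c n (d : R) (x : 'rV[R]_3) i : 0 < d -> d <= `|x 0 i| -> datum c n (d^-1 *: x) = 0.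
Proof.
move=> d0 xd; rewrite /datum (bigD1 i)//= profile0 ?mul0r// mxE normrM ger0_norm ?invr_ge0; last exact: ltW.
by rewrite ler_pdivlMl// mulr1.
Qed.

(** L is d times the 31st root of 50 / (amp^2 d^(2 nu + 1)); the denominator is
    at least amp^2 because 2 nu + 1 <= 0 and d <= 1. *)
Lemma short_pulse_blowup (nu d : R) : nu <= - 2^-1 -> 0 < d -> d * 2 ^+ 31 <= 1 ->
  blows_up_in_finite_time
    (fun x => d `^ (nu + 1) * datum (amp / 40) 16 (d^-1 *: x))
    (fun x => d `^ nu * datum (3 / 5 * amp) 15 (d^-1 *: x)).
Proof.
move=> hnu d0 dsmall; set f := fun x => _; set g := fun x => _.
have d1 : d <= 1 := L_le1 d0 dsmall.
pose E := d `^ nu; have E0 : 0 < E by rewrite powR_gt0.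
have Ed : d `^ (nu + 1) = E * d.
  by rewrite powRD ?powRr1 ?(ltW d0)// (gt_eqF d0) implybT.
have E2 : 1 <= E ^+ 2 * d.
  have -> : E ^+ 2 = d `^ (nu * 2) by rewrite -(powR_mulrn 2 (ltW E0)) /E -powRrM.
  have h : d `^ (-1) <= d `^ (nu * 2) by apply: ger_powR; [rewrite d0 d1|lra].
  have := ler_wpM2r (ltW d0) h; rewrite powR_inv1 ?mulVf ?gt_eqF//; exact: ltW.
have a0 := amp_gt0.
(* L is d * lam, and lam31 is what B^2 L^31 = 50 requires of lam^31 *)
pose lam31 := 50 / (amp ^+ 2 * (E ^+ 2 * d)).
have D0 : 0 < amp ^+ 2 * (E ^+ 2 * d) by rewrite !mulr_gt0// exprn_gt0.
have l0 : 0 < lam31 by rewrite divr_gt0.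
pose lam := lam31 `^ (31%:R^-1).
have lam0 : 0 < lam by rewrite powR_gt0.
have lamE : lam ^+ 31 = lam31.
  by rewrite -(powR_mulrn 31 (ltW lam0)) /lam -powRrM mulVf ?powRr1 ?ltW// pnatr_eq0.
have lam8 : lam <= 8^-1.
  have amp2 : 50 * 8 ^+ 31 <= amp ^+ 2 * (E ^+ 2 * d).
    apply: (@le_trans _ _ (amp ^+ 2)); last by rewrite ler_peMr// sqr_ge0.
    by rewrite -/amp expr2 ler_peMl ?(ltW a0)// /amp mulr_ege1// ?exprn_ege1// ler1n.
  have e8 : 0 < 8 ^+ 31 :> R by rewrite exprn_gt0.
  have : lam ^+ 31 <= 8^-1 ^+ 31.
    by rewrite lamE /lam31 ler_pdivrMr// exprVn ler_pdivlMl// mulrC.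
  by rewrite ler_pXn2r// nnegrE; exact: ltW.
pose L := d * lam; have L0 : 0 < L by rewrite mulr_gt0.
pose B := amp * E / d ^+ 15; have B0 : 0 < B by rewrite divr_gt0 ?mulr_gt0 ?exprn_gt0.
have BL : B ^+ 2 * L ^+ 31 = 50.
  have -> : B ^+ 2 * L ^+ 31 = amp ^+ 2 * (E ^+ 2 * d) * lam ^+ 31.
    by rewrite /B /L !exprMn; move: (lam ^+ 31) => z; field; rewrite gt_eqF.
  by rewrite lamE /lam31 mulrC divfK// gt_eqF.
have Ld : L <= d / 8 by rewrite /L ler_wpM2l// ltW.
have Lsmall : L * 2 ^+ 31 <= 1.
  by apply: le_trans dsmall; apply: ler_wpM2r; [rewrite exprn_ge0|move: Ld d0; lra].
have rho0 : 0 < d / 2 by rewrite divr_gt0.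
apply: (@blowup_of_bounded_lifespan R f g (L / 4)).
  apply: (@truncated_solution R f g d d0).
  - by move=> x i xi; rewrite /f /g !(datum_outer _ _ d0 xi) !mulr0.
  - apply: wienerZ; apply: wiener_prod => // [i|i y]; [exact: profile_smooth|exact: profile0].
  apply: wienerZ; apply: wiener_prod => // [i|i y]; [exact: profile_smooth|exact: profile0].
move=> T u /classical_kg[T0 Ku uf ug]; rewrite leNgt; apply/negP => LT.
have Hf (x : 'rV[R]_3) : (forall i, `|x 0 i| < d / 2) -> u (event 0 x) = B / 40 * x 0 0 ^+ 16.
  move=> xd; rewrite uf /f datum_inner// Ed /B exprMn exprVn.
  by move: (x 0 0 ^+ 16) => z; field; rewrite gt_eqF.
have Hg (x : 'rV[R]_3) : (forall i, `|x 0 i| < d / 2) -> dt T u (event 0 x) = 3 / 5 * B * x 0 0 ^+ 15.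
  move=> xd; rewrite ug /g datum_inner// -/E /B exprMn exprVn.
  by move: (x 0 0 ^+ 15) => z; field; rewrite gt_eqF.
have D1 (x : R) : is_derive x 1 (fun y : R => B / 40 * (16 * y ^+ 15)) (B / 40 * 16 * (15 * x ^+ 14)).
  rewrite (_ : (fun y : R => _) = (fun y => B / 40 * 16 * y ^+ 15)); last by apply/funext => y; rewrite mulrA.
  exact: power_derive.
have := @lifespan_bound R T (d / 2) u (fun y => B / 40 * y ^+ 16) (fun y => B / 40 * (16 * y ^+ 15))
  (fun y => B / 40 * 16 * (15 * y ^+ 14)) (fun y => 3 / 5 * B * y ^+ 15) (fun y => 3 / 5 * B * (15 * y ^+ 14))
  Ku rho0 Hf Hg (power_derive _ 16) D1 (power_derive _ 15) (L / 2) L (L / 4) (pmin B L) (pxmin B L) (wmax B L).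
have tau0 : 0 < L / 4 by rewrite divr_gt0.
have r1 : L / 4 < d / 2 / 4 by move: Ld d0; lra.
have r2 : L / 2 + L / 4 <= L - L / 4 by lra.
have r3 : - (d / 2 / 4) <= L / 2 by move: L0 d0; lra.
have r4 : L <= d / 2 / 4 by move: Ld; lra.
move=> /(_ tau0 LT r1 r2 r3 r4 (pmin_gt0 B0 L0) (pxmin_gt0 B0 L0) (pxmin_pmin B0 L0 Lsmall BL)
  (wmax_le B0 L0 Lsmall BL) (power_data_trapped B0 L0 BL)).
by rewrite ltNge (power_data_contra BL).
Qed.

End Assembly.

Theorem theorem1p2 (R : realType) (nu : R) (hnu : nu <= - 2^-1) :
  exists S : set (('rV[R]_3 -> R) * ('rV[R]_3 -> R)),
    S !=set0 /\
    forall u0 u1 : 'rV[R]_3 -> R, S (u0, u1) ->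
      [/\ Cc_infty u0, Cc_infty u1 &
          \forall delta \near 0^'+,
            blows_up_in_finite_time
              (fun x => delta `^ (nu + 1) * u0 (delta^-1 *: x))
              (fun x => delta `^ nu * u1 (delta^-1 *: x))].
Proof.
have [chi [chiS chi1 chi0]] := @cutoff_ex R.
(* 1/40 = (2/5)/16, so that p = B x^15 and q = p / 5 on the cube *)
exists [set (datum chi (amp / 40) 16, datum chi (3 / 5 * amp) 15)].
split; first by exists (datum chi (amp / 40) 16, datum chi (3 / 5 * amp) 15).
move=> u0 u1 /= [-> ->]; split.
- by apply: Cc_infty_prod => [i k|i x]; [exact: profile_smooth|exact: profile0].
- by apply: Cc_infty_prod => [i k|i x]; [exact: profile_smooth|exact: profile0].
have e0 : 0 < (2 ^+ 31)^-1 :> R by rewrite invr_gt0 exprn_gt0.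
near=> delta; have d0 : 0 < delta by near: delta; exact: nbhs_right_gt.
apply: short_pulse_blowup => //.
rewrite -ler_pdivlMr ?exprn_gt0// mul1r; near: delta; exact: nbhs_right_le.
Unshelve. all: by end_near. Qed.
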